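(* Let $n,d,k\ge1$, $0=r_0<r_1<\dots<r_k<\infty$, $T>0$ and $\frac13<\kappa<\gamma$. Let $x:[-r_k,T]\to\mathbb{R}^d$ be a $\gamma$-Hölder continuous path which admits a delayed Lévy area, i.e. for each $v\in\{-r_k,\dots,-r_1,-r_0\}$ there is given $\mathbf{x}^{\mathbf 2}(v)\in\mathcal{C}_2^{2\gamma}([0,T];\mathbb{R}^{d,d})$ with $$(\delta\mathbf{x}^{\mathbf 2}(v))_{sut}(i,j)=(\delta x^i)_{s+v,u+v}\,(\delta x^j)_{ut}\qquad\text{for all }s,u,t\in[0,T],\ 1\le i,j\le d.$$ Let $\xi\in\mathcal{C}_1^{2\kappa}([-r_k,0];\mathbb{R}^n)$ and $\sigma\in C_b^3(\mathbb{R}^{n,k+1};\mathbb{R}^{n,d})$. Then: (1) The equation $$dy_t=\sigma(y_t,y_{t-r_1},\dots,y_{t-r_k})\,dx_t,\quad t\in[0,T],\qquad y_t=\xi_t,\quad t\in[-r_k,0],$$ admits a unique solution $y$ in $\mathcal{Q}_{\kappa,\xi_0}([0,T];\mathbb{R}^n)$, for any $\frac13<\kappa<\gamma$ and any $T>0$. (2) Let $F$ be the mapping which sends $(\xi,x,\mathbf{x}^{\mathbf 2}(0),\mathbf{x}^{\mathbf 2}(-r_1),\dots,\mathbf{x}^{\mathbf 2}(-r_k))$, with $\xi\in\mathcal{C}_1^{2\gamma}([-r_k,0];\mathbb{R}^n)$, $x:[-r_k,T]\to\mathbb{R}^d$ a $\gamma$-Hölder continuous path, and $\mathbf{x}^{\mathbf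 2}(-r_i)\in\mathcal{C}_2^{2\gamma}([0,T];\mathbb{R}^{d,d})$, $0\le i\le k$, satisfying $(\delta\mathbf{x}^{\mathbf 2}(-r_i))_{sut}(p,q)=(\delta x^p)_{s-r_i,u-r_i}\,(\delta x^q)_{ut}$ for all $s,u,t\in[0,T]$ and $1\le p,q\le d$, to the unique solution $y\in\mathcal{C}_1^\kappa([0,T];\mathbb{R}^n)$. Then $F$ is locally Lipschitz continuous in the following sense. Let $\tilde x$ be another driving path with delayed Lévy area $\tilde{\mathbf{x}}^{\mathbf 2}(v)$, $v\in\{-r_k,\dots,-r_0\}$, let $\tilde\xi\in\mathcal{C}_1^{2\gamma}([-r_k,0];\mathbb{R}^n)$ be another initial condition, and let $\tilde y$ be the unique solution of the corresponding delay equation. For every $N>0$ there is a constant $K_N>0$ such that $$\|y-\tilde y\|_{\kappa,\infty}\le K_N\Big(\|x-\tilde x\|_{\gamma,\infty}+\sum_{i=0}^k\|\mathbf{x}^{\mathbf 2}(-r_i)-\tilde{\mathbf{x}}^{\mathbf 2}(-r_i)\|_{2\gamma}+\|\xi-\tilde\xi\|_{2\gamma,\infty}\Big)$$ holds for all tuples $(\xi,x,\mathbf{x}^{\mathbf 2}(0),\dots,\mathbf{x}^{\mathbf 2}(-r_k))$ and $(\tilde\xi,\tilde x,\tilde{\mathbf{x}}^{\mathbf 2}(0),\dots,\tilde{\mathbf{x}}^{\mathbf 2}(-r_k))$ with $$\sum_{i=0}^k\|\mathbf{x}^{\mathbf 2}(-r_i)\|_{2\gamma}+\sum_{i=0}^k\|\tilde{\mathbf{x}}^{\mathbf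 2}(-r_i)\|_{2\gamma}+\|x\|_{\gamma,\infty}+\|\tilde x\|_{\gamma,\infty}+\|\xi\|_{2\gamma,\infty}+\|\tilde\xi\|_{2\gamma,\infty}\le N.$$
   Context: **Notation.** $\mathbb{R}^{n,m}$ is the space of real $n\times m$ matrices. A point of $\mathbb{R}^{n,k+1}$ is written $(y_0,\dots,y_k)$ with columns $y_i\in\mathbb{R}^n$, and its entries are $x_{q,i}$ ($1\le q\le n$, $0\le i\le k$). $C_b^3$ means three times continuously differentiable, bounded, with bounded derivatives up to order 3. For a path $f$, $\|f\|_{\mu,\infty}=\|f\|_\infty+\sup_{s\ne t}|f_t-f_s|/|t-s|^\mu$, taken over the interval of definition: $[0,T]$ for $y$, $[-r_k,T]$ for $x$, $[-r_k,0]$ for $\xi$. **Increments.** For $j=1,2,3,4$, $\mathcal{C}_j([a,b];V)$ is the set of functions $g:[a,b]^j\to V$ with $g_{t_1\cdots t_j}=0$ whenever $t_i=t_{i+1}$ for some $i$. Set $(\delta g)_{st}=g_t-g_s$ for $g\in\mathcal{C}_1$ and $(\delta h)_{sut}=h_{st}-h_{su}-h_{ut}$ for $h\in\mathcal{C}_2$. For $h\in\mathcal{C}_2$ let $\|h\|_\mu=\sup_{s\ne t}|h_{st}|/|t-s|^\mu$ and let $\mathcal{C}_2^\mu$ be the set of $h$ with $\|h\|_\mu<\infty$. $\mathcal{C}_1^\mu$ is the set of continuous $g$ with $\|g\|_\mu:=\|\delta g\|_\mu<\infty$. **Classical controlled paths.** An element of $\mathcal{Q}_{\kappa,\alpha}([a,b];\mathbb{R}^n)$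 is a pair $(z,\zeta)$ with $z\in\mathcal{C}_1^\kappa([a,b];\mathbb{R}^n)$, $z_a=\alpha$, $\zeta\in\mathcal{C}_1^\kappa([a,b];\mathbb{R}^{n,d})$ and $(\delta z)_{st}=\zeta_s(\delta x)_{st}+\rho_{st}$ with $\rho\in\mathcal{C}_2^{2\kappa}([a,b];\mathbb{R}^n)$. **Delayed controlled paths and their integral.** An $\mathbb{R}^{n,d}$-valued delayed controlled path on $[a,b]\subset[0,T]$ is a $\kappa$-Hölder path $m=(m^{pj})$ together with $\kappa$-Hölder densities $\zeta^{(i)}=(\zeta^{(i)}(p,j,l))$, $0\le i\le k$, such that $$(\delta m^{pj})_{st}=\sum_{i=0}^k\sum_{l=1}^d\zeta^{(i)}_s(p,j,l)\,(\delta x^l)_{s-r_i,t-r_i}+\rho^{pj}_{st},\qquad \rho^{pj}\in\mathcal{C}_2^{2\kappa}([a,b];\mathbb{R}).$$ The integral $\mathcal{J}(m\,dx)$ is the $\mathbb{R}^n$-valued increment with components $$\mathcal{J}_{st}(m\,dx)^p=\sum_j m^{pj}_s(\delta x^j)_{st}+\sum_{i=0}^k\sum_{j,l}\zeta^{(i)}_s(p,j,l)\,\mathbf{x}^{\mathbf 2}_{st}(-r_i)(l,j)+\Lambda_{st}(h^p),$$ $$h^p_{sut}=\sum_j\rho^{pj}_{su}(\delta x^j)_{ut}+\sum_{i=0}^k\sum_{j,l}(\delta\zeta^{(i)}(p,j,l))_{su}\,\mathbf{x}^{\mathbf 2}_{ut}(-r_i)(l,j),$$ where $\Lambda(h^p)$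 is the unique $g\in\bigcup_{\mu>1}\mathcal{C}_2^\mu([a,b];\mathbb{R})$ with $\delta g=h^p$ (it exists by the sewing lemma since $\kappa,\gamma>\frac13$). **Solution.** A pair $(y,\zeta)\in\mathcal{Q}_{\kappa,\xi_0}([0,T];\mathbb{R}^n)$, with $y$ extended by $y_t=\xi_t$ on $[-r_k,0]$, is a solution of the equation if $\zeta_t=m_t:=\sigma(y_t,y_{t-r_1},\dots,y_{t-r_k})$ for all $t\in[0,T]$ and if $(\delta y)_{st}=\mathcal{J}_{st}(m\,dx)$ for $a\le s\le t\le b$, on every interval $[a,b]\subset[0,T]$ containing no $r_i$ in its interior. On such an interval $m$ is regarded as a delayed controlled path with densities $$\zeta^{(i)}_s(p,j,l)=\sum_{q=1}^n\frac{\partial\sigma^{pj}}{\partial x_{q,i}}(y_s,y_{s-r_1},\dots,y_{s-r_k})\,\zeta_{s-r_i}(q,l)\ \text{ if } r_i\le a,\qquad \zeta^{(i)}=0\ \text{ if } r_i\ge b,$$ the latter because the initial path $\xi$ is treated as a controlled path with zero density (it is part of the remainder). *)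

(* Defs.v *)
From HB Require Import structures.
From mathcomp Require Import all_boot all_order all_algebra.
From mathcomp Require Import all_classical all_reals all_analysis.

Set Implicit Arguments.
Unset Strict Implicit.
Unset Printing Implicit Defensive.

Import Order.TTheory GRing.Theory Num.Theory.
Import numFieldNormedType.Exports.

Local Open Scope classical_set_scope.
Local Open Scope ring_scope.

(* Paths and increments on [a, b] are total functions, of which only the
   values at times of [a, b] matter.  Finite-dimensional spaces carry the sup
   norm of the library; any other choice of norms leaves the Hoelder classes
   unchanged and only changes constants in estimates. *)

Section Increments.
Context {R : realType} {V : normedModType R}.

Definition delta1 (g : R -> V) (s t : R) : V := g t - g s.

Definition delta2 (h : R -> R -> V) (s u t : R) : V := h s t - h s u - h u t.

(* Meant for a < b: otherwise the supremum is over the empty set, hence -oo. *)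
Definition holder_seminorm (mu a b : R) (h : R -> R -> V) : \bar R :=
  ereal_sup [set e | exists s t, [/\ s \in `[a, b], t \in `[a, b], s != t &
                                     e = (`|h s t| / `|t - s| `^ mu)%:E]].

Definition sup_norm (a b : R) (f : R -> V) : \bar R :=
  ereal_sup [set (`|f t|)%:E | t in `[a, b]].

Definition holder_norm (mu a b : R) (f : R -> V) : \bar R :=
  (sup_norm a b f + holder_seminorm mu a b (delta1 f))%E.

Definition holderC1 (mu a b : R) (g : R -> V) : Prop :=
  {within `[a, b], continuous g} /\
  (holder_seminorm mu a b (delta1 g) < +oo)%E.

Definition holderC2 (mu a b : R) (h : R -> R -> V) : Prop :=
  (forall t, t \in `[a, b] -> h t t = 0) /\
  (holder_seminorm mu a b h < +oo)%E.

End Increments.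

Section Sewing.
Context {R : realType}.

Definition is_Lambda (a b : R) (h : R -> R -> R -> R) (g : R -> R -> R) :
    Prop :=
  (exists2 mu, 1 < mu & holderC2 mu a b g) /\
  (forall s u t, s \in `[a, b] -> u \in `[a, b] -> t \in `[a, b] ->
     delta2 g s u t = h s u t).

(* The chosen g is determined on [a, b] x [a, b] only, and is 0 if no g
   exists. *)
Definition Lambda (a b : R) (h : R -> R -> R -> R) : R -> R -> R :=
  xget (fun _ _ => 0) [set g | is_Lambda a b h g].

End Sewing.

Section Cb.
Context {R : realType} {V W : normedModType R}.

(* In finite dimension, f is of class C^(m+1) with bounded derivatives iff f is
   differentiable and bounded and each directional derivative x |-> 'D_v f x is
   of class C^m with bounded derivatives: x |-> 'd f x is continuous (bounded)
   for the operator norm iff each x |-> 'd f x v is. *)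
Fixpoint Cb (m : nat) (f : V -> W) : Prop :=
  [/\ continuous f, bounded_fun f &
      match m with
      | 0%N => True
      | m'.+1 => (forall x, differentiable f x) /\ (forall v, Cb m' ('D_v f))
      end].

End Cb.

Section DelayEquation.
Context {R : realType} {n d k : nat}.

Implicit Types (r : 'I_k.+1 -> R) (x : R -> 'cV[R]_d)
  (area : 'I_k.+1 -> R -> R -> 'M[R]_d) (xi y : R -> 'cV[R]_n)
  (m zeta : R -> 'M[R]_(n, d))
  (dens : 'I_k.+1 -> 'I_n -> 'I_d -> 'I_d -> R -> R)
  (sigma : 'M[R]_(n, k.+1) -> 'M[R]_(n, d)).

Definition is_delays r : Prop :=
  r ord0 = 0 /\ forall i j : 'I_k.+1, (i < j)%N -> r i < r j.

(* area i stands for the delayed Levy area at v = - r i. *)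
Definition is_delayed_levy_area (gamma T : R) r x area : Prop :=
  forall i : 'I_k.+1,
    holderC2 (2 * gamma) 0 T (area i) /\
    (forall s u t, s \in `[0, T] -> u \in `[0, T] -> t \in `[0, T] ->
      forall p q : 'I_d,
        delta2 (area i) s u t p q =
        delta1 x (s - r i) (u - r i) p 0 * delta1 x u t q 0).

Definition controlled_path (kappa a b : R) x (alpha : 'cV[R]_n)
    (z : R -> 'cV[R]_n) zeta : Prop :=
  [/\ holderC1 kappa a b z, z a = alpha, holderC1 kappa a b zeta &
      holderC2 (2 * kappa) a b (fun s t => delta1 z s t - zeta s *m delta1 x s t)].

Definition remainder r x m dens (p : 'I_n) (j : 'I_d) (s t : R) : R :=
  delta1 m s t p j -
  \sum_(i < k.+1) \sum_(l < d)
    dens i p j l s * delta1 x (s - r i) (t - r i) l 0.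

Definition delayed_controlled_path (kappa a b : R) r x m dens : Prop :=
  [/\ holderC1 kappa a b m,
      forall i p j l, holderC1 kappa a b (dens i p j l) &
      forall p j, holderC2 (2 * kappa) a b (remainder r x m dens p j)].

Definition integral_defect r x area m dens (p : 'I_n) (s u t : R) : R :=
  \sum_(j < d) remainder r x m dens p j s u * delta1 x u t j 0 +
  \sum_(i < k.+1) \sum_(j < d) \sum_(l < d)
    delta1 (dens i p j l) s u * area i u t l j.

Definition delayed_integral (a b : R) r x area m dens (s t : R) : 'cV[R]_n :=
  \col_(p < n)
    (\sum_(j < d) m s p j * delta1 x s t j 0 +
     \sum_(i < k.+1) \sum_(j < d) \sum_(l < d) dens i p j l s * area i s t l j +
     Lambda a b (integral_defect r x area m dens p) s t).

Definition extend xi y (t : R) : 'cV[R]_n := if t < 0 then xi t else y t.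

(* The matrix with columns y_t, y_(t - r_1), ..., y_(t - r_k). *)
Definition delayed_point r (y : R -> 'cV[R]_n) (t : R) : 'M[R]_(n, k.+1) :=
  \matrix_(q < n, i < k.+1) y (t - r i) q 0.

Definition coefficient sigma r xi y (t : R) : 'M[R]_(n, d) :=
  sigma (delayed_point r (extend xi y) t).

Definition partial sigma (p : 'I_n) (j : 'I_d) (q : 'I_n) (i : 'I_k.+1)
    (z : 'M[R]_(n, k.+1)) : R :=
  'D_(delta_mx q i) (fun w => sigma w p j) z.

(* On [a, b] with a < b and no delay in ]a, b[, the condition a < r i is
   equivalent to b <= r i. *)
Definition coefficient_density sigma r xi y zeta (a : R)
    (i : 'I_k.+1) (p : 'I_n) (j l : 'I_d) (s : R) : R :=
  if r i <= a then
    \sum_(q < n) partial sigma p j q i (delayed_point r (extend xi y) s) *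
                 zeta (s - r i) q l
  else 0.

Definition is_solution (kappa T : R) r sigma x area xi y zeta : Prop :=
  [/\ controlled_path kappa 0 T x (xi 0) y zeta,
      forall t, t \in `[0, T] -> zeta t = coefficient sigma r xi y t &
      forall a b, 0 <= a -> a < b -> b <= T ->
        (forall i, r i \notin `]a, b[) ->
        let m := coefficient sigma r xi y in
        let dens := coefficient_density sigma r xi y zeta a in
        delayed_controlled_path kappa a b r x m dens /\
        (forall s t, a <= s -> s <= t -> t <= b ->
           delta1 y s t = delayed_integral a b r x area m dens s t)].

End DelayEquation.

(* Main.v *)
Require Import Defs.
From HB Require Import structures.
From mathcomp Require Import all_boot all_order all_algebra.
From mathcomp Require Import all_classical all_reals all_analysis.
From mathcomp Require Import ring lra zify.

Set Implicit Arguments.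
Unset Strict Implicit.
Unset Printing Implicit Defensive.

Import Order.TTheory GRing.Theory Num.Theory.
Import numFieldNormedType.Exports.

Local Open Scope classical_set_scope.
Local Open Scope ring_scope.

(* Only the exponent kappa of the driving data matters.  Following Davie, y is
   a solution iff on every interval free of delays its increment over [s, t]
   agrees with the germ
     sigma(Y_s) (x_t - x_s) + (densities at s) . area_st
   up to o(t - s).  By Chen's relation the germ is additive up to a defect of
   order |t - s|^(3 kappa), so bisection improves o(t - s) to
   O(|t - s|^(3 kappa)), and Lambda of the defect is the increment minus the
   germ; no sewing map has to be constructed.

   A priori bound: if the remainder y_st - sigma(Y_s) x_st is at most
   B |t - s|^(2 kappa), then, sigma being bounded, the defect is affine in B, and
   on intervals of length tau the bound improves to C + C B tau^kappa, hence to
   an absolute constant when tau is small.  A short interval contains at most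
   one delay and is split there.  The same argument applied to the difference of
   two solutions, propagated over finitely many short intervals, yields Lipschitz
   dependence on the data and, for equal data, uniqueness.

   Existence: on an interval shorter than the smallest gap between delays the
   delayed values are known, and the Euler polygons satisfy the germ estimate
   between grid points uniformly in the mesh; a limit along an ultrafilter
   solves the equation there, and finitely many such extensions reach T. *)

(** Orders are counted in powers of |t - s|^kappa. Increments of the initial path are of order two,
    so it may carry the density zero, but a delayed value changes its nature when t - r_i crosses 0:
    this is why sewing is confined to intervals without interior delay. The form of the estimates is
    dictated by linearity. A bound quadratic in the unknown B would not improve itself, so the
    Taylor expansion of sigma is arranged in such a way that its quadratic term only sees quantities
    bounded by the data. For a difference of two solutions B is already a constant, and the new
    unknown b has to come with a factor tau^kappa each time. All this concerns finitely many
    matrices attached to three times; it is proved once for such a configuration and then used for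
    solutions, for pairs of solutions and for the one-step map of the Euler scheme. Finally, the
    Hoelder spaces involve both orders of s and t while sewing works with s <= t; additivity up to a
    known correction, applied to the times s, t, s, supplies the missing half. *)

Ltac nneg := repeat first [done | apply: addr_ge0 | apply: mulr_ge0 | exact: powR_ge0].

(** * Absorption, matrix norms, and domination with unspecified constants *)

Lemma ler_of_geometric (R : realType) (x y z : R) :
  (forall m : nat, x <= z * 2^-1 ^+ m + y) -> x <= y.
Proof.
move=> xzy; apply/ler_addgt0Pr => e e0.
have /cvgrPdist_lt/(_ e e0)[m _ /(_ m (leqnn m))] :
    (fun m => z * 2^-1 ^+ m) @ \oo --> z * 0.
  apply: cvgMl_tmp; apply: cvg_expr.
  by rewrite ger0_norm ?invr_ge0// invf_lt1 ?ltr1n.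
rewrite mulr0 sub0r normrN => zm.
apply: (le_trans (xzy m)); rewrite addrC lerD2l.
by apply: le_trans (ltW zm); rewrite ler_norm.
Qed.

(* A finite but uncontrolled bound that improves itself is a controlled one. *)
Lemma absorb (R : realType) (I : Type) (P : I -> Prop) (f g : I -> R) (C : R) :
  0 <= C -> (forall i, P i -> 0 <= g i) ->
  (exists2 B0, 0 <= B0 & forall i, P i -> f i <= B0 * g i) ->
  (forall B, 0 <= B -> (forall i, P i -> f i <= B * g i) ->
     forall i, P i -> f i <= (B / 2 + C) * g i) ->
  forall i, P i -> f i <= 2 * C * g i.
Proof.
move=> C0 g0 [B0 B00 fB0] step.
(* The map B |-> B / 2 + C has the fixed point 2 C, and each iteration halves the distance to it;
   the unknown B0 disappears in the limit. *)
have main m : forall i, P i -> f i <= (B0 * 2^-1 ^+ m + 2 * C) * g i.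
  elim: m => [|m IH] i Pi.
    rewrite expr0 mulr1; apply: (le_trans (fB0 i Pi)).
    by rewrite ler_wpM2r ?g0// lerDl mulr_ge0.
  have := step (B0 * 2^-1 ^+ m + 2 * C) _ IH i Pi.
  have -> : (B0 * 2^-1 ^+ m + 2 * C) / 2 + C = B0 * 2^-1 ^+ m.+1 + 2 * C.
    by rewrite exprS; field.
  by apply; rewrite addr_ge0 ?mulr_ge0// exprn_ge0// invr_ge0.
move=> i Pi; apply: (@ler_of_geometric _ _ _ (B0 * g i)) => m.
by apply: (le_trans (main m i Pi)); rewrite mulrDl; lra.
Qed.

Section MatrixNorm.
Context {R : realType}.

Lemma mx_norm_ge_entry (m n : nat) (A : 'M[R]_(m, n)) i j : `|A i j| <= `|A|.
Proof.
rewrite /Num.norm/= mx_normrE.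
by rewrite (le_trans _ (le_bigmax _ _ (i, j))).
Qed.

Lemma mx_norm_le (m n : nat) (A : 'M[R]_(m, n)) (c : R) :
  0 <= c -> (forall i j, `|A i j| <= c) -> `|A| <= c.
Proof.
move=> c0 Ac; rewrite [leLHS]/Num.norm/= mx_normrE.
by apply: bigmax_le => // -[i j] _ /=.
Qed.

Lemma norm_sum_le (V : normedModType R) (n : nat) (F : 'I_n -> V) (c : R) :
  (forall i, `|F i| <= c) -> `|\sum_(i < n) F i| <= n%:R * c.
Proof.
move=> Fc; apply: (le_trans (ler_norm_sum _ _ _)).
have -> : n%:R * c = \sum_(i < n) c by rewrite sumr_const card_ord mulr_natl.
exact: ler_sum.
Qed.

(** The sup norm is not submultiplicative: an entry of the product is a sum of n terms. This is the
    origin of the factors [d%:R] in the constants below. *)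
Lemma norm_mulmx_le (m n p : nat) (A : 'M[R]_(m, n)) (B : 'M[R]_(n, p)) :
  `|A *m B| <= n%:R * (`|A| * `|B|).
Proof.
apply: mx_norm_le => [|i j]; first by rewrite !mulr_ge0.
rewrite mxE; apply: norm_sum_le => l.
by rewrite normrM ler_pM// mx_norm_ge_entry.
Qed.

End MatrixNorm.

Section Dominated.
Context {R : realType} {I : Type} (P : I -> Prop).

(* One constant for the whole family: keeps the estimates below free of
   explicit constants. *)
Definition dominated (V : normedModType R) (f : I -> V) (g : I -> R) : Prop :=
  exists2 C, 0 <= C & forall i, P i -> `|f i| <= C * g i.

Implicit Types (V : normedModType R) (g h : I -> R).

Lemma dominated_eq V (f f' : I -> V) g :
  dominated f g -> (forall i, P i -> f' i = f i) -> dominated f' g.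
Proof. by move=> [C C0 fg] E; exists C => // i Pi; rewrite E// fg. Qed.

Lemma dominatedD V (f f' : I -> V) g :
  dominated f g -> dominated f' g -> dominated (fun i => f i + f' i) g.
Proof.
move=> [C C0 fg] [D D0 fg']; exists (C + D); first exact: addr_ge0.
move=> i Pi; rewrite mulrDl; apply: le_trans (ler_normD _ _) _.
by rewrite lerD ?fg ?fg'.
Qed.

Lemma dominatedM (f f' : I -> R) g g' h :
  dominated f g -> dominated f' g' -> (forall i, P i -> g i * g' i <= h i) ->
  dominated (fun i => f i * f' i) h.
Proof.
move=> [C C0 fg] [D D0 fg'] ggh; exists (C * D); first exact: mulr_ge0.
move=> i Pi; apply: (@le_trans _ _ (C * D * (g i * g' i))).
  by rewrite normrM mulrACA ler_pM// ?fg ?fg'.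
by rewrite ler_wpM2l ?ggh ?mulr_ge0.
Qed.

Lemma dominated_sum V (n : nat) (f : 'I_n -> I -> V) g :
  (forall j, dominated (f j) g) -> dominated (fun i => \sum_(j < n) f j i) g.
Proof.
elim: n f => [|n IH] f fg.
  by exists 0 => // i Pi; rewrite big_ord0 mul0r normr0.
apply: (@dominated_eq _ (fun i => \sum_(j < n) f (widen_ord (leqnSn n) j) i +
                                   f ord_max i)).
  by apply: dominatedD; [exact: IH | exact: fg].
by move=> i _; rewrite big_ord_recr.
Qed.

Lemma dominated_entry (m n : nat) (f : I -> 'M[R]_(m, n)) g p q :
  dominated f g -> dominated (fun i => f i p q) g.
Proof.
by move=> [C C0 fg]; exists C => // i Pi; rewrite (le_trans (mx_norm_ge_entry _ _ _))// fg.
Qed.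

Lemma dominated_mx (m n : nat) (f : I -> 'M[R]_(m, n)) g :
  (forall i, P i -> 0 <= g i) ->
  (forall p q, dominated (fun i => f i p q) g) -> dominated f g.
Proof.
move=> g0 fg.
have [C HC] : {C : 'I_m -> 'I_n -> R | forall p q, 0 <= C p q /\
    forall i, P i -> `|f i p q| <= C p q * g i}.
  have /choice[C HC] : forall pq : 'I_m * 'I_n, exists C, 0 <= C /\
      forall i, P i -> `|f i pq.1 pq.2| <= C * g i.
    by move=> [p q]; have [C] := fg p q; exists C.
  by exists (fun p q => C (p, q)) => p q; exact: HC (p, q).
exists (\sum_p \sum_q C p q).
  by apply: sumr_ge0 => p _; apply: sumr_ge0 => q _; case: (HC p q).
have C0 p q : 0 <= C p q by case: (HC p q).
move=> i Pi; apply: mx_norm_le => [|p q].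
  by rewrite mulr_ge0 ?g0// sumr_ge0 => // p _; rewrite sumr_ge0.
apply: (le_trans ((HC p q).2 i Pi)); rewrite ler_wpM2r ?g0//.
rewrite (bigD1 p)//= (bigD1 q)//= -addrA lerDl addr_ge0 ?sumr_ge0 => // j _.
by rewrite sumr_ge0.
Qed.

Lemma dominated_const V (f : I -> V) g (c : R) :
  0 <= c -> dominated f (fun i => c * g i) -> dominated f g.
Proof.
move=> c0 [C C0 fg]; exists (C * c); first exact: mulr_ge0.
by move=> i Pi; rewrite -mulrA fg.
Qed.

Lemma dominated_sumB V (n : nat) (f f' : 'I_n -> I -> V) g :
  (forall j, dominated (fun i => f j i - f' j i) g) ->
  dominated (fun i => \sum_(j < n) f j i - \sum_(j < n) f' j i) g.
Proof.
by move=> H; apply: (dominated_eq (dominated_sum H)) => i _; rewrite -sumrB.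
Qed.

(* f g - f' g' = f (g - g') + (f - f') g' *)
Lemma dominatedMB (f f' g g' : I -> R) a a' b b' h :
  dominated f a -> dominated (fun i => g i - g' i) a' ->
  (forall i, P i -> a i * a' i <= h i) ->
  dominated (fun i => f i - f' i) b -> dominated g' b' ->
  (forall i, P i -> b i * b' i <= h i) ->
  dominated (fun i => f i * g i - f' i * g' i) h.
Proof.
move=> fa ga aa fb gb bb.
apply: (@dominated_eq _ (fun i => f i * (g i - g' i) + (f i - f' i) * g' i)).
  by apply: dominatedD; [exact: (dominatedM fa ga)|exact: (dominatedM fb gb)].
by move=> i _; ring.
Qed.

End Dominated.

(** * Sewing by bisection *)

Section Sewing.
Context {R : realType} {V : normedModType R}.

(** J_st = o(t - s) uniformly on [[a, b]]: all that is known at the outset of an increment minus its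
    germ, and all that bisection needs in order to start. *)
Definition small_increment (a b : R) (J : R -> R -> V) : Prop :=
  forall e, 0 < e -> exists2 del, 0 < del & forall s t,
    a <= s -> s <= t -> t <= b -> t - s <= del -> `|J s t| <= e * (t - s).

Lemma small_incrementB (a b : R) (J J' : R -> R -> V) :
  small_increment a b J -> small_increment a b J' ->
  small_increment a b (fun s t => J s t - J' s t).
Proof.
move=> oJ oJ' e e0; have e20 : 0 < e / 2 by rewrite divr_gt0.
have [del del0 H] := oJ _ e20; have [del' del'0 H'] := oJ' _ e20.
exists (Num.min del del'); first by rewrite lt_min del0.
move=> s t as_ st tb; rewrite le_min => /andP[h h'].
apply: (le_trans (ler_normB _ _)); have := H _ _ as_ st tb h.
have := H' _ _ as_ st tb h'; lra.
Qed.

Lemma small_increment_powR (a b mu K : R) (J : R -> R -> V) :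
  1 < mu ->
  (forall s t, a <= s -> s <= t -> t <= b -> `|J s t| <= K * (t - s) `^ mu) ->
  small_increment a b J.
Proof.
move=> mu1 JK e e0.
(* [K] has no sign here; a positive majorant is needed to divide by. *)
pose K' := Num.max K 1; have K'0 : 0 < K' by rewrite lt_max ltr01 orbT.
have mu10 : mu - 1 != 0 by lra.
(* At this length K' (t - s)^(mu - 1) equals e. *)
exists ((e / K') `^ (mu - 1)^-1); first by rewrite powR_gt0 ?divr_gt0.
move=> s t as_ st tb h.
have ts0 : 0 <= t - s by rewrite subr_ge0.
apply: le_trans (JK _ _ as_ st tb) _.
apply: (@le_trans _ _ (K' * (t - s) `^ mu)).
  by rewrite ler_wpM2r ?powR_ge0// le_max lexx.
rewrite -(@mulr_powRB1 _ (t - s) mu)//; last by lra.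
rewrite [(t - s) * _]mulrC mulrA ler_wpM2r// mulrC -ler_pdivlMr//.
have : (t - s) `^ (mu - 1) <= ((e / K') `^ (mu - 1)^-1) `^ (mu - 1).
  by rewrite ge0_ler_powR ?nnegrE ?powR_ge0//; lra.
by rewrite -powRrM mulVf// powRr1// ltW// divr_gt0.
Qed.

(* Bisection: each halving costs the factor 2 ^ (1 - mu) < 1. *)
Lemma sewing_bound (a b mu C : R) (J : R -> R -> V) :
  1 < mu -> 0 <= C -> small_increment a b J ->
  (forall s u t, a <= s -> s <= u -> u <= t -> t <= b ->
     `|delta2 J s u t| <= C * (t - s) `^ mu) ->
  forall s t, a <= s -> s <= t -> t <= b ->
    `|J s t| <= (1 - 2 `^ (1 - mu))^-1 * C * (t - s) `^ mu.
Proof.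
move=> mu1 C0 oJ dJ s t as_ st tb; set p := 2 `^ (1 - mu).
have p1 : p < 1.
  rewrite /p -[1 - mu]opprB powRN invf_lt1 ?powR_gt0//.
  have : 1 `^ (mu - 1) < 2 `^ (mu - 1) :> R.
    by rewrite gt0_ltr_powR ?nnegrE ?ltr1n//; lra.
  by rewrite powR1.
set C' := (1 - p)^-1 * C.
(* C' reproduces itself: two halves cost C' p, the defect adds C. *)
have C'E : C' * p + C = C'.
  by rewrite /C'; field; rewrite subr_eq0; apply/eqP => ?; lra.
apply/ler_addgt0Pr => e e0.
(* The linear error, once accumulated over the whole interval, stays below e; adding 1 keeps the
   denominator positive when a = b. *)
have e'0 : 0 < e / (b - a + 1) by rewrite divr_gt0//; lra.
have [del del0 H] := oJ _ e'0.
(* A term linear in t - s is additive, so halving does not increase it; the power term is reproduced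
   by [C'E]. The induction is on the number of halvings needed to come below [del]. *)
have main m : forall s t, a <= s -> s <= t -> t <= b -> t - s <= 2 ^+ m * del ->
    `|J s t| <= e / (b - a + 1) * (t - s) + C' * (t - s) `^ mu.
  elim: m => [|m IH] {as_ st tb}s {}t as_ st tb h.
    rewrite expr0 mul1r in h.
    apply: (le_trans (H _ _ as_ st tb h)); rewrite lerDl.
    by rewrite mulr_ge0 ?powR_ge0// /C' mulr_ge0// invr_ge0; lra.
  pose u := (s + t) / 2.
  have su : s <= u by rewrite /u; lra.
  have ut : u <= t by rewrite /u; lra.
  have us : u - s = (t - s) / 2 by rewrite /u; lra.
  have tu : t - u = (t - s) / 2 by rewrite /u; lra.
  have h2 : (t - s) / 2 <= 2 ^+ m * del.
    by rewrite ler_pdivrMr// mulrAC -exprSr.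
  have pE : ((t - s) / 2) `^ mu = p / 2 * (t - s) `^ mu.
    rewrite powRM ?invr_ge0// ?subr_ge0// mulrC; congr (_ * _).
    rewrite /p powRD; last by rewrite pnatr_eq0 implybT.
    have -> : 2^-1 `^ mu = 2 `^ (- mu) :> R by rewrite -powR_inv1// -powRrM mulN1r.
    by rewrite powRr1// mulrC mulKf.
  have := IH s u as_ su (le_trans ut tb); rewrite us => /(_ h2) H1.
  have := IH u t (le_trans as_ su) ut tb; rewrite tu => /(_ h2) H2.
  have H3 := dJ s u t as_ su ut tb.
  have -> : J s t = delta2 J s u t + J s u + J u t.
    by rewrite /delta2 addrAC !subrK.
  apply: (le_trans (ler_normD _ _)); apply: le_trans (lerD (ler_normD _ _) (lexx _)) _.
  rewrite -{1}C'E; move: H1 H2 H3; rewrite pE; lra.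
have [m tsm] : exists m, t - s <= 2 ^+ m * del.
  exists (Num.bound ((t - s) / del)); rewrite -ler_pdivrMr//.
  have := archi_boundP (divr_ge0 (_ : 0 <= t - s) (ltW del0)).
  rewrite subr_ge0 => /(_ st)/ltW/le_trans; apply.
  by rewrite -natrX ler_nat ltnW// ltn_expl.
apply: (le_trans (main m s t as_ st tb tsm)); rewrite addrC lerD2l.
rewrite mulrAC -mulrA ler_piMr//; first exact: ltW.
rewrite ler_pdivrMr//; lra.
Qed.

End Sewing.

(** * Smooth coefficients *)

Section SmoothEstimates.
Context {R : realType} {V : normedModType R}.
Implicit Types (F : V -> R) (z v : V).

(** Quantitative form of [Cb] for scalar functions. The bound is homogeneous in the directions of
    differentiation, so that one constant serves all orders and all directions. *)
Fixpoint smooth (m : nat) (M : R) F : Prop :=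
  (forall z, `|F z| <= M) /\
  match m with
  | 0%N => True
  | m'.+1 => (forall z, differentiable F z) /\
             (forall v, smooth m' (M * `|v|) ('D_v F))
  end.

Lemma smooth_le (m : nat) (M M' : R) F : M <= M' -> smooth m M F -> smooth m M' F.
Proof.
elim: m M M' F => [|m IH] M M' F MM' /= [bF sF].
  by split=> // z; apply: le_trans MM'.
split; first by move=> z; apply: le_trans MM'.
by split; [exact: sF.1 | move=> v; apply: IH (sF.2 v); rewrite ler_wpM2r].
Qed.

Lemma smoothS (m : nat) (M : R) F : smooth m.+1 M F -> smooth m M F.
Proof.
elim: m M F => [|m IH] M F [bF [dF sF]]; first by split.
by split=> //; split=> // v; apply/IH/sF.
Qed.

Lemma smooth0 (m : nat) : smooth m 0 (cst 0).
Proof.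
elim: m => [|m IH] /=; split => //; try by move=> z; rewrite normr0.
split=> [z|v]; first exact: differentiable_cst.
by rewrite mul0r (_ : 'D_v _ = cst 0)//; apply/funext => z; rewrite derive_cst.
Qed.

Lemma smoothD (m : nat) (M M' : R) F G :
  smooth m M F -> smooth m M' G -> smooth m (M + M') (fun z => F z + G z).
Proof.
elim: m M M' F G => [|m IH] M M' F G [bF sF] [bG sG].
  by split=> // z; rewrite (le_trans (ler_normD _ _))// lerD.
split; first by move=> z; rewrite (le_trans (ler_normD _ _))// lerD.
split=> [z|v]; first by apply: differentiableD; [exact: sF.1|exact: sG.1].
rewrite mulrDl (_ : 'D_v _ = fun z => 'D_v F z + 'D_v G z).
  by apply: IH; [exact: sF.2|exact: sG.2].
apply/funext => z; rewrite (_ : (fun z => _) = F + G)// deriveD//.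
  exact/diff_derivable/sF.1.
exact/diff_derivable/sG.1.
Qed.

Lemma smoothZ (m : nat) (M : R) F (c : R) :
  smooth m M F -> smooth m (`|c| * M) (fun z => c * F z).
Proof.
elim: m M F => [|m IH] M F [bF sF].
  by split=> // z; rewrite normrM ler_wpM2l.
split; first by move=> z; rewrite normrM ler_wpM2l.
split=> [z|v]; first by apply: differentiableZ; exact: sF.1.
rewrite -mulrA (_ : 'D_v _ = fun z => c * 'D_v F z).
  by apply: IH; exact: sF.2.
apply/funext => z; rewrite (_ : (fun z => _) = c *: F)// deriveZ//.
exact/diff_derivable/sF.1.
Qed.

Lemma is_derive_line F z v (th : R) :
  (forall w, differentiable F w) ->
  is_derive th (1 : R) (fun t : R => F (z + t *: v)) ('D_v F (z + th *: v)).
Proof.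
move=> dF.
have dg : differentiable (fun t : R => z + t *: v) th by [].
apply: DeriveDef.
  apply/derivable1_diffP.
  by apply: (@differentiable_comp _ _ _ _ (fun t : R => z + t *: v) F).
rewrite [LHS]deriveE; last exact: (@differentiable_comp _ _ _ _ (fun t : R => z + t *: v) F).
rewrite (@diff_comp _ _ _ _ (fun t : R => z + t *: v) F)//= deriveE//.
rewrite (_ : (fun t : R => z + t *: v) = cst z + *:%R^~ v)//.
by rewrite diffD//= diff_cst diff_val/= add0r scale1r.
Qed.

Lemma is_derive_mulr (c t : R) : is_derive t (1 : R) (fun s : R => s * c) c.
Proof.
rewrite (_ : (fun s : R => s * c) = c \*: id); last first.
  by apply/funext => s; rewrite /= mulrC.
by apply: is_derive_eq; rewrite /GRing.scale/= mulr1.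
Qed.

(** Every estimate on F below is this one, applied to a function of one real variable along the
    segments t |-> z + t v. *)
Lemma mean_value_le (phi dphi : R -> R) (c : R) :
  (forall t : R, is_derive t (1 : R) phi (dphi t)) ->
  (forall t, 0 <= t <= 1 -> `|dphi t| <= c) -> `|phi 1 - phi 0| <= c.
Proof.
move=> dp bp.
have [|t t01 ->] := @MVT_segment R phi dphi 0 1 ler01 (fun t _ => dp t).
  by apply: derivable_within_continuous => t _; exact: (@ex_derive _ _ _ _ _ _ _ (dp t)).
by rewrite subr0 mulr1 bp// -in_itv/=.
Qed.

Lemma derive_sub F z v w : (forall w, differentiable F w) ->
  'D_(v - w) F z = 'D_v F z - 'D_w F z.
Proof. by move=> dF; rewrite !deriveE// linearB. Qed.

Lemma smooth_increment (M : R) F z v :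
  smooth 1 M F -> `|F (z + v) - F z| <= M * `|v|.
Proof.
move=> [bF [dF sF]].
have := @mean_value_le (fun t => F (z + t *: v)) (fun t => 'D_v F (z + t *: v)) (M * `|v|).
rewrite scale1r scale0r addr0; apply.
  by move=> t; exact: is_derive_line.
by move=> t _; exact: (sF v).1.
Qed.

Lemma smooth_lipschitz (M : R) F z z' :
  smooth 1 M F -> `|F z - F z'| <= M * `|z - z'|.
Proof.
by move=> /(smooth_increment z' (z - z')); rewrite [z' + _]addrC subrK.
Qed.

Lemma smooth_ge0 (m : nat) (M : R) F : smooth m M F -> 0 <= M.
Proof. by case: m => [|m] [bF _]; apply: le_trans (bF 0). Qed.

Lemma smooth_taylor (M : R) F z v :
  smooth 2 M F -> `|F (z + v) - F z - 'D_v F z| <= M * (`|v| * `|v|).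
Proof.
move=> sF; have M0 := smooth_ge0 sF; move: sF => [bF [dF sF]].
have := @mean_value_le (fun t => F (z + t *: v) - t * 'D_v F z)
  (fun t => 'D_v F (z + t *: v) - 'D_v F z) (M * (`|v| * `|v|)).
rewrite scale1r scale0r addr0 mul1r mul0r subr0 addrAC; apply.
  move=> t; apply: is_deriveB; first exact: is_derive_line.
  exact: is_derive_mulr.
move=> t /andP[t0 t1].
have := smooth_increment z (t *: v) (sF v) => /le_trans; apply.
by rewrite normrZ ger0_norm// -mulrA !ler_wpM2l// ler_piMl.
Qed.

(** The function t |-> F (z + t v) - F (z' + t v') has a derivative that splits into a change of
    base point in the fixed direction v and a derivative in the direction v - v'. *)
Lemma smooth_four_point (M : R) F z z' v v' : smooth 2 M F ->
  `|(F (z + v) - F z) - (F (z' + v') - F z')| <=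
  M * ((`|z - z'| + `|v - v'|) * `|v| + `|v - v'|).
Proof.
move=> sF; have M0 := smooth_ge0 sF; move: sF => [bF [dF sF]].
have := @mean_value_le (fun t => F (z + t *: v) - F (z' + t *: v'))
  (fun t => 'D_v F (z + t *: v) - 'D_v' F (z' + t *: v'))
  (M * ((`|z - z'| + `|v - v'|) * `|v| + `|v - v'|)).
rewrite !scale1r !scale0r !addr0.
rewrite (_ : F (z + v) - F z - (F (z' + v') - F z') =
             F (z + v) - F (z' + v') - (F z - F z')); last by ring.
apply.
  by move=> t; apply: is_deriveB; exact: is_derive_line.
move=> t /andP[t0 t1].
have -> : 'D_v F (z + t *: v) - 'D_v' F (z' + t *: v') =
   ('D_v F (z + t *: v) - 'D_v F (z' + t *: v')) + 'D_(v - v') F (z' + t *: v').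
  by rewrite derive_sub//; ring.
apply: (le_trans (ler_normD _ _)); rewrite mulrDr lerD//; last exact: (sF _).1.
apply: (le_trans (smooth_lipschitz _ _ (sF v))).
rewrite -mulrA ler_wpM2l// mulrC ler_wpM2r//.
have -> : z + t *: v - (z' + t *: v') = (z - z') + t *: (v - v').
  by rewrite scalerBr opprD addrACA.
by rewrite (le_trans (ler_normD _ _))// lerD2l normrZ ger0_norm// ler_piMl.
Qed.

(** Third derivatives enter because the four-point estimate is applied to the directional derivative
    ['D_v F]; the change of direction leaves an increment of the derivative along v - v'. *)
Lemma smooth_taylor_diff (M : R) F z z' v v' : smooth 3 M F ->
  `|(F (z + v) - F z - 'D_v F z) - (F (z' + v') - F z' - 'D_v' F z')| <=
  M * (`|v| * ((`|z - z'| + `|v - v'|) * `|v| + `|v - v'|) + `|v'| * `|v - v'|).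
Proof.
move=> sF; have M0 := smooth_ge0 sF; move: sF => [bF [dF sF]].
have := @mean_value_le (fun t => (F (z + t *: v) - F (z' + t *: v')) - t * ('D_v F z - 'D_v' F z'))
  (fun t => ('D_v F (z + t *: v) - 'D_v' F (z' + t *: v')) - ('D_v F z - 'D_v' F z'))
  (M * (`|v| * ((`|z - z'| + `|v - v'|) * `|v| + `|v - v'|) + `|v'| * `|v - v'|)).
rewrite !scale1r !scale0r !addr0 mul1r mul0r subr0.
rewrite (_ : (F (z + v) - F z - 'D_v F z) - (F (z' + v') - F z' - 'D_v' F z') =
  F (z + v) - F (z' + v') - ('D_v F z - 'D_v' F z') - (F z - F z')); last by ring.
apply.
  move=> t; apply: is_deriveB; first by apply: is_deriveB; exact: is_derive_line.
  exact: is_derive_mulr.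
move=> t /andP[t0 t1].
have -> : ('D_v F (z + t *: v) - 'D_v' F (z' + t *: v')) - ('D_v F z - 'D_v' F z') =
   (('D_v F (z + t *: v) - 'D_v F z) - ('D_v F (z' + t *: v') - 'D_v F z')) +
   ('D_(v - v') F (z' + t *: v') - 'D_(v - v') F z').
  by rewrite !derive_sub//; ring.
apply: (le_trans (ler_normD _ _)); rewrite mulrDr lerD//.
  apply: (le_trans (smooth_four_point _ _ _ _ (sF v))).
  rewrite -mulrA ler_wpM2l// ler_wpM2l// -scalerBr !normrZ (ger0_norm t0).
  apply: lerD; last by rewrite ler_piMl.
  by apply: ler_pM; rewrite ?addr_ge0 ?mulr_ge0 ?lerD2l// ler_piMl.
apply: (le_trans (smooth_increment _ _ (@smoothS 1 _ _ (sF (v - v'))))).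
rewrite -mulrA ler_wpM2l// [leRHS]mulrC ler_wpM2l// normrZ (ger0_norm t0).
by rewrite ler_piMl.
Qed.

End SmoothEstimates.

Section SmoothMatrix.
Context {R : realType} {m n : nat}.

Lemma derive_sum_delta (F : 'M[R]_(m, n) -> R) z v :
  (forall w, differentiable F w) ->
  'D_v F z = \sum_i \sum_j v i j * 'D_(delta_mx i j) F z.
Proof.
move=> dF; rewrite !deriveE// {1}(matrix_sum_delta v) linear_sum.
apply: eq_bigr => i _; rewrite linear_sum; apply: eq_bigr => j _.
by rewrite linearZ deriveE.
Qed.

(** [Cb] gives an unrelated bound for each direction. In finite dimension only the coordinate
    directions count: a derivative along v is their combination with the entries of v as
    coefficients, which restores homogeneity. *)
Lemma smooth_Cb (k : nat) (F : 'M[R]_(m, n) -> R) :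
  Cb k F -> exists M, smooth k M F.
Proof.
elim: k F => [|k IH] F /= [cF bF].
  move=> _; have [M [_ /(_ (M + 1))]] := bF.
  rewrite ltrDl ltr01 => /(_ isT) HM.
  by exists (M + 1); split=> // z; exact: HM.
move=> [dF sF].
have [M [_ /(_ (M + 1))]] := bF.
rewrite ltrDl ltr01 => /(_ isT) HM.
have /choice[C HC] : forall ij : 'I_m * 'I_n,
    exists C, smooth k C ('D_(delta_mx ij.1 ij.2) F) by move=> ij; exact: IH.
have C0 ij : 0 <= C ij by exact: smooth_ge0 (HC ij).
pose S := \sum_i \sum_j C (i, j).
have S0 : 0 <= S by apply: sumr_ge0 => i _; exact: sumr_ge0.
exists (Num.max (M + 1) S); split.
  by move=> z; rewrite le_max HM.
split=> // v; apply: (@smooth_le _ _ _ (\sum_i \sum_j (`|v i j| * C (i, j)))).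
  apply: (@le_trans _ _ (S * `|v|)); last by rewrite ler_wpM2r// le_max lexx orbT.
  rewrite mulr_suml ler_sum// => i _; rewrite mulr_suml ler_sum// => j _.
  by rewrite mulrC ler_wpM2l ?C0// mx_norm_ge_entry.
have -> : 'D_v F = fun z => \sum_i \sum_j v i j * 'D_(delta_mx i j) F z.
  by apply/funext => z; exact: derive_sum_delta.
have sum_smooth (N : nat) (c : 'I_N -> R) (G : 'I_N -> 'M[R]_(m, n) -> R) :
    (forall i, smooth k (c i) (G i)) ->
    smooth k (\sum_i c i) (fun z => \sum_i G i z).
  elim: N c G => [|N IHN] c G cG.
    have -> : (fun z => \sum_(i < 0) G i z) = cst 0.
      by apply/funext => z; rewrite big_ord0.
    by rewrite big_ord0; exact: smooth0.
  have -> : (fun z => \sum_(i < N.+1) G i z) =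
      fun z => \sum_(i < N) G (widen_ord (leqnSn N) i) z + G ord_max z.
    by apply/funext => z; rewrite big_ord_recr.
  rewrite big_ord_recr.
  by apply: smoothD => //; apply: IHN.
by do 2![apply: (sum_smooth) => ?]; apply/smoothZ/HC.
Qed.

Lemma Cb_entry (k p q : nat) (f : 'M[R]_(m, n) -> 'M[R]_(p, q)) i j :
  Cb k f -> Cb k (fun z => f z i j).
Proof.
elim: k f => [|k IH] f /= [cf bf df].
all: have cfe : continuous (fun z => f z i j) by move=> z;
  apply: (@continuous_comp _ _ _ f (fun A : 'M[R]_(p, q) => A i j));
  [exact: cf|exact: coord_continuous].
  split=> //.
  have [M [Mr HM]] := bf; exists M; split=> // x Mx z _ /=.
  exact: le_trans (mx_norm_ge_entry _ _ _) (HM x Mx z I).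
have dfe z : differentiable (fun z => f z i j) z.
  apply: (@differentiable_comp _ _ _ _ f (fun A : 'M[R]_(p, q) => A i j)).
    exact: df.1.
  exact: differentiable_coord.
split=> //.
  have [M [Mr HM]] := bf; exists M; split=> // x Mx z _ /=.
  exact: le_trans (mx_norm_ge_entry _ _ _) (HM x Mx z I).
split=> // v.
rewrite (_ : 'D_v _ = fun z => ('D_v f z) i j); first exact/IH/df.2.
apply/funext => z; rewrite derive_mx ?mxE//.
exact/diff_derivable/df.1.
Qed.

End SmoothMatrix.

(** * Germs and their defect *)

Section Germs.
Context {R : realType} {n d k : nat}.
Variable sigma : 'M[R]_(n, k.+1) -> 'M[R]_(n, d).

Definition smooth_coef (M : R) : Prop :=
  forall p j, smooth 3 M (fun z => sigma z p j).

(** Chain rule: the density of sigma^{pj}(Y) with respect to x delayed by r_i, when column i of Y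
    has density [Z i]. *)
Definition dens_val (Y : 'M[R]_(n, k.+1)) (Z : 'I_k.+1 -> 'M[R]_(n, d))
    (i : 'I_k.+1) (p : 'I_n) (j l : 'I_d) : R :=
  \sum_(q < n) partial sigma p j q i Y * Z i q l.

(** In [W i l j], l is the index of the inner, delayed increment and j that of the outer one. *)
Definition germ2 Y Z (W : 'I_k.+1 -> 'M[R]_d) (p : 'I_n) : R :=
  \sum_(i < k.+1) \sum_(j < d) \sum_(l < d) dens_val Y Z i p j l * W i l j.

Definition germ Y Z (X : 'cV[R]_d) W : 'cV[R]_n :=
  \col_(p < n) (\sum_(j < d) sigma Y p j * X j 0 + germ2 Y Z W p).

(* Everything the defect of the germ at times (s, u, t) depends on: delayed
   points Y and densities Z at s and u, delayed increments X1 over [s, u],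
   increment X2 and areas W2 over [u, t]. *)
Record cfg := Cfg {
  Ys : 'M[R]_(n, k.+1); Yu : 'M[R]_(n, k.+1);
  Zs : 'I_k.+1 -> 'M[R]_(n, d); Zu : 'I_k.+1 -> 'M[R]_(n, d);
  X1 : 'I_k.+1 -> 'cV[R]_d; X2 : 'cV[R]_d; W2 : 'I_k.+1 -> 'M[R]_d }.

Implicit Types c : cfg.

Definition first_order c : 'M[R]_(n, k.+1) :=
  \matrix_(q, i) (Zs c i *m X1 c i) q 0.

(** The remainder of the delayed point as a controlled path: what its densities at time s do not
    predict. For a solution it is of order two. *)
Definition second_order c : 'M[R]_(n, k.+1) := Yu c - Ys c - first_order c.

Definition coef_rem c (p : 'I_n) (j : 'I_d) : R :=
  (sigma (Yu c) - sigma (Ys c)) p j -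
  \sum_(i < k.+1) \sum_(l < d) dens_val (Ys c) (Zs c) i p j l * X1 c i l 0.

Definition dens_incr c i p j l : R :=
  dens_val (Yu c) (Zu c) i p j l - dens_val (Ys c) (Zs c) i p j l.

(** The increment h^p_{sut} that the sewing map is applied to, expressed on a configuration; see
    [integral_defectE]. *)
Definition defect c (p : 'I_n) : R :=
  \sum_(j < d) coef_rem c p j * X2 c j 0 +
  \sum_(i < k.+1) \sum_(j < d) \sum_(l < d) dens_incr c i p j l * W2 c i l j.

(* Chen's relation makes the germ additive up to the defect. *)
Lemma germ_defect c (Wsu Wst : 'I_k.+1 -> 'M[R]_d) (Xsu Xst : 'cV[R]_d) :
  Xst = Xsu + X2 c ->
  (forall i l j, Wst i l j - Wsu i l j - W2 c i l j = X1 c i l 0 * X2 c j 0) ->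
  germ (Ys c) (Zs c) Xst Wst - germ (Ys c) (Zs c) Xsu Wsu -
  germ (Yu c) (Zu c) (X2 c) (W2 c) = - \col_p defect c p.
Proof.
move=> XE WE; apply/colP => p; rewrite !mxE XE.
have -> : \sum_(j < d) sigma (Ys c) p j * (Xsu + X2 c) j 0 =
    \sum_(j < d) sigma (Ys c) p j * Xsu j 0 + \sum_(j < d) sigma (Ys c) p j * X2 c j 0.
  by rewrite -big_split/=; apply: eq_bigr => j _; rewrite mxE mulrDr.
have -> : germ2 (Ys c) (Zs c) Wst p = germ2 (Ys c) (Zs c) Wsu p +
   germ2 (Ys c) (Zs c) (W2 c) p + \sum_(j < d)
   (\sum_(i < k.+1) \sum_(l < d) dens_val (Ys c) (Zs c) i p j l * X1 c i l 0) * X2 c j 0.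
  under [X in _ = _ + X]eq_bigr => j _ do (rewrite mulr_suml; under eq_bigr => i _ do rewrite mulr_suml).
  rewrite [X in _ = _ + X]exchange_big/= /germ2 -!big_split/=.
  apply: eq_bigr => i _; rewrite -!big_split/=; apply: eq_bigr => j _.
  rewrite -!big_split/=; apply: eq_bigr => l _.
  by rewrite -mulrA -WE; ring.
have -> : germ2 (Yu c) (Zu c) (W2 c) p = germ2 (Ys c) (Zs c) (W2 c) p +
  \sum_(i < k.+1) \sum_(j < d) \sum_(l < d) dens_incr c i p j l * W2 c i l j.
  rewrite /germ2 -!big_split/=.
  apply: eq_bigr => i _; rewrite -!big_split/=; apply: eq_bigr => j _.
  rewrite -!big_split/=; apply: eq_bigr => l _.
  by rewrite /dens_incr; ring.
have -> : \sum_(j < d) sigma (Yu c) p j * X2 c j 0 = \sum_(j < d) sigma (Ys c) p j * X2 c j 0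
  + \sum_(j < d) coef_rem c p j * X2 c j 0 + \sum_(j < d)
   (\sum_(i < k.+1) \sum_(l < d) dens_val (Ys c) (Zs c) i p j l * X1 c i l 0) * X2 c j 0.
  rewrite -!big_split/=; apply: eq_bigr => j _.
  by rewrite /coef_rem !mxE; ring.
rewrite /defect; ring.
Qed.

(** * Bounds on the defect of one configuration and on the difference of two *)

Section Estimates.
Variables (M : R) (sigmaM : smooth_coef M).

Lemma partial_smooth p j q i : smooth 2 M (partial sigma p j q i).
Proof.
have [_ [_ /(_ (delta_mx q i)) H]] := sigmaM p j.
apply: (@smooth_le _ _ 2 _ M _ _ H); rewrite ler_piMr ?(smooth_ge0 (sigmaM p j))//.
apply: mx_norm_le => // a b; rewrite mxE.
by case: (_ && _); rewrite ?normr1 ?normr0.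
Qed.

(** Makes [coef_rem] accessible to Taylor's formula: the double sum subtracted there is a
    directional derivative of sigma^{pj}. *)
Lemma first_order_derive c p j :
  \sum_(i < k.+1) \sum_(l < d) dens_val (Ys c) (Zs c) i p j l * X1 c i l 0 =
  'D_(first_order c) (fun z => sigma z p j) (Ys c).
Proof.
rewrite derive_sum_delta; last by have [_ []] := sigmaM p j.
rewrite [RHS]exchange_big; apply: eq_bigr => i _ /=.
under eq_bigr => l _ do rewrite /dens_val mulr_suml.
rewrite exchange_big; apply: eq_bigr => q _/=.
rewrite !mxE mulr_suml; apply: eq_bigr => l _.
by rewrite /partial; ring.
Qed.

Variable N : R.

(** [th] stands for |t - s|^kappa. [Q] is kept apart from [N] because it carries the unknown bound
    on the remainder: the estimates must be linear in it. The condition [1 <= Q] lets terms without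
    [Q] be absorbed. *)
Definition cfg_bounded (Q th : R) c : Prop :=
  [/\ 0 <= th <= N, 1 <= Q,
      forall i, `|Zs c i| <= N /\ `|Zu c i| <= N,
      forall i, `|X1 c i| <= N * th /\ `|W2 c i| <= N * (th * th) &
      [/\ `|X2 c| <= N * th, `|second_order c| <= Q * (th * th),
          `|Yu c - Ys c| <= Q * th & forall i, `|Zu c i - Zs c i| <= Q * th]].

Let I1 := (cfg * R * R)%type.
Let P1 (i : I1) : Prop := cfg_bounded i.1.2 i.2 i.1.1.

Lemma cfg_bounded_ge0 Q th c : cfg_bounded Q th c -> [/\ 0 <= th, 0 <= N & 0 <= Q].
Proof.
move=> [/andP[th0 thN] Q1 _ _ _]; split=> //; first exact: le_trans thN.
exact: le_trans Q1.
Qed.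

Local Notation dom1 f g := (dominated P1 (fun i : I1 => f i.1.1) (fun i : I1 => g i.1.2 i.2)).

(** For [N < 0] the condition [0 <= th <= N] leaves no configuration, and the bound is vacuous. *)
Lemma N_ge0_dom (V : normedModType R) (f : I1 -> V) g :
  (0 <= N -> dominated P1 f g) -> dominated P1 f g.
Proof.
move=> H; case: (leP 0 N) => [/H//|N0]; exists 0 => // i /cfg_bounded_ge0[_ N0' _].
by move: N0; rewrite ltNge N0'.
Qed.

(** The increment is cut at [Ys + first_order]. Up to there Taylor's formula applies, with an
    increment bounded by the data alone; from there to [Yu] the Lipschitz bound suffices, because
    [second_order] is already of order two. Expanding along all of [Yu - Ys] would produce Q^2. *)
Lemma dom_coef_rem p j : dom1 (fun c => coef_rem c p j) (fun Q th => Q * (th * th)).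
Proof.
have M0 := smooth_ge0 (sigmaM p j).
pose f z := sigma z p j.
apply: (@dominated_eq _ _ _ _ (fun i : I1 =>
   (f (Ys i.1.1 + first_order i.1.1 + second_order i.1.1) -
    f (Ys i.1.1 + first_order i.1.1)) +
   (f (Ys i.1.1 + first_order i.1.1) - f (Ys i.1.1) -
    'D_(first_order i.1.1) f (Ys i.1.1)))); last first.
  move=> [[c Q] th] _ /=; rewrite /coef_rem first_order_derive !mxE /f.
  rewrite (_ : Ys c + first_order c + second_order c = Yu c); last first.
    by rewrite -addrA /second_order [first_order c + _]addrC subrK addrC subrK.
  ring.
apply: dominatedD.
  exists M => // -[[c Q] th] /= [_ _ _ _ [_ RQ _ _]].
  apply: le_trans (smooth_increment _ _ (smoothS (smoothS (sigmaM p j)))) _.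
  by rewrite ler_wpM2l.
exists (M * ((d%:R * (N * N)) * (d%:R * (N * N)))).
  by rewrite mulr_ge0 ?sqr_ge0// -expr2 sqr_ge0.
move=> [[c Q] th] cP /=; have [th0 N0 Q0] := cfg_bounded_ge0 cP.
case: cP => /= _ Q1 ZN XN _.
apply: le_trans (smooth_taylor _ _ (smoothS (sigmaM p j))) _.
rewrite -[leRHS]mulrA ler_wpM2l//.
have fo : `|first_order c| <= d%:R * (N * N) * th.
  apply: mx_norm_le => [|q i]; first by rewrite !mulr_ge0.
  rewrite !mxE -mulrA; apply: norm_sum_le => l.
  rewrite -mulrA normrM ler_pM// (le_trans (mx_norm_ge_entry _ _ _))//.
    by have [] := ZN i.
  by have [] := XN i.
apply: (@le_trans _ _ ((d%:R * (N * N) * th) * (d%:R * (N * N) * th))).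
  by rewrite ler_pM.
rewrite [leLHS](_ : _ = (d%:R * (N * N) * (d%:R * (N * N))) * (1 * (th * th))); last by ring.
by rewrite ler_wpM2l ?ler_wpM2r ?mulr_ge0.
Qed.

Lemma dom_dens i p j l : dom1 (fun c => dens_val (Ys c) (Zs c) i p j l) (fun Q th => 1).
Proof.
apply: N_ge0_dom => N0.
apply: dominated_sum => q.
apply: (@dominatedM _ _ _ _ _ (fun=> 1) (fun=> 1)) => [||? _]; last by rewrite mulr1.
  exists M => [|[[c Q] th] _]; first exact: smooth_ge0 (partial_smooth p j q i).
  by rewrite mulr1; have [+ _] := partial_smooth p j q i; apply.
exists N => // -[[c Q] th] [_ _ ZN _ _] /=.
by rewrite mulr1; apply: le_trans (mx_norm_ge_entry _ _ _) _; have [] := ZN i.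
Qed.

Lemma dom_germ2 p : dom1 (fun c => germ2 (Ys c) (Zs c) (W2 c) p) (fun Q th => th * th).
Proof.
apply: N_ge0_dom => N0.
apply: dominated_sum => i; apply: dominated_sum => j; apply: dominated_sum => l.
apply: (@dominatedM _ _ _ _ _ _ (fun t => t.2 * t.2) _ (dom_dens _ _ _ _)) => [|t _];
  last by rewrite mul1r.
apply: dominated_entry; exists N => // -[[c Q] th] [_ _ _ XN _] /=.
by have [] := XN i.
Qed.

Lemma dom_dens_incr i p j l : dom1 (fun c => dens_incr c i p j l) (fun Q th => Q * th).
Proof.
apply: N_ge0_dom => N0.
pose f q := partial sigma p j q i.
have M0 q := smooth_ge0 (partial_smooth p j q i).
apply: (@dominated_eq _ _ _ _ (fun t : I1 => \sum_(q < n)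
   (f q (Yu t.1.1) * Zu t.1.1 i q l - f q (Ys t.1.1) * Zs t.1.1 i q l))); last first.
  by move=> t _; rewrite /dens_incr /dens_val -sumrB.
apply: dominated_sum => q.
apply: (@dominatedMB _ _ _ _ _ _ _ (fun=> 1) (fun t => t.1.2 * t.2)
   (fun t => t.1.2 * t.2) (fun=> 1)) => [||t _|||t _].
- exists M => [|t _]; [exact: M0 | rewrite mulr1].
  by have [+ _] := partial_smooth p j q i; apply.
- apply: (@dominated_eq _ _ _ _ (fun t : I1 => (Zu t.1.1 i - Zs t.1.1 i) q l)).
    apply: dominated_entry; exists 1 => // -[[c Q] th] [_ _ _ _ [_ _ _ ZQ]] /=.
    by rewrite mul1r ZQ.
  by move=> t _; rewrite !mxE.
- by rewrite mul1r.
- exists M => [|[[c Q] th] [_ _ _ _ [_ _ YQ _]] /=]; first exact: M0.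
  apply: le_trans (smooth_lipschitz _ _ (smoothS (partial_smooth p j q i))) _.
  by rewrite ler_wpM2l ?M0.
- exists N => // -[[c Q] th] [_ _ ZN _ _] /=.
  by rewrite mulr1; apply: le_trans (mx_norm_ge_entry _ _ _) _; have [] := ZN i.
- by rewrite mulr1.
Qed.

Lemma dom_defect p : dom1 (fun c => defect c p) (fun Q th => Q * (th * th * th)).
Proof.
apply: N_ge0_dom => N0.
apply: dominatedD.
  apply: dominated_sum => j.
  apply: (@dominatedM _ _ _ _ _ _ (fun t => t.2) _ (dom_coef_rem p j)) => [|t _].
    apply: dominated_entry; exists N => // -[[c Q] th] [_ _ _ _ [XN _ _ _]] //.
  by rewrite !mulrA.
apply: dominated_sum => i; apply: dominated_sum => j; apply: dominated_sum => l.
apply: (@dominatedM _ _ _ _ _ _ (fun t => t.2 * t.2) _ (dom_dens_incr _ _ _ _)) => [|t _].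
  apply: dominated_entry; exists N => // -[[c Q] th] [_ _ _ XN _] /=.
  by have [] := XN i.
by rewrite !mulrA.
Qed.

(** Each configuration is bounded with [Q = N]: when two solutions are compared the a priori bound
    is available, and linearity matters in the distance [q] only. *)
Definition cfg_close (q th : R) c c' : Prop :=
  [/\ cfg_bounded N th c, cfg_bounded N th c', 0 <= q,
    [/\ `|Ys c - Ys c'| <= q, `|Yu c - Yu c'| <= q,
        forall i, `|Zs c i - Zs c' i| <= q /\ `|Zu c i - Zu c' i| <= q,
        forall i, `|X1 c i - X1 c' i| <= q * th & `|X2 c - X2 c'| <= q * th] &
    [/\ forall i, `|W2 c i - W2 c' i| <= q * (th * th),
        `|second_order c - second_order c'| <= q * (th * th),
        `|(Yu c - Ys c) - (Yu c' - Ys c')| <= q * th &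
        forall i, `|(Zu c i - Zs c i) - (Zu c' i - Zs c' i)| <= q * th]].

Let I2 := (cfg * cfg * R * R)%type.
Let P2 (i : I2) : Prop := cfg_close i.1.2 i.2 i.1.1.1 i.1.1.2.

Local Notation dom2 f g := (dominated P2
  (fun i : I2 => f i.1.1.1 - f i.1.1.2) (fun i : I2 => g i.1.2 i.2)).

Lemma dominated_left (V : normedModType R) (f : cfg -> V) g :
  dom1 f g -> dominated P2 (fun i => f i.1.1.1) (fun i => g N i.2).
Proof. by move=> [C C0 H]; exists C => // -[[[c c'] q] th] [cN _ _ _ _]; exact: (H (c, N, th)). Qed.

Lemma N_ge0_dom2 (V : normedModType R) (f : I2 -> V) g :
  (0 <= N -> dominated P2 f g) -> dominated P2 f g.
Proof.
move=> H; case: (leP 0 N) => [/H//|N0]; exists 0 => // i [/cfg_bounded_ge0[_ N0' _]].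
by move: N0; rewrite ltNge N0'.
Qed.

(** Unlike in [dom_coef_rem] the expansion is along the whole increment, its bound being a constant
    by now. The derivative along [second_order] is then left over, and its difference splits into a
    change of direction and a change of base point. *)
Lemma dom2_coef_rem p j : dom2 (fun c => coef_rem c p j) (fun q th => q * (th * th)).
Proof.
apply: N_ge0_dom2 => N0.
have M0 := smooth_ge0 (sigmaM p j).
have dF : forall z, differentiable (fun z => sigma z p j) z by have [_ []] := sigmaM p j.
pose f z := sigma z p j; pose v c := Yu c - Ys c.
pose T c := f (Ys c + v c) - f (Ys c) - 'D_(v c) f (Ys c).
apply: (@dominated_eq _ _ _ _ (fun i : I2 => (T i.1.1.1 - T i.1.1.2) +
   ('D_(second_order i.1.1.1 - second_order i.1.1.2) f (Ys i.1.1.1) +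
    ('D_(second_order i.1.1.2) f (Ys i.1.1.1) -
     'D_(second_order i.1.1.2) f (Ys i.1.1.2))))); last first.
  have E c : coef_rem c p j = T c + 'D_(second_order c) f (Ys c).
    rewrite /coef_rem first_order_derive /T /second_order /v
      (derive_sub _ (Yu c - Ys c))//.
    rewrite [Ys c + _]addrC subrK !mxE -/(f _) -/(f _); ring.
  move=> [[[c c'] q] th] _ /=; rewrite !E.
  by rewrite (derive_sub _ (second_order c))//; ring.
apply: dominatedD; last apply: dominatedD.
- exists (M * (N * ((1 + N) * N + 1) + N)).
    by rewrite mulr_ge0 ?addr_ge0 ?mulr_ge0 ?addr_ge0 ?mulr_ge0 ?addr_ge0.
  move=> [[[c c'] q] th] [cN cN' q0 [YsQ _ _ _ _] [_ _ vQ _]] /=.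
  have [/andP[th0 thN] _ _ _ [_ _ vN _]] := cN.
  have [_ _ _ _ [_ _ vN' _]] := cN'.
  apply: le_trans (smooth_taylor_diff _ _ _ _ (sigmaM p j)) _.
  rewrite -!mulrA ler_wpM2l// /v.
  apply: (@le_trans _ _ (N * th * ((q + q * th) * (N * th) + q * th) + N * th * (q * th))).
    by rewrite lerD ?ler_pM ?lerD ?addr_ge0 ?mulr_ge0 ?addr_ge0 ?ler_pM ?lerD.
  rewrite [leLHS](_ : _ = (N * ((1 + th) * N + 1) + N) * (q * (th * th))); last by ring.
  by rewrite ler_wpM2r ?mulr_ge0// lerD2r ler_wpM2l// lerD2r ler_wpM2r// lerD2l.
- exists M => // -[[[c c'] q] th] [_ _ _ _ [_ sQ _ _]] /=.
  have [_ [_ /(_ (second_order c - second_order c'))[+ _]]] := sigmaM p j.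
  by move=> /(_ (Ys c))/le_trans; apply; rewrite ler_wpM2l.
- exists (M * N); first exact: mulr_ge0.
  move=> [[[c c'] q] th] [_ [_ _ _ _ [_ sN _ _]] q0 [YsQ _ _ _ _] _] /=.
  have [_ [_ /(_ (second_order c')) H]] := sigmaM p j.
  apply: le_trans (smooth_lipschitz _ _ (@smoothS _ _ 1 _ _ H)) _.
  apply: (@le_trans _ _ (M * (N * (th * th)) * q)).
    by rewrite ler_pM ?mulr_ge0 ?ler_wpM2l.
  by rewrite le_eqVlt; apply/orP; left; apply/eqP; ring.
Qed.

Lemma dom2_dens i p j l : dom2 (fun c => dens_val (Ys c) (Zs c) i p j l) (fun q th => q).
Proof.
apply: N_ge0_dom2 => N0.
have M0 q := smooth_ge0 (partial_smooth p j q i).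
apply: dominated_sumB => q.
apply: (@dominatedMB _ _ _ _ _ _ _ (fun=> 1) (fun t => t.1.2)
   (fun t => t.1.2) (fun=> 1)) => [||t _|||t _]; rewrite ?mul1r ?mulr1//.
- exists M => [|t _]; [exact: M0 | rewrite mulr1].
  by have [+ _] := partial_smooth p j q i; apply.
- apply: (@dominated_eq _ _ _ _ (fun t : I2 => (Zs t.1.1.1 i - Zs t.1.1.2 i) q l)).
    apply: dominated_entry; exists 1 => // -[[[c c'] q'] th] [_ _ _ [_ _ ZQ _ _] _] /=.
    by rewrite mul1r; have [] := ZQ i.
  by move=> t _; rewrite !mxE.
- exists M => [|[[[c c'] q'] th] [_ _ _ [YQ _ _ _ _] _] /=]; first exact: M0.
  apply: le_trans (smooth_lipschitz _ _ (smoothS (partial_smooth p j q i))) _.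
  by rewrite ler_wpM2l ?M0.
- exists N => // -[[[c c'] q'] th] [_ [_ _ ZN _ _] _ _ _] /=.
  by rewrite mulr1; apply: le_trans (mx_norm_ge_entry _ _ _) _; have [] := ZN i.
Qed.

Lemma dom2_germ2 p : dom2 (fun c => germ2 (Ys c) (Zs c) (W2 c) p) (fun q th => q * (th * th)).
Proof.
apply: N_ge0_dom2 => N0.
apply: dominated_sumB => i; apply: dominated_sumB => j; apply: dominated_sumB => l.
apply: (@dominatedMB _ _ _ _ _ _ _ (fun=> 1) (fun t => t.1.2 * (t.2 * t.2))
   (fun t => t.1.2) (fun t => t.2 * t.2)) => [||t _|||t _]; rewrite ?mul1r//.
- exact: (dominated_left (dom_dens i p j l)).
- apply: (@dominated_eq _ _ _ _ (fun t : I2 => (W2 t.1.1.1 i - W2 t.1.1.2 i) l j)).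
    by apply: dominated_entry; exists 1 => // -[[[c c'] q'] th] [_ _ _ _ [WQ _ _ _]] /=; rewrite mul1r.
  by move=> t _; rewrite !mxE.
- exact: dom2_dens.
- apply: dominated_entry; exists N => // -[[[c c'] q'] th] [_ [_ _ _ XN _] _ _ _] /=.
  by have [] := XN i.
Qed.

(** Product rule in time, then in the pair of configurations. The increment in time of a partial
    derivative, differenced between the configurations, is a four-point expression; third
    derivatives of sigma occur here as well. *)
Lemma dom2_dens_incr i p j l : dom2 (fun c => dens_incr c i p j l) (fun q th => q * th).
Proof.
apply: N_ge0_dom2 => N0.
have M0 q := smooth_ge0 (partial_smooth p j q i).
pose f q := partial sigma p j q i.
apply: (@dominated_eq _ _ _ _ (fun t : I2 =>
  (\sum_(q < n) (f q (Yu t.1.1.1) - f q (Ys t.1.1.1)) * Zu t.1.1.1 i q l -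
   \sum_(q < n) (f q (Yu t.1.1.2) - f q (Ys t.1.1.2)) * Zu t.1.1.2 i q l) +
  (\sum_(q < n) f q (Ys t.1.1.1) * (Zu t.1.1.1 i - Zs t.1.1.1 i) q l -
   \sum_(q < n) f q (Ys t.1.1.2) * (Zu t.1.1.2 i - Zs t.1.1.2 i) q l))); last first.
  move=> t _; rewrite /dens_incr /dens_val -!sumrB -big_split/=.
  by apply: eq_bigr => q _; rewrite !mxE /f; ring.
apply: dominatedD; apply: dominated_sumB => q.
  apply: (@dominatedMB _ _ _ _ _ _ _ (fun t => t.2) (fun t => t.1.2)
     (fun t => t.1.2 * t.2) (fun=> 1)) => [||t _|||t _]; rewrite ?mulr1// 1?mulrC//.
  - exists (M * N) => [|[[[c c'] q'] th] [[_ _ _ _ [_ _ YN _]] _ _ _ _] /=].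
      by rewrite mulr_ge0 ?M0.
    apply: le_trans (smooth_lipschitz _ _ (smoothS (partial_smooth p j q i))) _.
    by rewrite -mulrA ler_wpM2l ?M0.
  - apply: (@dominated_eq _ _ _ _ (fun t : I2 => (Zu t.1.1.1 i - Zu t.1.1.2 i) q l)).
      apply: dominated_entry; exists 1 => // -[[[c c'] q'] th] [_ _ _ [_ _ ZQ _ _] _] /=.
      by rewrite mul1r; have [] := ZQ i.
    by move=> t _; rewrite !mxE.
  - exists (M * ((1 + N) * N + 1)).
      by rewrite mulr_ge0 ?M0// addr_ge0// mulr_ge0// addr_ge0.
    move=> [[[c c'] q'] th] [cN _ q0 [YsQ _ _ _ _] [_ _ vQ _]] /=.
    have [/andP[th0 thN] _ _ _ [_ _ vN _]] := cN.
    have := smooth_four_point (Ys c) (Ys c') (Yu c - Ys c) (Yu c' - Ys c') (partial_smooth p j q i).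
    rewrite [Ys c + _]addrC [Ys c' + _]addrC !subrK => /le_trans; apply.
    rewrite -mulrA ler_wpM2l ?M0//.
    apply: (@le_trans _ _ ((q' + q' * th) * (N * th) + q' * th)).
      by rewrite lerD// ler_pM ?addr_ge0 ?lerD.
    rewrite [leLHS](_ : _ = ((1 + th) * N + 1) * (q' * th)); last by ring.
    by rewrite ler_wpM2r ?mulr_ge0// lerD2r ler_wpM2r// lerD2l.
  - exists N => // -[[[c c'] q'] th] [_ [_ _ ZN _ _] _ _ _] /=.
    by rewrite mulr1; apply: le_trans (mx_norm_ge_entry _ _ _) _; have [] := ZN i.
apply: (@dominatedMB _ _ _ _ _ _ _ (fun=> 1) (fun t => t.1.2 * t.2)
   (fun t => t.1.2) (fun t => t.2)) => [||t _|||t _]; rewrite ?mul1r//.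
- exists M => [|t _]; [exact: M0 | rewrite mulr1].
  by have [+ _] := partial_smooth p j q i; apply.
- apply: (@dominated_eq _ _ _ _ (fun t : I2 => ((Zu t.1.1.1 i - Zs t.1.1.1 i) -
      (Zu t.1.1.2 i - Zs t.1.1.2 i)) q l)).
    apply: dominated_entry; exists 1 => // -[[[c c'] q'] th] [_ _ _ _ [_ _ _ ZQ]] /=.
    by rewrite mul1r.
  by move=> t _; rewrite !mxE.
- exists M => [|[[[c c'] q'] th] [_ _ _ [YQ _ _ _ _] _] /=]; first exact: M0.
  apply: le_trans (smooth_lipschitz _ _ (smoothS (partial_smooth p j q i))) _.
  by rewrite ler_wpM2l ?M0.
- apply: dominated_entry.
  by exists N => // -[[[c c'] q'] th] [_ [_ _ _ _ [_ _ _ ZN]] _ _ _] /=.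
Qed.

Lemma dom2_defect p : dom2 (fun c => defect c p) (fun q th => q * (th * th * th)).
Proof.
apply: N_ge0_dom2 => N0.
apply: (@dominated_eq _ _ _ _ (fun t : I2 =>
  (\sum_(j < d) coef_rem t.1.1.1 p j * X2 t.1.1.1 j 0 -
   \sum_(j < d) coef_rem t.1.1.2 p j * X2 t.1.1.2 j 0) +
  (\sum_(i < k.+1) \sum_(j < d) \sum_(l < d) dens_incr t.1.1.1 i p j l * W2 t.1.1.1 i l j -
   \sum_(i < k.+1) \sum_(j < d) \sum_(l < d) dens_incr t.1.1.2 i p j l * W2 t.1.1.2 i l j))); last first.
  by move=> t _; rewrite /defect; ring.
apply: dominatedD.
  apply: dominated_sumB => j.
  apply: (@dominatedMB _ _ _ _ _ _ _ (fun t => t.2 * t.2) (fun t => t.1.2 * t.2)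
     (fun t => t.1.2 * (t.2 * t.2)) (fun t => t.2)) => [||t _|||t _].
  - exact: (dominated_const N0 (dominated_left (dom_coef_rem p j))).
  - apply: (@dominated_eq _ _ _ _ (fun t : I2 => (X2 t.1.1.1 - X2 t.1.1.2) j 0)).
      by apply: dominated_entry; exists 1 => // -[[[c c'] q'] th] [_ _ _ [_ _ _ _ XQ] _] /=; rewrite mul1r.
    by move=> t _; rewrite !mxE.
  - by rewrite [leLHS](_ : _ = t.1.2 * (t.2 * t.2 * t.2))//; ring.
  - exact: dom2_coef_rem.
  - by apply: dominated_entry; exists N => // -[[[c c'] q'] th] [_ [_ _ _ _ [XN _ _ _]] _ _ _] /=.
  - by rewrite !mulrA.
apply: dominated_sumB => i; apply: dominated_sumB => j; apply: dominated_sumB => l.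
apply: (@dominatedMB _ _ _ _ _ _ _ (fun t => t.2) (fun t => t.1.2 * (t.2 * t.2))
   (fun t => t.1.2 * t.2) (fun t => t.2 * t.2)) => [||t _|||t _].
- exact: (dominated_const N0 (dominated_left (dom_dens_incr i p j l))).
- apply: (@dominated_eq _ _ _ _ (fun t : I2 => (W2 t.1.1.1 i - W2 t.1.1.2 i) l j)).
    by apply: dominated_entry; exists 1 => // -[[[c c'] q'] th] [_ _ _ _ [WQ _ _ _]] /=; rewrite mul1r.
  by move=> t _; rewrite !mxE.
- by rewrite [leLHS](_ : _ = t.1.2 * (t.2 * t.2 * t.2))//; ring.
- exact: dom2_dens_incr.
- apply: dominated_entry; exists N => // -[[[c c'] q'] th] [_ [_ _ _ XN _] _ _ _] /=.
  by have [] := XN i.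
- by rewrite !mulrA.
Qed.

End Estimates.
End Germs.

(** The five inequalities are what [tcfg_close] asks of its [q], with v = E + del, z = b tau^kappa
    and z' = b. *)
Lemma affine_bounds (R : realFieldType) (M k1 k3 k4 v z z' : R) :
  0 <= M -> 0 <= k1 -> 0 <= k3 -> 0 <= k4 -> 0 <= v -> 0 <= z -> z <= z' ->
  let c := 1 + M + (k1 + 1) + k3 + k4 in
  [/\ v <= c * (v + z'), M * v <= c * (v + z'), (k1 + 1) * v + z <= c * (v + z'),
      k3 * v + k4 * z <= c * (v + z') & z' + v <= c * (v + z')].
Proof.
move=> M0 k10 k30 k40 v0 z0 zz' c; have z'0 : 0 <= z' by exact: le_trans zz'.
have k4z : k4 * z <= k4 * z' by rewrite ler_wpM2l.
have : [/\ 0 <= M * v, 0 <= k1 * v, 0 <= k3 * v & 0 <= k4 * v] by split; nneg.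
have : [/\ 0 <= M * z', 0 <= k1 * z', 0 <= k3 * z' & 0 <= k4 * z'] by split; nneg.
by rewrite /c => -[? ? ? ?] [? ? ? ?]; split; lra.
Qed.

(** * Euler polygons *)

Section UltraLimit.
Context {R : realType}.

(** The image of the ultrafilter clusters in the compact segment; since an ultrafilter contains each
    set or its complement, a cluster point is a limit. *)
Lemma ultra_limit_bounded (U : set_system nat) (v : nat -> R) (B : R) :
  UltraFilter U -> (forall m, `|v m| <= B) ->
  exists l, forall e, 0 < e -> U [set m | `|v m - l| < e].
Proof.
move=> UU vB; have UF := @ultra_proper _ U UU.
have := @segment_compact R (- B) B (v @ U) _ _.
have vU : (v @ U) [set` `[- B, B]].
  rewrite /fmap/=; apply: (filterS _ (filterT : U setT)) => m _ /=.
  by rewrite in_itv/= -ler_norml.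
move=> /(_ _ vU)[l [_ cl]]; exists l => e e0.
have [//|UC] := @in_ultra_setVsetC _ U [set m | `|v m - l| < e] UU.
have [||x [[m /= mC <-]]] := cl (v @` (~` [set m | `|v m - l| < e])) (ball l e).
- by rewrite /fmap/=; apply: filterS UC => m mC; exists m.
- exact: nbhsx_ballx.
rewrite -ball_normE/= distrC => lt_e.
by exfalso; apply: mC.
Qed.

Lemma ultra_limit_bounded_col (n : nat) (U : set_system nat) (v : nat -> 'cV[R]_n) (B : R) :
  UltraFilter U -> (forall m, `|v m| <= B) ->
  exists l, forall e, 0 < e -> U [set m | `|v m - l| <= e].
Proof.
move=> UU vB; have UF := @ultra_proper _ U UU.
have /choice[l Hl] : forall q, exists l, forall e, 0 < e -> U [set m | `|v m q 0 - l| < e].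
  move=> q; apply: (@ultra_limit_bounded U (fun m => v m q 0) B UU) => m.
  exact: le_trans (mx_norm_ge_entry _ _ _) (vB m).
exists (\col_q l q) => e e0.
have : U (\bigcap_(q in [set: 'I_n]) [set m | `|v m q 0 - l q| < e]).
  have H : forall q, U [set m | `|v m q 0 - l q| < e] by move=> q; exact: Hl.
  apply: filterS (filter_forall (F := U) _ H) => m Hm q _; exact: Hm.
apply: filterS => m Hm /=; apply: mx_norm_le => [|q j]; first exact: ltW.
by rewrite ord1 !mxE; apply: ltW; exact: Hm.
Qed.

End UltraLimit.

Section Euler.
Context {R : realType} {n : nat}.
Variables (kappa mu a b C : R) (A : R -> R -> 'cV[R]_n -> 'cV[R]_n).
Hypotheses (kappa_gt0 : 0 < kappa) (mu_gt1 : 1 < mu) (ab : a < b) (C_ge0 : 0 <= C).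
Hypothesis A0 : forall (s : R) v, a <= s <= b -> A s s v = 0.
Hypothesis A_small : forall (s t : R) v, a <= s -> s <= t -> t <= b ->
  `|A s t v| <= C * (t - s) `^ kappa.
Hypothesis A_lip : forall (s t : R) v w, a <= s -> s <= t -> t <= b ->
  `|A s t v - A s t w| <= C * `|v - w|.
(** [A s t v] is the increment predicted over [s, t] from the value v at s, and w a value at u
    reached from v with an error K (u - s)^mu. The defect may grow linearly in K, but with a spare
    factor (t - s)^kappa that makes K reproducible on short intervals. *)
Hypothesis A_chen : forall (s u t K : R) v w, a <= s -> s <= u -> u <= t -> t <= b ->
  0 <= K -> `|w - v - A s u v| <= K * (u - s) `^ mu ->
  `|A s t v - A s u v - A u t w| <= C * (1 + K * (t - s) `^ kappa) * (t - s) `^ mu.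
Variable v0 : 'cV[R]_n.

(** Bisection on a grid cannot halve exactly: of two or more steps the larger part is at most 2/3,
    attained by 3 = 1 + 2. *)
Local Notation rho := ((2 / 3) `^ (mu - 1) : R).

Lemma rho_lt1 : rho < 1.
Proof.
have : rho < 1 `^ (mu - 1).
  by rewrite gt0_ltr_powR ?nnegrE ?divr_ge0//; have := mu_gt1; lra.
by rewrite powR1.
Qed.

Lemma powR_split (x y : R) : 0 <= x -> 0 <= y -> x <= 2 / 3 * (x + y) -> y <= 2 / 3 * (x + y) ->
  x `^ mu + y `^ mu <= rho * (x + y) `^ mu.
Proof.
move=> x0 y0 xm ym; have mu1 := mu_gt1.
have mu0 : 0 < mu by lra.
have mu10 : 0 <= mu - 1 by lra.
rewrite -(mulr_powRB1 x0 mu0) -(mulr_powRB1 y0 mu0) -(mulr_powRB1 (addr_ge0 x0 y0) mu0).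
have le (z : R) : 0 <= z -> z <= 2 / 3 * (x + y) -> z `^ (mu - 1) <= rho * (x + y) `^ (mu - 1).
  move=> z0 zm; rewrite -powRM ?addr_ge0 ?divr_ge0//.
  by apply: ge0_ler_powR; rewrite ?nnegrE// (le_trans z0).
rewrite mulrCA mulrDl; apply: lerD; apply: ler_wpM2l => //; exact: le.
Qed.

Section Polygon.
Variable m : nat.
Local Notation h := ((b - a) / m.+1%:R).

Definition grid (i : nat) : R := a + i%:R * h.

Fixpoint euler (i : nat) : 'cV[R]_n :=
  if i is j.+1 then euler j + A (grid j) (grid j.+1) (euler j) else v0.

Lemma step_gt0 : 0 < h.
Proof. by rewrite divr_gt0// subr_gt0. Qed.

Lemma grid_le i j : (i <= j)%N -> grid i <= grid j.
Proof. by move=> ij; rewrite lerD2l ler_wpM2r ?ler_nat// ltW// step_gt0. Qed.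

Lemma grid_sub i j : (i <= j)%N -> grid j - grid i = (j - i)%:R * h.
Proof. by move=> ij; rewrite /grid natrB//; ring. Qed.

Lemma grid_ge i : a <= grid i.
Proof. by rewrite lerDl mulr_ge0// ltW// step_gt0. Qed.

Lemma grid_le_b i : (i <= m.+1)%N -> grid i <= b.
Proof.
move=> im; rewrite /grid -[leRHS](subrK a) addrC lerD2r.
by rewrite mulrA ler_pdivrMr// mulrC ler_wpM2l ?ler_nat// subr_ge0 ltW.
Qed.

Definition euler_defect i j := euler j - euler i - A (grid i) (grid j) (euler i).

(** Over no step or one step the defect vanishes, which replaces the o(t - s) condition of
    continuous sewing. From two steps on Chen's relation is used at the middle grid point; the bound
    on the left part plays the role of the error of the value there. *)
Lemma euler_bisect (K1 L : R) : 0 <= K1 ->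
  (forall i j, (i <= j <= m.+1)%N -> (j - i)%:R * h <= 2 / 3 * L ->
     `|euler_defect i j| <= K1 * ((j - i)%:R * h) `^ mu) ->
  forall i j, (i <= j <= m.+1)%N -> (j - i)%:R * h <= L ->
    `|euler_defect i j| <=
      (rho * K1 + C * (1 + K1 * ((j - i)%:R * h) `^ kappa)) * ((j - i)%:R * h) `^ mu.
Proof.
move=> K10 H i j /andP[ij jm] ijL.
have r0 : 0 <= rho by exact: powR_ge0.
have C0 := C_ge0.
have h0 := step_gt0.
have [->|[E|ij2]] : (j = i)%N \/ (j = i.+1)%N \/ (i.+2 <= j)%N by lia.
- rewrite /euler_defect A0 ?grid_ge ?grid_le_b//; last exact: leq_trans jm.
  by rewrite !subrr normr0 mulr_ge0 ?powR_ge0 ?addr_ge0 ?mulr_ge0 ?addr_ge0 ?mulr_ge0 ?powR_ge0.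
- rewrite {1}E /euler_defect /= -E [euler i + _]addrC addrK subrr normr0.
  by rewrite mulr_ge0 ?powR_ge0 ?addr_ge0 ?mulr_ge0 ?addr_ge0 ?mulr_ge0 ?powR_ge0.
pose p := ((j - i) %/ 2)%N; pose l := (i + p)%N.
have p_le : (p <= j - i)%N by exact: leq_div.
have il : (i <= l)%N by rewrite leq_addr.
have lj : (l <= j)%N by rewrite /l -(subnKC ij) leq_add2l.
have li_p : (l - i)%N = p by rewrite /l addKn.
have jl_p : (j - l)%N = (j - i - p)%N by rewrite /l subnDA.
have pn : (3 * p <= 2 * (j - i))%N.
  by rewrite /p; lia.
have qn : (3 * (j - i - p) <= 2 * (j - i))%N.
  have : (2 <= j - i)%N by lia.
  by rewrite /p; lia.
set x := (l - i)%:R * h; set y := (j - l)%:R * h.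
have xyE : x + y = (j - i)%:R * h.
  by rewrite /x /y -mulrDl -natrD li_p jl_p subnKC.
have x0 : 0 <= x by rewrite mulr_ge0// ltW.
have y0 : 0 <= y by rewrite mulr_ge0// ltW.
have frac (z : nat) : (3 * z <= 2 * (j - i))%N -> z%:R * h <= 2 / 3 * (x + y).
  move=> zn; rewrite xyE [leRHS]mulrA ler_wpM2r//; first exact: ltW.
  have : (3 * z)%:R <= (2 * (j - i))%:R :> R by rewrite ler_nat.
  by rewrite !natrM; lra.
have xE : x = p%:R * h by rewrite /x li_p.
have xm : x <= 2 / 3 * (x + y) by rewrite {1}xE frac.
have yE : y = (j - i - p)%:R * h by rewrite /y jl_p.
have ym : y <= 2 / 3 * (x + y) by rewrite {1}yE frac.
rewrite -xyE in ijL *.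
have L23 : 2 / 3 * (x + y) <= 2 / 3 * L by rewrite ler_wpM2l// divr_ge0.
have lm : (l <= m.+1)%N by exact: leq_trans jm.
have Jil : `|euler_defect i l| <= K1 * x `^ mu.
  by apply: H; [rewrite il lm|exact: le_trans xm L23].
have Jlj : `|euler_defect l j| <= K1 * y `^ mu.
  by apply: H; [rewrite lj jm|exact: le_trans ym L23].
have := @A_chen (grid i) (grid l) (grid j) K1 (euler i) (euler l) (grid_ge i) (grid_le il)
  (grid_le lj) (grid_le_b jm) K10.
rewrite (grid_sub il) (grid_sub ij) -/x -xyE => /(_ Jil) D.
have -> : euler_defect i j = euler_defect i l + euler_defect l j -
   (A (grid i) (grid j) (euler i) - A (grid i) (grid l) (euler i) - A (grid l) (grid j) (euler l)).
  by rewrite /euler_defect; apply/colP => q; rewrite !mxE; ring.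
apply: le_trans (ler_normB _ _) _; rewrite mulrDl; apply: lerD => //.
apply: le_trans (ler_normD _ _) _; apply: le_trans (lerD Jil Jlj) _.
by rewrite -mulrDr [rho * _]mulrC -[leRHS]mulrA ler_wpM2l// powR_split.
Qed.

(** The hypothesis says that the recursion of [euler_bisect] maps K1 below itself at lengths up to
    [tau], so K1 persists by induction on the number of grid steps; an interval of 2/3 of the length
    has strictly fewer steps. *)
Lemma euler_bound_small (tau K1 : R) : 0 <= K1 -> 0 < tau ->
  rho * K1 + C * (1 + K1 * tau `^ kappa) <= K1 ->
  forall i j, (i <= j <= m.+1)%N -> (j - i)%:R * h <= tau ->
    `|euler_defect i j| <= K1 * ((j - i)%:R * h) `^ mu.
Proof.
move=> K10 tau0 HK; have h0 := step_gt0.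
have main p : forall i j, (i <= j <= m.+1)%N -> (j - i <= p)%N -> (j - i)%:R * h <= tau ->
    `|euler_defect i j| <= K1 * ((j - i)%:R * h) `^ mu.
  elim: p => [|p IH] i j ijm ijp ijt.
    case/andP: ijm => ij jm.
    have -> : j = i by apply/eqP; rewrite eqn_leq ij -subn_eq0 -leqn0 ijp.
    rewrite /euler_defect A0 ?grid_ge ?grid_le_b ?(leq_trans ij jm)//.
    by rewrite !subrr normr0 mulr_ge0 ?powR_ge0.
  have [ij0|ij0] := leqP (j - i) 0; first by apply: IH => //; exact: leq_trans ij0 _.
  have d0 : 0 < (j - i)%:R * h by rewrite mulr_gt0// ltr0n.
  apply: le_trans (@euler_bisect K1 ((j - i)%:R * h) K10 _ i j ijm (lexx _)) _.
    move=> i' j' ijm' le23; apply: IH => //.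
      have : (j' - i')%:R * h < (j - i)%:R * h by apply: (le_lt_trans le23); rewrite gtr_pMl//; lra.
      by rewrite ltr_pM2r// ltr_nat => lt; rewrite -ltnS (leq_trans lt).
    by apply: (le_trans le23); apply: le_trans ijt; rewrite ler_piMl ?(ltW d0)//; lra.
  rewrite ler_wpM2r ?powR_ge0//; apply: le_trans HK; rewrite lerD2l.
  rewrite ler_wpM2l// lerD2l ler_wpM2l//.
  by apply: (ge0_ler_powR (ltW kappa_gt0)); rewrite ?nnegrE//; exact: ltW.
by move=> i j ijm; exact: main (leqnn _).
Qed.

End Polygon.

Lemma euler_bound : exists2 K, 0 <= K & forall m i j, (i <= j <= m.+1)%N ->
  `|euler_defect m i j| <= K * ((j - i)%:R * ((b - a) / m.+1%:R)) `^ mu.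
Proof.
have r1 : rho < 1 by exact: rho_lt1.
have r0 : 0 <= rho by exact: powR_ge0.
have C0 := C_ge0; have k0 := kappa_gt0.
(* The gain (1 - rho) K0 = 2 C pays for C and for C K0 tau^kappa, [tau] being chosen so that K0
   tau^kappa <= 1. *)
pose K0 := 2 * C / (1 - rho).
have K00 : 0 <= K0 by rewrite divr_ge0 ?mulr_ge0// subr_ge0 ltW.
pose tau := ((1 - rho) / (2 * C + 1)) `^ kappa^-1.
have tau0 : 0 < tau by rewrite powR_gt0// divr_gt0//; lra.
have tauE : tau `^ kappa = (1 - rho) / (2 * C + 1).
  by rewrite /tau -powRrM mulVf ?gt_eqF// powRr1// divr_ge0//; lra.
have small : rho * K0 + C * (1 + K0 * tau `^ kappa) <= K0.
  have K0E : (1 - rho) * K0 = 2 * C by rewrite /K0; field; rewrite subr_eq0 gt_eqF.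
  have : C * (K0 * tau `^ kappa) <= C.
    rewrite -[leRHS]mulr1 ler_wpM2l// tauE mulrA ler_pdivrMr ?mul1r; last by lra.
    by rewrite mulrC K0E; lra.
  by move: K0E; rewrite mulrBl mul1r mulrDr mulr1; lra.
(* Beyond [tau] the admissible length grows by 3/2 at each application of [euler_bisect]. The
   constant is allowed to grow too; the number of applications depends on b - a and [tau], not on
   the mesh. *)
have glob p : exists2 K, 0 <= K & forall m i j, (i <= j <= m.+1)%N ->
    (j - i)%:R * ((b - a) / m.+1%:R) <= (3 / 2) ^+ p * tau ->
    `|euler_defect m i j| <= K * ((j - i)%:R * ((b - a) / m.+1%:R)) `^ mu.
  elim: p => [|p [K K_ge0 IH]].
    exists K0 => // m i j ijm; rewrite expr0 mul1r.
    exact: (euler_bound_small K00 tau0 small ijm).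
  exists (rho * K + C * (1 + K * (b - a) `^ kappa)).
    by rewrite addr_ge0 ?mulr_ge0 ?addr_ge0 ?mulr_ge0 ?powR_ge0.
  move=> m i j ijm ijt.
  apply: le_trans (euler_bisect K_ge0 _ ijm ijt) _.
    move=> i' j' ijm' h'; apply: IH => //; apply: (le_trans h').
    by rewrite exprS mulrA mulrA (_ : 2 / 3 * (3 / 2) = 1 :> R) ?mul1r//; field.
  rewrite ler_wpM2r ?powR_ge0// lerD2l ler_wpM2l// lerD2l ler_wpM2l//.
  have h0 : 0 < (b - a) / m.+1%:R by rewrite divr_gt0// subr_gt0.
  have le_ba : (j - i)%:R * ((b - a) / m.+1%:R) <= b - a.
    rewrite mulrA ler_pdivrMr// mulrC ler_wpM2l ?ler_nat//; last first.
      by case/andP: ijm => _; apply: leq_trans; exact: leq_subr.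
    by rewrite subr_ge0 ltW.
  apply: ge0_ler_powR; rewrite ?nnegrE ?(ltW k0)//.
    by rewrite mulr_ge0// ltW.
  by rewrite subr_ge0 ltW.
have [p bap] : exists p, b - a <= (3 / 2) ^+ p * tau.
  pose x := (2 / 3 : R).
  have : (x ^+ p @[p --> \oo] --> 0)%classic by apply: cvg_expr; rewrite /x ger0_norm ?divr_ge0//; lra.
  move=> /cvgrPdist_lt/(_ (tau / (b - a + 1)))[].
    by rewrite divr_gt0// addr_gt0// subr_gt0.
  move=> p _ /(_ p (leqnn p)); rewrite sub0r normrN ger0_norm ?exprn_ge0 ?divr_ge0//.
  have ba1 : 0 < b - a + 1 by rewrite addr_gt0// subr_gt0.
  rewrite ltr_pdivlMr// => xp; exists p.
  have xpE : x ^+ p * (3 / 2) ^+ p = 1.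
    by rewrite -exprMn /x (_ : 2 / 3 * (3 / 2) = 1 :> R) ?expr1n//; field.
  have p0 : 0 < (3 / 2 : R) ^+ p by rewrite exprn_gt0// divr_gt0.
  have : x ^+ p * (b - a + 1) * (3 / 2) ^+ p <= tau * (3 / 2) ^+ p
    by apply: ler_wpM2r; exact: ltW.
  by rewrite mulrAC xpE mul1r mulrC; lra.
have [K K_ge0 HK] := glob p; exists K => // m i j ijm; apply: HK => //.
apply: le_trans bap; have h0 : 0 < (b - a) / m.+1%:R by rewrite divr_gt0// subr_gt0.
rewrite mulrA ler_pdivrMr// mulrC ler_wpM2l ?ler_nat//; last first.
  by case/andP: ijm => _; apply: leq_trans; exact: leq_subr.
by rewrite subr_ge0 ltW.
Qed.

Local Notation h m := ((b - a) / m.+1%:R).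
Local Notation e := euler.

(* The Euler polygons of mesh (b - a) / m.+1 are uniformly bounded, so they
   converge pointwise along an ultrafilter; the germ estimate survives in the
   limit because it holds up to O((t - s) ^ mu) between grid points already. *)
Lemma euler_solution : exists y K, [/\ 0 <= K, y a = v0 &
  forall s t, a <= s -> s <= t -> t <= b ->
    `|y t - y s - A s t (y s)| <= K * (t - s) `^ mu].
Proof.
have [K K0 HK] := euler_bound.
have C0 := C_ge0; have k0 := kappa_gt0.
have ba : 0 < b - a by rewrite subr_gt0.
have h0 m : 0 < h m by rewrite divr_gt0.
pose B := `|v0| + C * (b - a) `^ kappa + K * (b - a) `^ mu.
have mu0 : 0 <= mu by rewrite (le_trans ler01)// ltW.
have grid0 m : grid m 0 = a by rewrite /grid mul0r addr0.
have e_bound m i : (i <= m.+1)%N -> `|e m i| <= B.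
  move=> im; have im' : (0 <= i <= m.+1)%N by [].
  have := HK m 0%N i im'; rewrite /euler_defect/= grid0 subn0 => J.
  have gib : grid m i <= b by exact: grid_le_b.
  have gia : a <= grid m i by exact: grid_ge.
  have gi : i%:R * h m = grid m i - a by rewrite /grid [a + _]addrC addrK.
  have := A_small v0 (lexx a) gia gib => Ai.
  have -> : e m i = v0 + A a (grid m i) v0 + (e m i - v0 - A a (grid m i) v0).
    by apply/colP => q; rewrite !mxE; ring.
  apply: le_trans (ler_normD _ _) _; apply: lerD.
    apply: le_trans (ler_normD _ _) _; rewrite lerD2l; apply: le_trans Ai _.
    rewrite ler_wpM2l//; apply: (ge0_ler_powR (ltW k0)); rewrite ?nnegrE ?subr_ge0 ?lerD2r//.
    exact: ltW.
  apply: le_trans J _; rewrite ler_wpM2l// gi.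
  apply: (ge0_ler_powR mu0); rewrite ?nnegrE ?subr_ge0 ?lerD2r//.
  exact: ltW.
(* Index of the last grid point before t; the cap makes [e_bound] applicable to every real t, also
   outside of [a, b]. *)
pose fl m (t : R) := minn (Num.truncn ((t - a) / h m)) m.+1.
have flP m (t : R) : a <= t -> t <= b -> grid m (fl m t) <= t /\ t < grid m (fl m t) + h m.
  move=> at_ tb; have q0 : 0 <= (t - a) / h m by rewrite divr_ge0 ?subr_ge0// ltW.
  have /andP[q1 q2] := truncn_itv q0.
  have qm : (t - a) / h m <= m.+1%:R.
    by rewrite ler_pdivrMr// mulrCA mulfV ?mulr1// lerD2r.
  have -> : fl m t = Num.truncn ((t - a) / h m).
    by apply/minn_idPl; rewrite -(ler_nat R) (le_trans q1).
  rewrite /grid; move: q1 q2; rewrite ler_pdivlMr// ltr_pdivrMr// => q1 q2; split.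
    by rewrite addrC -lerBrDr.
  by rewrite -addrA addrC -ltrBlDr (lt_le_trans q2)// -natr1 mulrDl mul1r.
have flm m t : (fl m t <= m.+1)%N by exact: geq_minr.
(* One ultrafilter serves all times t at once, so no diagonal extraction is needed. *)
have [U [UU Uoo]] := ultraFilterLemma (_ : ProperFilter \oo).
have UF := @ultra_proper _ U UU.
have /choice[y Hy] : forall t : R, exists l, forall eps, 0 < eps ->
    U [set m | `|e m (fl m t) - l| <= eps].
  by move=> t; apply: (@ultra_limit_bounded_col R n U _ B) => m; exact: e_bound.
have hsmall eps : 0 < eps -> U [set m | h m <= eps].
  move=> eps0; apply: Uoo; exists (Num.bound ((b - a) / eps)) => // m /= hm.
  rewrite ler_pdivrMr// mulrC -ler_pdivrMr//.
  have := archi_boundP (divr_ge0 (ltW ba) (ltW eps0)) => /ltW/le_trans; apply.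
  by rewrite ler_nat leqW.
(* K comes from the polygon between grid points, 2 C from two applications of Chen's relation that
   move s and t to the grid. *)
exists y, (K + 2 * C); split; first by rewrite addr_ge0 ?mulr_ge0.
  apply/eqP; rewrite -subr_eq0 -normr_le0; apply/ler_addgt0Pr => eps eps0.
  have [m /=] := filter_ex (Hy a _ eps0).
  have -> : fl m a = 0%N by rewrite /fl subrr mul0r truncn0 min0n.
  by rewrite /= distrC add0r.
move=> s t as_ st tb.
have [<-|st'] := eqVneq s t.
  by rewrite A0 ?as_ ?(le_trans st)// !subrr normr0 mulr_ge0 ?powR_ge0 ?addr_ge0 ?mulr_ge0.
have {st'}lt_st : s < t by rewrite lt_neqAle st' st.
have ts0 : 0 <= t - s by rewrite subr_ge0.
apply/ler_addgt0Pr => eps eps0.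
(* Number of errors of size d in the final decomposition: 2 for [vN - v], 1 for the value at t, 1
   for each of the two end pieces, and 3 C for the Lipschitz term. *)
pose c := 5 + 3 * C; have c0 : 0 < c by rewrite ltr_pwDl// mulr_ge0.
pose d := eps / c; have d0 : 0 < d by rewrite divr_gt0.
pose hb := (d / (C + 1)) `^ kappa^-1.
have C1 : 0 < C + 1 by rewrite ltr_wpDl.
have hb0 : 0 < hb by rewrite powR_gt0 ?divr_gt0.
have hbE : C * hb `^ kappa <= d.
  rewrite /hb -powRrM mulVf ?gt_eqF// powRr1; last by rewrite divr_ge0// ltW.
  by rewrite mulrA ler_pdivrMr// mulrC ler_wpM2l// ?lerDl// ltW.
have ts20 : 0 < (t - s) / 2 by rewrite divr_gt0// subr_gt0.
have [m [[ms mt] [mh1 mh2]]] := filter_ex (filterI (filterI (Hy s _ d0) (Hy t _ d0))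
  (filterI (hsmall _ hb0) (hsmall _ ts20))).
rewrite /= in ms mt mh1 mh2.
have sb : s <= b := le_trans st tb.
have at_ : a <= t := le_trans as_ st.
set i := fl m s in ms; set j := fl m t in mt.
have [is1 is2] := flP m s as_ sb; have [jt1 jt2] := flP m t at_ tb.
rewrite -/i in is1 is2; rewrite -/j in jt1 jt2.
have gS l : grid m l.+1 = grid m l + h m.
  by rewrite /grid -natr1 mulrDl mul1r addrA.
have hC (p q : R) : p <= q -> q - p <= h m -> C * (q - p) `^ kappa <= d.
  move=> pq qp; apply: le_trans hbE; rewrite ler_wpM2l//.
  apply: (ge0_ler_powR (ltW k0)); rewrite ?nnegrE ?subr_ge0 ?(ltW hb0)//.
  exact: le_trans qp mh1.
(* The mesh is at most half of t - s, so a grid point lies between s and t. *)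
have ij : (i < j)%N.
  rewrite -(ltr_nat R) -(ltr_pM2r (h0 m)) -(ltrD2l a).
  change (grid m i < grid m j).
  move: is1 jt2 mh2; set hm := h m; set gi := grid m i; set gj := grid m j.
  by clearbody hm gi gj => is1' jt2' mh2'; lra.
have jm : (j <= m.+1)%N by exact: flm.
have im1 : (i.+1 <= m.+1)%N := leq_trans ij jm.
pose s' := grid m i.+1; pose t' := grid m j.
have ss' : s <= s' by rewrite /s' gS ltW.
have s's : s' - s <= h m by rewrite /s' gS addrAC -lerBrDr subrr subr_le0.
have s't' : s' <= t' by exact: grid_le.
have t't : t' <= t by [].
have tt' : t - t' <= h m by rewrite lerBlDl ltW.
have s't : s' <= t := le_trans s't' t't.
have as' : a <= s' := le_trans as_ ss'.
have t'b : t' <= b := le_trans t't tb.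
have s'b : s' <= b := le_trans s't tb.
have at' : a <= t' := le_trans as' s't'.
pose v := y s; pose vN := e m i.+1.
have vNv : `|vN - v| <= 2 * d.
  rewrite /vN/= (_ : _ - v = (e m i - v) + A (grid m i) s' (e m i)); last first.
    by rewrite addrAC.
  apply: le_trans (ler_normD _ _) _; rewrite mulr2n mulrDl mul1r; apply: lerD => //.
  apply: le_trans (A_small _ (grid_ge m i) (grid_le m (leqnSn i)) s'b) _.
  by apply: hC; [exact: grid_le|rewrite /s' gS addrC addKr].
(* The values w and w' are exact one-step predictions, so Chen's relation is applied with error K =
   0. *)
pose w := v + A s s' v; pose w' := w + A s' t' w.
have E1 : `|A s t v - A s s' v - A s' t w| <= C * (t - s) `^ mu.
  have := @A_chen s s' t 0 v w as_ ss' s't tb (lexx 0).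
  rewrite mul0r mul0r addr0 mulr1; apply.
  by rewrite /w addrAC addrK subrr normr0.
have E2 : `|A s' t w - A s' t' w - A t' t w'| <= C * (t - s) `^ mu.
  have := @A_chen s' t' t 0 w w' as' s't' t't tb (lexx 0).
  rewrite mul0r mul0r addr0 mulr1 => H; apply: le_trans (H _) _.
    by rewrite /w' addrAC addrK subrr normr0.
  rewrite ler_wpM2l//; apply: (ge0_ler_powR mu0); rewrite ?nnegrE ?subr_ge0//.
  by rewrite lerD2l lerN2.
have E3 : `|A s s' v| <= d.
  by apply: le_trans (A_small _ as_ ss' s'b) _; exact: hC.
have E4 : `|A t' t w'| <= d.
  by apply: le_trans (A_small _ at' t't tb) _; exact: hC.
have E5 : `|A s' t' w - A s' t' vN| <= C * (3 * d).
  apply: le_trans (A_lip _ _ as' s't' t'b) _; rewrite ler_wpM2l//.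
  rewrite (_ : w - vN = A s s' v - (vN - v)); last first.
    by rewrite /w; apply/colP => q; rewrite !mxE; ring.
  by apply: le_trans (ler_normB _ _) _; move: E3 vNv; lra.
have E6 : `|e m j - vN - A s' t' vN| <= K * (t - s) `^ mu.
  have ijm : (i.+1 <= j <= m.+1)%N by rewrite ij.
  have := HK m i.+1 j ijm; rewrite /euler_defect => /le_trans; apply.
  rewrite ler_wpM2l// -(grid_sub m ij).
  apply: (ge0_ler_powR mu0); rewrite ?nnegrE ?subr_ge0//.
  by apply: lerB.
rewrite (_ : y t - y s - A s t (y s) = - (e m j - y t) + (e m j - vN - A s' t' vN) + (vN - v)
   - (A s t v - A s s' v - A s' t w) - (A s' t w - A s' t' w - A t' t w')
   - A s s' v - A t' t w' - (A s' t' w - A s' t' vN)); last first.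
  by rewrite /v; apply/colP => q; rewrite !mxE; ring.
have epsE : eps = c * d by rewrite /d mulrC divfK// gt_eqF.
have {}epsE : eps = 5 * d + 3 * (C * d) by rewrite epsE /c; ring.
move: mt E1 E2 E3 E4 E5 E6 vNv; clearbody v vN w w' s' t'.
rewrite -normrN; set x1 := - (e m j - y t); set x2 := e m j - vN - _; set x3 := vN - v.
set x4 := A s t v - _ - _; set x5 := A s' t w - _ - _; set x6 := A s s' v; set x7 := A t' t w'.
set x8 := A s' t' w - _ => b1 b4 b5 b6 b7 b8 b2 b3.
have : `|x1 + x2 + x3 - x4 - x5 - x6 - x7 - x8| <=
   `|x1| + `|x2| + `|x3| + `|x4| + `|x5| + `|x6| + `|x7| + `|x8|.
  do 4![apply: le_trans (ler_normB _ _) _; apply: lerD => //].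
  apply: le_trans (ler_normB _ _) _; apply: lerD => //.
  do 2![apply: le_trans (ler_normD _ _) _; apply: lerD => //].
move=> /le_trans; apply.
rewrite epsE [leRHS](_ : _ = d + K * (t - s) `^ mu + 2 * d + C * (t - s) `^ mu + C * (t - s) `^ mu
  + d + d + C * (3 * d)); last by ring.
by do 7!apply: lerD => //.
Qed.

End Euler.

(** * Hoelder norms and Lambda *)

Section HolderNorms.
Context {R : realType} {V : normedModType R}.
Implicit Types (h : R -> R -> V) (g : R -> V).

Lemma holder_seminorm_le (mu a b B : R) h :
  (forall s t, s \in `[a, b] -> t \in `[a, b] -> `|h s t| <= B * `|t - s| `^ mu) ->
  (holder_seminorm mu a b h <= B%:E)%E.
Proof.
move=> hB; apply: ge_ereal_sup => _ [s [t [sab tab st ->]]].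
rewrite lee_fin ler_pdivrMr ?hB// powR_gt0// normr_gt0 subr_eq0.
by rewrite eq_sym.
Qed.

(** The seminorm ranges over distinct times and does not see the diagonal, hence the separate
    hypothesis there. *)
Lemma le_holder_seminorm (mu a b B : R) h : 0 <= B ->
  (forall t, t \in `[a, b] -> h t t = 0) -> (holder_seminorm mu a b h <= B%:E)%E ->
  forall s t, s \in `[a, b] -> t \in `[a, b] -> `|h s t| <= B * `|t - s| `^ mu.
Proof.
move=> B0 h0 hB s t sab tab; have [<-|st] := eqVneq s t.
  by rewrite h0// normr0 mulr_ge0// powR_ge0.
rewrite -ler_pdivrMr; last by rewrite powR_gt0// normr_gt0 subr_eq0 eq_sym.
rewrite -lee_fin; apply: le_trans hB; apply: ereal_sup_ubound.
by exists s, t.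
Qed.

Lemma holder_seminorm_ge0 (mu a b : R) h : a < b -> (0 <= holder_seminorm mu a b h)%E.
Proof.
move=> ab; apply: (@le_trans _ _ (`|h a b| / `|b - a| `^ mu)%:E).
  by rewrite lee_fin divr_ge0// powR_ge0.
apply: ereal_sup_ubound; exists a, b; split=> //; rewrite ?in_itv/= ?lexx ?(ltW ab)//.
by rewrite lt_eqF.
Qed.

Lemma holder_seminorm_fin (mu a b : R) h : a < b -> (holder_seminorm mu a b h < +oo)%E ->
  exists2 B, 0 <= B & (holder_seminorm mu a b h <= B%:E)%E.
Proof.
move=> ab; have := @holder_seminorm_ge0 mu a b h ab.
case: (holder_seminorm mu a b h) => [B| |]//; rewrite lee_fin => B0 _.
by exists B.
Qed.

Lemma sup_norm_le (a b B : R) g :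
  (forall t, t \in `[a, b] -> `|g t| <= B) -> (sup_norm a b g <= B%:E)%E.
Proof.
by move=> gB; apply: ge_ereal_sup => _ [t tab <-]; rewrite lee_fin gB.
Qed.

Lemma le_sup_norm (a b B : R) g t : (sup_norm a b g <= B%:E)%E -> t \in `[a, b] -> `|g t| <= B.
Proof.
move=> gB tab; rewrite -lee_fin; apply: le_trans gB; apply: ereal_sup_ubound.
by exists t.
Qed.

Lemma sup_norm_ge0 (a b : R) g : a <= b -> (0 <= sup_norm a b g)%E.
Proof.
move=> ab; apply: (@le_trans _ _ `|g a|%:E); first by rewrite lee_fin.
by apply: ereal_sup_ubound; exists a => //; rewrite /= in_itv/= lexx.
Qed.

Lemma holder_continuous (mu a b B : R) g : 0 < mu -> 0 <= B ->
  (forall s t, s \in `[a, b] -> t \in `[a, b] -> `|g t - g s| <= B * `|t - s| `^ mu) ->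
  {within `[a, b], continuous g}.
Proof.
move=> mu0 B0 gB; apply/subspace_continuousP => t /= tab.
apply/cvgrPdist_le => e e0.
pose del := (e / (B + 1)) `^ mu^-1.
have B1 : 0 < B + 1 by rewrite ltr_wpDl.
have del0 : 0 < del by rewrite powR_gt0 ?divr_gt0.
near=> s.
have sab : s \in `[a, b] by near: s; exact: withinT.
have st : `|t - s| <= del.
  near: s; apply: cvg_within; apply/nbhs_ballP; exists del => //= s /=.
  by rewrite -ball_normE/= => /ltW.
apply: le_trans (gB s t sab tab) _.
apply: (@le_trans _ _ (B * (e / (B + 1)))).
  rewrite ler_wpM2l//.
  have -> : e / (B + 1) = del `^ mu.
    by rewrite /del -powRrM mulVf ?gt_eqF// powRr1// divr_ge0 ?ltW.
  by apply: (ge0_ler_powR (ltW mu0)); rewrite ?nnegrE ?(ltW del0).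
by rewrite mulrCA ler_piMr ?(ltW e0)// ler_pdivrMr// mul1r lerDl.
Unshelve. all: by end_near. Qed.

Lemma holderC1_intro (mu a b B : R) g : 0 < mu -> 0 <= B ->
  (forall s t, s \in `[a, b] -> t \in `[a, b] -> `|g t - g s| <= B * `|t - s| `^ mu) ->
  holderC1 mu a b g.
Proof.
move=> mu0 B0 gB; split; first exact: holder_continuous gB.
by apply: (@le_lt_trans _ _ B%:E); [exact: holder_seminorm_le|rewrite ltry].
Qed.

Lemma holderC2_intro (mu a b B : R) h : 0 < mu ->
  (forall s t, s \in `[a, b] -> t \in `[a, b] -> `|h s t| <= B * `|t - s| `^ mu) ->
  holderC2 mu a b h.
Proof.
move=> mu0 hB; split.
  move=> t tab; apply/eqP; rewrite -normr_le0; apply: le_trans (hB t t tab tab) _.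
  by rewrite subrr normr0 powR0 ?gt_eqF// mulr0.
by apply: (@le_lt_trans _ _ B%:E); [exact: holder_seminorm_le|rewrite ltry].
Qed.

Lemma holderC2_bound (mu a b : R) h : a < b -> holderC2 mu a b h ->
  exists2 B, 0 <= B & forall s t, s \in `[a, b] -> t \in `[a, b] ->
    `|h s t| <= B * `|t - s| `^ mu.
Proof.
move=> ab [h0 /(holder_seminorm_fin ab)[B B0 hB]].
by exists B => //; exact: le_holder_seminorm.
Qed.

Lemma holderC1_bound (mu a b : R) g : a < b -> holderC1 mu a b g ->
  exists2 B, 0 <= B & forall s t, s \in `[a, b] -> t \in `[a, b] ->
    `|delta1 g s t| <= B * `|t - s| `^ mu.
Proof.
move=> ab [_ /(holder_seminorm_fin ab)[B B0 hB]].
by exists B => //; apply: le_holder_seminorm => // t _; rewrite /delta1 subrr.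
Qed.

(** Lowers an exponent at the price of a power of the length; this is how gamma is traded for
    kappa. *)
Lemma powR_exponent_le (mu nu L x : R) : nu <= mu -> 0 < nu -> 0 <= x -> x <= L ->
  x `^ mu <= L `^ (mu - nu) * x `^ nu.
Proof.
move=> numu nu0 x0 xL; have [->|x0'] := eqVneq x 0.
  by rewrite powR0 ?mulr_ge0 ?powR_ge0// gt_eqF// (lt_le_trans nu0).
rewrite -[in leLHS](subrK nu mu) [in leLHS]powRD; last by rewrite x0' implybT.
rewrite ler_wpM2r ?powR_ge0//; apply: ge0_ler_powR; rewrite ?nnegrE ?subr_ge0//.
exact: le_trans xL.
Qed.

End HolderNorms.

Section LambdaBound.
Context {R : realType}.

(** Valid for every h: if h has no sewing, [Lambda] takes its default value 0. *)
Lemma small_increment_Lambda (a b : R) h : a < b -> small_increment a b (Lambda a b h).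
Proof.
move=> ab; rewrite /Lambda; case: xgetP => [g _ [[mu mu1 gmu] _]|_]; last first.
  move=> e e0; exists 1 => // s t _ st _ _.
  by rewrite normr0 mulr_ge0 ?subr_ge0// ltW.
have [B B0 HB] := holderC2_bound ab gmu.
apply: (@small_increment_powR _ _ _ _ mu B) => // s t as_ st tb.
rewrite -[t - s]ger0_norm ?subr_ge0//; apply: HB; rewrite in_itv/=.
  by rewrite as_ (le_trans st).
by rewrite tb (le_trans as_).
Qed.

(** The two sewings may have different exponents, so they are compared through o(t - s) only: their
    difference is additive, and bisection with C = 0 annihilates it. The exponent 2 there is
    arbitrary. *)
Lemma Lambda_unique (a b : R) h g : a < b -> is_Lambda a b h g ->
  forall s t, a <= s -> s <= t -> t <= b -> Lambda a b h s t = g s t.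
Proof.
move=> ab gL; have [HL1 HL2] : is_Lambda a b h (Lambda a b h) by apply: xgetPex; exists g.
have [[mu mu1 gmu] dg] := gL.
have og : small_increment a b g.
  have [B B0 HB] := holderC2_bound ab gmu.
  apply: (@small_increment_powR _ _ _ _ mu B) => // s t as_ st tb.
  rewrite -[t - s]ger0_norm ?subr_ge0//; apply: HB; rewrite in_itv/=.
    by rewrite as_ (le_trans st).
  by rewrite tb (le_trans as_).
have oD := small_incrementB (small_increment_Lambda h ab) og.
have D0 (s u t : R) : a <= s -> s <= u -> u <= t -> t <= b ->
    `|delta2 (fun p q => Lambda a b h p q - g p q) s u t| <= 0 * (t - s) `^ 2.
  move=> as_ su ut tb; have st := le_trans su ut.
  have sab : s \in `[a, b] by rewrite in_itv/= as_ (le_trans st).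
  have uab : u \in `[a, b] by rewrite in_itv/= (le_trans as_ su) (le_trans ut).
  have tab : t \in `[a, b] by rewrite in_itv/= tb (le_trans as_ st).
  have := dg s u t sab uab tab; have := HL2 s u t sab uab tab.
  rewrite /delta2 mul0r normr_le0 => e1 e2.
  by apply/eqP; move: e1; rewrite -e2 => /eqP; rewrite -subr_eq0 => /eqP <-; ring.
move=> s t as_ st tb.
have := sewing_bound (ltr1n R 2) (lexx 0) oD D0 as_ st tb.
by rewrite mulr0 mul0r normr_le0 subr_eq0 => /eqP.
Qed.

Lemma small_increment_col (n : nat) (a b : R) (J : R -> R -> 'cV[R]_n) :
  (forall p, small_increment a b (fun s t => J s t p 0)) -> small_increment a b J.
Proof.
move=> oJ e e0.
have /choice[del Hdel] : forall p, exists del, 0 < del /\ forall s t : R,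
    a <= s -> s <= t -> t <= b -> t - s <= del -> `|J s t p 0| <= e * (t - s).
  by move=> p; have [del del0 H] := oJ p e e0; exists del.
(* [(1 + S)^-1] lies below every [del p], and makes sense also for an empty family. *)
pose S := \sum_p (del p)^-1.
have S0 : 0 <= S by apply: sumr_ge0 => p _; rewrite invr_ge0 ltW//; case: (Hdel p).
have S1 : 0 < 1 + S by rewrite ltr_pwDl.
exists (1 + S)^-1; first by rewrite invr_gt0.
move=> s t as_ st tb ts; apply: mx_norm_le => [|p j].
  by rewrite mulr_ge0 ?subr_ge0// ltW.
rewrite ord1; have [delp0 H] := Hdel p; apply: H => //; apply: le_trans ts _.
rewrite -[leRHS]invrK lef_pV2 ?posrE ?invr_gt0//.
rewrite /S (bigD1 p)//= addrCA lerDl addr_ge0// sumr_ge0// => q _.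
by rewrite invr_ge0 ltW//; case: (Hdel q).
Qed.

End LambdaBound.

(** * Paths with delays *)

Section DelayEquation.
Context {R : realType} {n d k : nat}.
Variables (r : 'I_k.+1 -> R) (T kappa : R).
Variable sigma : 'M[R]_(n, k.+1) -> 'M[R]_(n, d).
Hypotheses (r_delays : is_delays r) (T_gt0 : 0 < T) (kappa_gt : 3^-1 < kappa).
Variables (M : R) (sigmaM : smooth_coef sigma M) (M_ge0 : 0 <= M).

Local Notation rmax := (r ord_max).

Lemma delay0 : r ord0 = 0. Proof. by case: r_delays. Qed.

Lemma delay_ge0 i : 0 <= r i.
Proof.
have [r0 rlt] := r_delays; have [->|i0] := eqVneq i ord0; first by rewrite r0.
by rewrite -r0 ltW// rlt// lt0n.
Qed.

Lemma delay_le_max i : r i <= rmax.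
Proof.
have [r0 rlt] := r_delays; have [->//|i0] := eqVneq i ord_max.
by rewrite ltW// rlt// ltn_neqAle -ltnS ltn_ord andbT; apply: contra i0 => /eqP E; apply/eqP/val_inj.
Qed.

Lemma delay_gap : exists2 g, 0 < g & forall i j, i != j -> g <= `|r i - r j|.
Proof.
have [r0 rlt] := r_delays.
pose S : R := \sum_i \sum_(j | i != j) `|r i - r j|^-1.
have S0 : 0 <= S by apply: sumr_ge0 => i _; apply: sumr_ge0 => j _; rewrite invr_ge0.
exists (1 + S)^-1; first by rewrite invr_gt0 ltr_pwDl.
move=> i j ij.
have rij : 0 < `|r i - r j|.
  rewrite normr_gt0 subr_eq0; have [/rlt/lt_eqF->//|] := ltnP i j.
  rewrite leq_eqVlt => /orP[/eqP E|/rlt/gt_eqF->//].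
  by move: ij; rewrite (val_inj E) eqxx.
rewrite -[leRHS]invrK lef_pV2 ?posrE ?invr_gt0//; last by rewrite ltr_pwDl.
have h1 : `|r i - r j|^-1 <= \sum_(j' | i != j') `|r i - r j'|^-1.
  by rewrite (bigD1 j)//= lerDl sumr_ge0// => l _; rewrite invr_ge0.
have h2 : \sum_(j' | i != j') `|r i - r j'|^-1 <= S.
  by rewrite /S [leRHS](bigD1 i)//= lerDl sumr_ge0// => l _; apply: sumr_ge0 => j' _; rewrite invr_ge0.
by apply: le_trans h1 _; lra.
Qed.

Lemma kappa_gt0 : 0 < kappa. Proof. by apply: lt_trans kappa_gt; rewrite invr_gt0. Qed.

Lemma kappa3_gt1 : 1 < 3 * kappa.
Proof. by rewrite mulrC -ltr_pdivrMr// mul1r. Qed.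

(** The unit of order: paths are of order one, remainders and areas of order two, defects of order
    three, and 3 kappa > 1. *)
Definition hp (s t : R) : R := `|t - s| `^ kappa.

Lemma hp_ge0 s t : 0 <= hp s t. Proof. exact: powR_ge0. Qed.
Hint Resolve hp_ge0 : core.

Lemma hp_sym s t : hp s t = hp t s. Proof. by rewrite /hp distrC. Qed.

Lemma hp_shift s t c : hp (s - c) (t - c) = hp s t.
Proof. by rewrite /hp opprB addrA subrK. Qed.

Lemma hpxx s : hp s s = 0.
Proof. by rewrite /hp subrr normr0 powR0// gt_eqF// kappa_gt0. Qed.

Lemma hp_le (s t h : R) : `|t - s| <= h -> hp s t <= h `^ kappa.
Proof.
move=> le_h; rewrite /hp ge0_ler_powR ?nnegrE ?(le_trans _ le_h)//.
exact/ltW/kappa_gt0.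
Qed.

Lemma hp_sub (s t s' t' : R) : s' <= s -> s <= t -> t <= t' -> hp s t <= hp s' t'.
Proof. by move=> s's st tt'; apply: hp_le; rewrite !ger0_norm; lra. Qed.

Lemma hp2 s t : `|t - s| `^ (2 * kappa) = hp s t * hp s t.
Proof. by rewrite mulrC powRrM powR_mulrn ?powR_ge0// expr2. Qed.

Lemma hp3 s t : `|t - s| `^ (3 * kappa) = hp s t * hp s t * hp s t.
Proof. by rewrite mulrC powRrM powR_mulrn ?powR_ge0// exprSr expr2. Qed.

Record drive := Drive {
  path : R -> 'cV[R]_d; levy : 'I_k.+1 -> R -> R -> 'M[R]_d; init : R -> 'cV[R]_n }.

Implicit Types (D : drive) (y : R -> 'cV[R]_n).

(** All data are measured at the exponent kappa, the initial path at order two as a controlled path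
    of density zero. The last clause is Chen's relation for the delayed areas. *)
Definition good_drive (N : R) D : Prop :=
  [/\ forall s t : R, - rmax <= s <= T -> - rmax <= t <= T ->
        `|delta1 (path D) s t| <= N * hp s t,
      forall (i : 'I_k.+1) (s t : R), 0 <= s <= T -> 0 <= t <= T ->
        `|levy D i s t| <= N * (hp s t * hp s t),
      forall s t : R, - rmax <= s <= 0 -> - rmax <= t <= 0 ->
        `|delta1 (init D) s t| <= N * (hp s t * hp s t) &
      forall (i : 'I_k.+1) (s u t : R), 0 <= s <= T -> 0 <= u <= T -> 0 <= t <= T -> forall l j,
        levy D i s t l j - levy D i s u l j - levy D i u t l j =
        delta1 (path D) (s - r i) (u - r i) l 0 * delta1 (path D) u t j 0].

Definition ext D y := extend (init D) y.
Definition pt D y s := delayed_point r (ext D y) s.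
Definition cf D y s := sigma (pt D y s).
Definition rem D y s t : 'cV[R]_n := delta1 y s t - cf D y s *m delta1 (path D) s t.
(* The initial path has zero density: see coefficient_density. *)
Definition lag D y (a s : R) (i : 'I_k.+1) : 'M[R]_(n, d) :=
  if r i <= a then cf D y (s - r i) else 0.
Definition tgerm D y a s t := germ sigma (pt D y s) (lag D y a s)
  (delta1 (path D) s t) (fun i => levy D i s t).
(** On a solution this is the [Lambda] term of the integral. The time a only decides which delayed
    values carry a density. *)
Definition jinc D y a s t : 'cV[R]_n := delta1 y s t - tgerm D y a s t.
Definition tcfg D y a s u t := Cfg (pt D y s) (pt D y u) (lag D y a s) (lag D y a u)
  (fun i => delta1 (path D) (s - r i) (u - r i)) (delta1 (path D) u t)
  (fun i => levy D i u t).

Definition no_delay_inside (a b : R) : Prop := forall i, ~~ (a < r i < b).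

(** On an interval without interior delay each delayed time stays on one side of 0: it sees either
    the controlled path or the initial path, never both. *)
Lemma no_delay_le (a b s : R) i : no_delay_inside a b -> a < b -> a <= s -> s <= b ->
  if r i <= a then 0 <= s - r i else s - r i <= 0.
Proof.
move=> /(_ i); case: leP => [ra _ _ as_ _|ra /=]; first lra.
by rewrite -leNgt => br _ _ sb; lra.
Qed.

Lemma delay_shift (s S : R) i : 0 <= s <= S -> - rmax <= s - r i <= S.
Proof. by have := delay_le_max i; have := delay_ge0 i; lra. Qed.

Lemma ext_ge0 D y (t : R) : 0 <= t -> ext D y t = y t.
Proof. by move=> t0; rewrite /ext /extend ltNge t0. Qed.

Lemma ext_le0 D y (t : R) : y 0 = init D 0 -> t <= 0 -> ext D y t = init D t.
Proof.
by move=> y0; rewrite le_eqVlt /ext /extend => /orP[/eqP->|->//]; rewrite ltxx.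
Qed.

(** Column by column the second-order part is a remainder of y at shifted times or, because of the
    zero density, a whole increment of the initial path; both are of order two. *)
Lemma second_order_tcfg D y (a b s u t : R) q i : y 0 = init D 0 ->
  no_delay_inside a b -> a < b -> a <= s -> s <= b -> a <= u -> u <= b ->
  second_order (tcfg D y a s u t) q i =
    (if r i <= a then rem D y (s - r i) (u - r i)
     else delta1 (init D) (s - r i) (u - r i)) q 0.
Proof.
move=> y0 nd ab as_ sb au ub; rewrite /second_order /first_order !mxE /=.
have := no_delay_le i nd ab as_ sb; have := no_delay_le i nd ab au ub.
rewrite /lag; case: ifPn => _ u0 s0.
  by rewrite !ext_ge0// /rem /delta1 !mxE.
rewrite !ext_le0// /delta1 [X in _ - X]big1 ?subr0 ?mxE// => l _.
by rewrite mxE mul0r.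
Qed.

(** The increment of y is additive, so only the germ contributes, with opposite sign. *)
Lemma jinc_delta2 D y (N a s u t : R) : good_drive N D ->
  0 <= s <= T -> 0 <= u <= T -> 0 <= t <= T ->
  delta2 (jinc D y a) s u t = \col_p defect sigma (tcfg D y a s u t) p.
Proof.
move=> [_ _ _ chen] sT uT tT.
have := @germ_defect _ _ _ _ sigma (tcfg D y a s u t) (fun i => levy D i s u)
  (fun i => levy D i s t) (delta1 (path D) s u) (delta1 (path D) s t) _ _ => /=.
rewrite -/(tgerm D y a s t) -/(tgerm D y a s u) -/(tgerm D y a u t) => H.
rewrite /delta2 /jinc -[RHS]opprK -H; first last.
- by move=> i l j; exact: chen.
- by rewrite /delta1 [RHS]addrC addrA subrK.
rewrite /delta1; apply/colP => p; rewrite !mxE; ring.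
Qed.

Lemma sigma_bound Y : `|sigma Y| <= M.
Proof. by apply: mx_norm_le => // p j; have [+ _] := sigmaM p j; apply. Qed.

Lemma sigma_lip Y Y' : `|sigma Y - sigma Y'| <= M * `|Y - Y'|.
Proof.
apply: mx_norm_le => [|p j]; first exact: mulr_ge0.
rewrite !mxE; exact: smooth_lipschitz (smoothS (smoothS (sigmaM p j))).
Qed.

(** No order of s and t is imposed, as in [holderC2]. The scale [tau] is a parameter because the
    bound is first improved on short intervals. *)
Definition rem_bounded (S tau B : R) D y : Prop :=
  forall s t : R, 0 <= s <= S -> 0 <= t <= S -> `|t - s| <= tau ->
    `|rem D y s t| <= B * (hp s t * hp s t).

(** Hoelder constant of the extended path at scale [tau]: the first term comes from sigma times the
    increment of x, B from the remainder, the last N from the initial path. *)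
Definition incr_cst (N tau B : R) : R := d%:R * (M * N) + (B + N) * tau `^ kappa.

Section Single.
Variables (N : R) (D : drive) (y : R -> 'cV[R]_n).
Hypotheses (N_ge0 : 0 <= N) (gD : good_drive N D) (y0 : y 0 = init D 0).
Variables (S tau B : R).
Hypotheses (S_ge0 : 0 <= S) (ST : S <= T) (B_ge0 : 0 <= B) (tau_ge0 : 0 <= tau).
Hypothesis remB : rem_bounded S tau B D y.
Local Notation G := (incr_cst N tau B).

Lemma y_incr (s t : R) : 0 <= s <= S -> 0 <= t <= S -> `|t - s| <= tau ->
  `|delta1 y s t| <= (d%:R * (M * N) + B * tau `^ kappa) * hp s t.
Proof.
move=> sS tS st.
have -> : delta1 y s t = cf D y s *m delta1 (path D) s t + rem D y s t.
  by rewrite /rem addrC subrK.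
have [xN _ _ _] := gD.
have ST' := ST; have S0' := S_ge0; have T0' := T_gt0; have rk0 : 0 <= rmax := delay_ge0 _.
apply: (le_trans (ler_normD _ _)); rewrite mulrDl lerD//.
  apply: le_trans (norm_mulmx_le _ _) _.
  rewrite -!mulrA ler_wpM2l// ler_pM//; first exact: sigma_bound.
  by apply: xN; lra.
apply: le_trans (remB sS tS st) _.
by rewrite -mulrA ler_wpM2l// ler_wpM2r// hp_le.
Qed.

Section Increments.
Variable g : R.
Hypothesis g_ge0 : 0 <= g.
Hypothesis y_holder : forall s t : R, 0 <= s <= S -> 0 <= t <= S -> `|t - s| <= tau ->
  `|delta1 y s t| <= g * hp s t.
Local Notation g' := (g + N * tau `^ kappa).

(** Stated for any Hoelder constant g of y, since the existence part uses these bounds before a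
    remainder bound in both orders is available. An increment across 0 is cut at 0, and the two
    constants add up. *)
Lemma ext_incr_of (s t : R) : - rmax <= s <= S -> - rmax <= t <= S -> `|t - s| <= tau ->
  `|delta1 (ext D y) s t| <= g' * hp s t.
Proof.
wlog st : s t / s <= t => [H sS tS tau_st|sS tS tau_st].
  have [st|/ltW ts] := leP s t; first exact: H.
  by rewrite hp_sym /delta1 distrC; apply: H => //; rewrite distrC.
have [xN _ xiN _] := gD.
have ST' := ST; have S0' := S_ge0; have T0' := T_gt0; have rk0 : 0 <= rmax := delay_ge0 _.
have xi_incr s' t' : - rmax <= s' -> s' <= t' -> t' <= 0 -> `|t' - s'| <= tau ->
    `|delta1 (init D) s' t'| <= N * tau `^ kappa * hp s' t'.
  move=> ? ? ? ?; apply: le_trans (xiN _ _ _ _) _; [lra|lra|].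
  by rewrite -mulrA ler_wpM2l// ler_wpM2r// hp_le.
have c2 : 0 <= N * tau `^ kappa by rewrite mulr_ge0 ?powR_ge0.
have [s0|s0] := leP 0 s.
  rewrite /delta1 !ext_ge0 ?(le_trans s0)//.
  apply: le_trans (y_holder _ _ tau_st) _; [lra|lra|].
  by rewrite ler_wpM2r// lerDl.
have [t0|t0] := leP t 0.
  rewrite /delta1 !ext_le0 ?(ltW s0)//.
  apply: le_trans (xi_incr _ _ _ st t0 tau_st) _; first lra.
  by rewrite ler_wpM2r// lerDr.
have -> : delta1 (ext D y) s t = delta1 (init D) s 0 + delta1 y 0 t.
  rewrite /delta1 ext_ge0 ?(ltW t0)// ext_le0 ?(ltW s0)// y0.
  by rewrite [RHS]addrC addrA subrK.
have tau_st' : t - s <= tau by rewrite ger0_norm in tau_st => //; lra.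
apply: (le_trans (ler_normD _ _)); rewrite mulrDl addrC lerD//.
  apply: le_trans (y_holder _ _ _) _; [lra|lra|by rewrite ger0_norm; lra|].
  by rewrite ler_wpM2l// hp_sub; lra.
apply: le_trans (xi_incr _ _ _ _ _ _) _ => //; [lra|lra|by rewrite ger0_norm; lra|].
by rewrite ler_wpM2l// hp_sub; lra.
Qed.

Lemma g'_ge0 : 0 <= g'.
Proof. by rewrite addr_ge0 ?mulr_ge0 ?powR_ge0. Qed.

Lemma pt_incr_of (s t : R) : 0 <= s <= S -> 0 <= t <= S -> `|t - s| <= tau ->
  `|pt D y t - pt D y s| <= g' * hp s t.
Proof.
move=> sS tS st; apply: mx_norm_le => [|q i]; first by rewrite mulr_ge0 ?g'_ge0.
rewrite !mxE -(hp_shift s t (r i)).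
have := ext_incr_of (delay_shift i sS) (delay_shift i tS).
rewrite opprB addrA subrK => /(_ st); apply: le_trans.
by have := mx_norm_ge_entry (delta1 (ext D y) (s - r i) (t - r i)) q 0; rewrite !mxE.
Qed.

Lemma cf_incr_of (s t : R) : 0 <= s <= S -> 0 <= t <= S -> `|t - s| <= tau ->
  `|cf D y t - cf D y s| <= M * g' * hp s t.
Proof.
move=> sS tS st; apply: le_trans (sigma_lip _ _) _.
by rewrite -mulrA ler_wpM2l// pt_incr_of.
Qed.

End Increments.

Let g0 : R := d%:R * (M * N) + B * tau `^ kappa.

Let g0_ge0 : 0 <= g0.
Proof. by rewrite addr_ge0 ?mulr_ge0 ?powR_ge0. Qed.

Let GE : G = g0 + N * tau `^ kappa.
Proof. by rewrite /incr_cst /g0; ring. Qed.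

Lemma ext_incr (s t : R) : - rmax <= s <= S -> - rmax <= t <= S -> `|t - s| <= tau ->
  `|delta1 (ext D y) s t| <= G * hp s t.
Proof. by rewrite GE; exact: (ext_incr_of g0_ge0 y_incr). Qed.

Lemma G_ge0 : 0 <= G.
Proof. by rewrite GE; exact: g'_ge0. Qed.

Lemma pt_incr (s t : R) : 0 <= s <= S -> 0 <= t <= S -> `|t - s| <= tau ->
  `|pt D y t - pt D y s| <= G * hp s t.
Proof. by rewrite GE; exact: (pt_incr_of g0_ge0 y_incr). Qed.

Lemma cf_incr (s t : R) : 0 <= s <= S -> 0 <= t <= S -> `|t - s| <= tau ->
  `|cf D y t - cf D y s| <= M * G * hp s t.
Proof. by rewrite GE; exact: (cf_incr_of g0_ge0 y_incr). Qed.

(** The times are not ordered, as the Hoelder classes require both orders; [th] has to dominate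
    [hp s u] and [hp u t] only. *)
Lemma tcfg_bounded (N' Q a b s u t th : R) :
  N <= N' -> M <= N' -> th <= N' -> 1 <= Q -> B + N <= Q -> G <= Q -> M * G <= Q ->
  0 <= a -> a < b -> b <= S -> no_delay_inside a b ->
  a <= s -> s <= b -> a <= u -> u <= b -> a <= t -> t <= b -> `|u - s| <= tau ->
  hp s u <= th -> hp u t <= th ->
  cfg_bounded N' Q th (tcfg D y a s u t).
Proof.
move=> NN' MN' thN' Q1 BNQ GQ MGQ a0 ab bS nd as_ sb au ub at_ tb usS sth uth.
have [xN lN xiN _] := gD.
have rk0 : 0 <= rmax := delay_ge0 _.
have th0 : 0 <= th := le_trans (hp_ge0 s u) sth.
have s0 : 0 <= s := le_trans a0 as_.
have u0' : 0 <= u := le_trans a0 au.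
have t0 : 0 <= t := le_trans a0 at_.
have sS' : s <= S := le_trans sb bS.
have uS' : u <= S := le_trans ub bS.
have tS' : t <= S := le_trans tb bS.
have sS : 0 <= s <= S by rewrite s0.
have uS : 0 <= u <= S by rewrite u0'.
have sT : 0 <= s <= T by rewrite s0 (le_trans sS').
have uT : 0 <= u <= T by rewrite u0' (le_trans uS').
have tT : 0 <= t <= T by rewrite t0 (le_trans tS').
have inT (v : R) : 0 <= v <= T -> - rmax <= v <= T.
  by move=> /andP[v0 ->]; rewrite andbT (le_trans _ v0)// oppr_le0.
have lagS (v : R) i : 0 <= v - r i -> 0 <= v <= S -> 0 <= v - r i <= S.
  by move=> -> vS; have /andP[_ ->] := delay_shift i vS.
have lag0 (v : R) i : v - r i <= 0 -> 0 <= v <= S -> - rmax <= v - r i <= 0.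
  by move=> -> vS; have /andP[-> _] := delay_shift i vS.
have N'0 : 0 <= N' := le_trans N_ge0 NN'.
have Q0 : 0 <= Q := le_trans ler01 Q1.
have lagN v i : `|lag D y a v i| <= N'.
  rewrite /lag; case: ifP => _; last by rewrite normr0.
  exact: le_trans (sigma_bound _) MN'.
have thth : hp s u * hp s u <= th * th by rewrite ler_pM.
have shiftT v i : 0 <= v <= T -> - rmax <= v - r i <= T by exact: delay_shift.
split=> //=; first by rewrite th0.
- move=> i; split.
    apply: le_trans (xN _ _ (shiftT _ i sT) (shiftT _ i uT)) _.
    by rewrite hp_shift ler_pM.
  apply: le_trans (lN _ _ _ uT tT) _.
  by rewrite ler_pM ?mulr_ge0 ?ler_pM.
split.
- apply: le_trans (xN _ _ (inT _ uT) (inT _ tT)) _.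
  by rewrite ler_pM.
- apply: mx_norm_le => [|q i]; first by rewrite !mulr_ge0.
  rewrite (second_order_tcfg _ _ _ y0 nd ab)//.
  apply: le_trans (mx_norm_ge_entry _ _ _) _.
  apply: (@le_trans _ _ ((B + N) * (hp s u * hp s u))); last by rewrite ler_pM ?addr_ge0 ?mulr_ge0.
  have := no_delay_le i nd ab as_ sb; have := no_delay_le i nd ab au ub.
  case: ifP => _ ui si.
    apply: le_trans (remB _ _ _) _; rewrite ?opprB ?addrA ?subrK//.
    - exact: lagS.
    - exact: lagS.
    by rewrite hp_shift ler_wpM2r ?mulr_ge0// lerDl.
  apply: le_trans (xiN _ _ _ _) _.
  - exact: lag0.
  - exact: lag0.
  by rewrite hp_shift ler_wpM2r ?mulr_ge0// lerDr.
- apply: le_trans (pt_incr sS uS usS) _.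
  by rewrite ler_pM ?G_ge0.
move=> i; rewrite /lag.
have := no_delay_le i nd ab as_ sb; have := no_delay_le i nd ab au ub.
case: ifP => _ ui si; last by rewrite subrr normr0 mulr_ge0.
apply: le_trans (cf_incr _ _ _) _; rewrite ?opprB ?addrA ?subrK//.
- exact: lagS.
- exact: lagS.
by rewrite hp_shift ler_pM ?mulr_ge0 ?G_ge0.
Qed.

End Single.

Local Notation cfg := (@cfg R n d k).

(** * A priori bound *)

Lemma delay_split : exists2 g, 0 < g & forall s t : R, s < t -> t - s < g ->
  no_delay_inside s t \/ exists u, [/\ s < u, u < t,
    no_delay_inside s u & no_delay_inside u t].
Proof.
have [g g0 gP] := delay_gap; exists g => // s t st tsg.
have [nd|] := pselect (no_delay_inside s t); first by left.
move=> /existsNP[i /negP]; rewrite negbK => /andP[si it]; right.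
exists (r i); split=> // j; apply/negP => /andP[h1 h2].
- have /gP : i != j by apply/eqP => E; move: h2; rewrite E ltxx.
  by rewrite ger0_norm; lra.
- have /gP : i != j by apply/eqP => E; move: h1; rewrite E ltxx.
  by rewrite ltr0_norm; lra.
Qed.

(** A short interval is cut at its only delay, each part costing A and the correction [chi] costing
    L; reversing the times costs another L. The abstract [rho] will be the remainder of one solution
    and the difference of two remainders. *)
Lemma straddle_bound : exists2 g, 0 < g &
  forall (V : normedModType R) (rho : R -> R -> V) (chi : R -> R -> R -> V) (S tau A L : R),
    0 <= A -> 0 <= L -> tau < g ->
    (forall s u t, rho s t = rho s u + rho u t + chi s u t) -> (forall s, rho s s = 0) ->
    (forall s u t : R, 0 <= s <= S -> 0 <= u <= S -> 0 <= t <= S -> `|u - s| <= tau ->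
       `|chi s u t| <= L * (hp s u * hp u t)) ->
    (forall s t : R, 0 <= s -> s < t -> t <= S -> t - s <= tau -> no_delay_inside s t ->
       `|rho s t| <= A * (hp s t * hp s t)) ->
    forall s t : R, 0 <= s <= S -> 0 <= t <= S -> `|t - s| <= tau ->
      `|rho s t| <= (2 * A + 2 * L) * (hp s t * hp s t).
Proof.
have [g g0 split_g] := delay_split; exists g => // V rho chi S tau A L A0 L0 taug.
move=> chasles rho0 chiL rhoA.
have A2 s t : 0 <= A * (hp s t * hp s t) by nneg.
have L2 s t : 0 <= L * (hp s t * hp s t) by nneg.
have ordered s t : 0 <= s -> s < t -> t <= S -> t - s <= tau ->
    `|rho s t| <= (2 * A + L) * (hp s t * hp s t).
  move=> s0 st tS ts.
  have -> : (2 * A + L) * (hp s t * hp s t) = A * (hp s t * hp s t) +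
    A * (hp s t * hp s t) + L * (hp s t * hp s t) by ring.
  have [nd|[u [su ut nd1 nd2]]] := split_g s t st (le_lt_trans ts taug).
    apply: le_trans (rhoA _ _ s0 st tS ts nd) _.
    by rewrite -addrA lerDl addr_ge0.
  have hsu : hp s u <= hp s t by exact: (hp_sub (lexx _) (ltW su) (ltW ut)).
  have hut : hp u t <= hp s t by exact: (hp_sub (ltW su) (ltW ut) (lexx _)).
  have uS : u <= S by rewrite (le_trans (ltW ut)).
  have u0 : 0 <= u by rewrite (le_trans s0)// ltW.
  have us : u - s <= tau by apply: le_trans ts; rewrite lerD2r ltW.
  have tu : t - u <= tau by apply: le_trans ts; rewrite lerD2l lerN2 ltW.
  rewrite (chasles s u t).
  apply: (le_trans (ler_normD _ _)); apply: lerD.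
    apply: (le_trans (ler_normD _ _)); apply: lerD.
      apply: le_trans (rhoA s u s0 su uS us nd1) _.
      by rewrite ler_wpM2l// ler_pM.
    apply: le_trans (rhoA u t u0 ut tS tu nd2) _.
    by rewrite ler_wpM2l// ler_pM.
  apply: le_trans (chiL s u t _ _ _ _) _.
  - by rewrite s0 (le_trans (ltW su)).
  - by rewrite u0.
  - by rewrite tS (le_trans u0 (ltW ut)).
  - by rewrite ger0_norm// subr_ge0 ltW.
  by rewrite ler_wpM2l// ler_pM.
have E s t : (2 * A + 2 * L) * (hp s t * hp s t) =
    (2 * A + L) * (hp s t * hp s t) + L * (hp s t * hp s t) by ring.
move=> s t sS tS ts; rewrite E.
case/andP: (sS) => s0 sS'; case/andP: (tS) => t0 tS'.
have [st|ts'|<-] := ltgtP s t.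
- apply: le_trans (ordered _ _ s0 st tS' _) _; last by rewrite lerDl.
  by apply: le_trans ts; rewrite ler_norm.
(* The relation over the times s, t, s, where [rho s s] vanishes. *)
- have -> : rho s t = - rho t s - chi s t s.
    have := chasles s t s; rewrite rho0 => /esym/eqP; rewrite addrAC addr_eq0 => /eqP <-.
    by rewrite addrK.
  apply: (le_trans (ler_normB _ _)); rewrite normrN; apply: lerD.
    rewrite hp_sym; apply: ordered => //.
    by apply: le_trans ts; rewrite distrC ler_norm.
  by rewrite {2}[hp s t]hp_sym; apply: chiL.
by rewrite rho0 normr0 addr_ge0 ?mulr_ge0 ?addr_ge0 ?mulr_ge0.
Qed.

Lemma rem_chasles D y s u t :
  rem D y s t = rem D y s u + rem D y u t + (cf D y u - cf D y s) *m delta1 (path D) u t.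
Proof.
rewrite /rem mulmxBl.
have -> : delta1 (path D) s t = delta1 (path D) s u + delta1 (path D) u t.
  by rewrite /delta1 [RHS]addrC addrA subrK.
by rewrite mulmxDr /delta1; apply/colP => p; rewrite !mxE; ring.
Qed.

Lemma remxx D y s : rem D y s s = 0.
Proof. by rewrite /rem /delta1 !subrr mulmx0 subrr. Qed.

(** The remainder differs from the increment minus the germ by the area term alone. Writing it on
    the degenerate configuration u = s lets the general estimates bound it. *)
Lemma rem_jinc D y a s t : rem D y s t = jinc D y a s t +
  \col_p germ2 sigma (Ys (tcfg D y a s s t)) (Zs (tcfg D y a s s t))
     (W2 (tcfg D y a s s t)) p.
Proof.
rewrite /jinc /tgerm /rem /germ; apply/colP => p; rewrite !mxE /=; ring.
Qed.

(** Davie's notion of solution. The bound B in the last clause is arbitrary and serves to start the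
    absorption arguments. *)
Definition germ_solution D y : Prop :=
  [/\ y 0 = init D 0,
     forall a b, 0 <= a -> a < b -> b <= T -> no_delay_inside a b ->
       small_increment a b (jinc D y a) &
     exists2 B, 0 <= B & rem_bounded T T B D y].

Lemma le_incr_cst (N tau B : R) : 0 <= N -> 0 <= B -> 0 <= incr_cst N tau B.
Proof. by move=> N0 B0; rewrite addr_ge0 ?mulr_ge0 ?addr_ge0 ?powR_ge0. Qed.

Lemma defect_vec_bound (N : R) : 0 <= N -> exists2 C, 0 <= C &
  forall (Q th : R) (c : cfg), cfg_bounded N Q th c ->
    `|\col_p defect sigma c p : 'cV[R]_n| <= C * (Q * (th * th * th)).
Proof.
move=> N0.
have : dominated (fun i : cfg * R * R => cfg_bounded N i.1.2 i.2 i.1.1)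
  (fun i => \col_p defect sigma i.1.1 p : 'cV[R]_n) (fun i => i.1.2 * (i.2 * i.2 * i.2)).
  apply: dominated_mx => [i /cfg_bounded_ge0[th0 _ Q0]|p q]; first by rewrite !mulr_ge0.
  apply: (dominated_eq (dom_defect sigmaM N p)) => i _; by rewrite mxE.
by move=> [C C0 H]; exists C => // Q th c; exact: (H (c, Q, th)).
Qed.

Lemma germ2_vec_bound (N : R) : 0 <= N -> exists2 C, 0 <= C &
  forall (Q th : R) (c : cfg), cfg_bounded N Q th c ->
    `|\col_p germ2 sigma (Ys c) (Zs c) (W2 c) p : 'cV[R]_n| <= C * (th * th).
Proof.
move=> N0.
have : dominated (fun i : cfg * R * R => cfg_bounded N i.1.2 i.2 i.1.1)
  (fun i => \col_p germ2 sigma (Ys i.1.1) (Zs i.1.1) (W2 i.1.1) p : 'cV[R]_n)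
  (fun i => i.2 * i.2).
  apply: dominated_mx => [i /cfg_bounded_ge0[th0 _ Q0]|p q]; first by rewrite !mulr_ge0.
  apply: (dominated_eq (dom_germ2 sigmaM N p)) => i _; by rewrite mxE.
by move=> [C C0 H]; exists C => // Q th c; exact: (H (c, Q, th)).
Qed.

(** Dominates the three things that [cfg_bounded] compares with its constant: the data, sigma, and
    [hp s t] on [0, T]. *)
Definition big_cst N : R := N + M + T `^ kappa.

Lemma tcfg_good (N : R) D y (S tau B Q a b s u t : R) :
  0 <= N -> good_drive N D -> y 0 = init D 0 -> 0 <= S -> S <= T ->
  0 <= B -> 0 <= tau -> rem_bounded S tau B D y ->
  1 <= Q -> B + N <= Q -> incr_cst N tau B <= Q -> M * incr_cst N tau B <= Q ->
  0 <= a -> a < b -> b <= S -> no_delay_inside a b ->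
  a <= s -> s <= u -> u <= t -> t <= b -> u - s <= tau ->
  cfg_bounded (big_cst N) Q (hp s t) (tcfg D y a s u t).
Proof.
move=> N0 gD y0 S0 ST B0 tau0 remB Q1 BNQ GQ MGQ a0 ab bS nd as_ su ut tb usS.
have k0 := kappa_gt0.
have Tk0 : 0 <= T `^ kappa := powR_ge0 _ _.
have M0 := M_ge0.
apply: (tcfg_bounded N0 gD y0 S0 ST B0 remB (a := a) (b := b)) => //;
  rewrite ?/big_cst; try lra.
- have : hp s t <= T `^ kappa by apply: hp_le => //; rewrite ger0_norm; lra.
  by move=> /le_trans; apply; lra.
- by rewrite ger0_norm; lra.
- by apply: hp_sub; lra.
- by apply: hp_sub; lra.
Qed.

(** Sewing at the exponent 3 kappa. The constant is chosen from N alone, before B and [Q], and [Q]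
    enters linearly. *)
Lemma local_bound (N : R) : 0 <= N -> exists2 C, 0 <= C &
  forall D y (S tau B Q a b : R), good_drive N D -> y 0 = init D 0 -> 0 <= S -> S <= T ->
  0 <= B -> 0 <= tau -> rem_bounded S tau B D y ->
  1 <= Q -> B + N <= Q -> incr_cst N tau B <= Q -> M * incr_cst N tau B <= Q ->
  0 <= a -> a < b -> b <= S -> b - a <= tau -> no_delay_inside a b ->
  small_increment a b (jinc D y a) ->
  forall s t, a <= s -> s <= t -> t <= b ->
    `|jinc D y a s t| <= C * (Q * (hp s t * hp s t * hp s t)) /\
    `|rem D y s t| <= C * (1 + Q * hp s t) * (hp s t * hp s t).
Proof.
move=> N0.
have N'0 : 0 <= big_cst N by rewrite /big_cst !addr_ge0 ?powR_ge0.
have [Cd Cd0 HCd] := defect_vec_bound N'0.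
have [Cg Cg0 HCg] := germ2_vec_bound N'0.
pose K := (1 - 2 `^ (1 - 3 * kappa))^-1.
have K0 : 0 <= K.
  rewrite invr_ge0 subr_ge0 -[leRHS](powRr0 2) ler_powR ?ler1n//.
  by have := kappa3_gt1; lra.
exists (K * Cd + Cg); first by rewrite addr_ge0 ?mulr_ge0.
move=> D y S tau B Q a b gD y0 S0 ST B0 tau0 remB Q1 BNQ GQ MGQ a0 ab bS bat nd oJ.
move=> s t as_ st tb.
have Q0 : 0 <= Q by lra.
have cfgb s' u' t' : a <= s' -> s' <= u' -> u' <= t' -> t' <= b ->
    cfg_bounded (big_cst N) Q (hp s' t') (tcfg D y a s' u' t').
  move=> as' su' ut' tb'.
  by apply: (tcfg_good (b := b) N0 gD y0 S0 ST B0 tau0 remB) => //; lra.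
have T0 := T_gt0.
have dJ s' u' t' : a <= s' -> s' <= u' -> u' <= t' -> t' <= b ->
    `|delta2 (jinc D y a) s' u' t'| <= Cd * Q * (t' - s') `^ (3 * kappa).
  move=> as' su' ut' tb'.
  rewrite (jinc_delta2 y a gD); [|lra|lra|lra].
  apply: le_trans (HCd _ _ _ (cfgb _ _ _ as' su' ut' tb')) _.
  by rewrite -[t' - s']ger0_norm ?hp3 ?mulrA//; lra.
have Jst : `|jinc D y a s t| <= K * Cd * (Q * (hp s t * hp s t * hp s t)).
  apply: le_trans (sewing_bound kappa3_gt1 _ oJ dJ as_ st tb) _.
    exact: mulr_ge0.
  by rewrite -[t - s]ger0_norm ?hp3 -?/K ?mulrA//; lra.
split.
  apply: le_trans Jst _; rewrite ler_wpM2r ?lerDl// !mulr_ge0//.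
rewrite (rem_jinc D y a); apply: le_trans (ler_normD _ _) _.
rewrite [leRHS](_ : _ = (K * Cd + Cg) * (Q * (hp s t * hp s t * hp s t)) +
  (K * Cd + Cg) * (hp s t * hp s t)); last by ring.
rewrite lerD//.
  by apply: le_trans Jst _; rewrite ler_wpM2r ?lerDl// !mulr_ge0.
apply: le_trans (HCg _ _ _ (cfgb s s t as_ (lexx _) st tb)) _.
by rewrite ler_wpM2r ?mulr_ge0// lerDr mulr_ge0.
Qed.

(** Sewing gives order three where order two is asked for: the spare factor is at most tau^kappa,
    and it multiplies Q, hence B. *)
Lemma rem_improve (N : R) : 0 <= N -> exists C g, [/\ 0 <= C, 0 < g &
  forall D y (tau B : R), good_drive N D -> germ_solution D y -> 0 <= B ->
    0 < tau -> tau <= 1 -> tau < g -> rem_bounded T tau B D y ->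
    rem_bounded T tau (C + C * (B * tau `^ kappa)) D y].
Proof.
move=> N0.
have T0 := T_gt0; have M0 := M_ge0.
have [C1 C10 HC1] := local_bound N0.
have [g g0 straddle] := straddle_bound.
pose X : R := d%:R * (M * N); have X0 : 0 <= X by rewrite !mulr_ge0.
(* Chosen so that Q <= C3 (1 + B): the passage from [Q] to a bound affine in B. *)
pose C3 := (1 + N) + (1 + M) * (X + N + 1).
have C30 : 0 <= C3 by rewrite !addr_ge0 ?mulr_ge0 ?addr_ge0.
exists (2 * (C1 * (1 + C3)) + 2 * (X * (X + N + 1))), g; split=> //.
  by nneg.
move=> D y tau B gD [y0 oJ _] B0 tau0 tau1 taug remB.
set e := tau `^ kappa; have e0 : 0 <= e by exact: powR_ge0.
have e1 : e <= 1.
  have := @ge0_ler_powR _ kappa (ltW kappa_gt0) tau 1.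
  by rewrite powR1; apply; rewrite ?nnegrE ?ler01// ltW.
set Gt := incr_cst N tau B.
have GE : Gt = X + N * e + B * e by rewrite /Gt /incr_cst /X /e; ring.
have Be0 : 0 <= B * e by rewrite mulr_ge0.
have Be1 : B * e <= B by rewrite ler_piMr.
have Ne0 : 0 <= N * e by rewrite mulr_ge0.
have Ne1 : N * e <= N by rewrite ler_piMr.
have G0 : 0 <= Gt by rewrite GE; lra.
have MG0 : 0 <= M * Gt by rewrite mulr_ge0.
(* Sum of the four lower bounds that [local_bound] imposes on Q. *)
pose Q := 1 + B + N + (1 + M) * Gt.
have QE : Q = 1 + B + N + Gt + M * Gt by rewrite /Q; ring.
have Q0 : 0 <= Q by rewrite QE; lra.
have QC : Q <= C3 * (1 + B).
  have -> : C3 * (1 + B) = (1 + N) * (1 + B) + (1 + M) * ((X + N + 1) * (1 + B)).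
    by rewrite /C3; ring.
  rewrite /Q lerD//.
    by rewrite [leRHS](_ : _ = 1 + B + N + N * B); [rewrite lerDl; nneg|ring].
  rewrite ler_wpM2l ?GE//; first by nneg.
  rewrite [leRHS](_ : _ = X + N + 1 + B + (X + N) * B); last by ring.
  have : 0 <= (X + N) * B by nneg.
  by lra.
pose A := C1 * (1 + Q * e).
have A0 : 0 <= A by rewrite /A; nneg.
have AC : A <= C1 * (1 + C3) + C1 * C3 * (B * e).
  rewrite /A [leRHS](_ : _ = C1 * (1 + C3 * (1 + B * e))); last by ring.
  rewrite ler_wpM2l// lerD2l; apply: (@le_trans _ _ (C3 * (1 + B) * e)).
    by rewrite ler_wpM2r.
  by rewrite -mulrA ler_wpM2l// mulrDl mul1r lerD2r.
have rk0 : 0 <= r ord_max := delay_ge0 _.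
have inT (v : R) : 0 <= v <= T -> - r ord_max <= v <= T.
  by move=> /andP[v0 ->]; rewrite andbT (le_trans _ v0)// oppr_le0.
have L_le (s u t : R) : 0 <= s <= T -> 0 <= u <= T -> 0 <= t <= T -> `|u - s| <= tau ->
    `|(cf D y u - cf D y s) *m delta1 (path D) u t| <= X * Gt * (hp s u * hp u t).
  move=> sT uT tT us.
  apply: le_trans (norm_mulmx_le _ _) _.
  have -> : X * Gt * (hp s u * hp u t) = d%:R * ((M * Gt * hp s u) * (N * hp u t)).
    by rewrite /X; ring.
  rewrite ler_wpM2l// ler_pM//.
    exact: (cf_incr N0 gD y0 (ltW T_gt0)
      (lexx _) B0 remB).
  by case: gD => xN _ _ _; apply: xN; exact: inT.
have [Q1 Q2 Q3 Q4] : [/\ 1 <= Q, B + N <= Q, Gt <= Q & M * Gt <= Q].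
  by rewrite QE; split; lra.
have nonstraddling (s t : R) : 0 <= s -> s < t -> t <= T -> t - s <= tau -> no_delay_inside s t ->
    `|rem D y s t| <= A * (hp s t * hp s t).
  move=> s0 st tT ts nd.
  have [_ H] := @HC1 D y T tau B Q s t gD y0 (ltW T0) (lexx _) B0 (ltW tau0) remB
    Q1 Q2 Q3 Q4 s0 st tT ts nd (oJ _ _ s0 st tT nd) s t (lexx _) (ltW st) (lexx _).
  apply: le_trans H _; rewrite ler_wpM2r ?mulr_ge0// ler_wpM2l// lerD2l ler_wpM2l//.
  by apply: hp_le => //; rewrite ger0_norm// subr_ge0 ltW.
have final := straddle _ (rem D y)
  (fun s u t => (cf D y u - cf D y s) *m delta1 (path D) u t) T tau A (X * Gt) A0
  (mulr_ge0 X0 G0) taug (rem_chasles D y) (remxx D y) L_le nonstraddling.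
move=> s t sT tT ts; apply: le_trans (final s t sT tT ts) _.
rewrite ler_wpM2r ?mulr_ge0//.
have XG : X * Gt <= X * (X + N + 1) + X * (X + N + 1) * (B * e).
  rewrite -mulrA -mulrDr ler_wpM2l// GE.
  have : 0 <= (X + N) * (B * e) by rewrite mulr_ge0 ?addr_ge0.
  by rewrite mulrDl !mulrDl; lra.
have CBe : 0 <= C1 * (B * e) by rewrite mulr_ge0.
by move: AC XG CBe; rewrite -/e; lra.
Qed.

Lemma apriori (N : R) : 0 <= N -> exists tau B, [/\ 0 < tau, 0 <= B &
  forall D y, good_drive N D -> germ_solution D y -> rem_bounded T tau B D y].
Proof.
move=> N0; have [C [g [C0 g0 H]]] := rem_improve N0.
have T0 := T_gt0; have k0 := kappa_gt0.
(* Below T the uncontrolled bound of the solution applies, below g an interval has at most one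
   delay, and the last term makes C tau^kappa <= 1/2, the contraction required by [absorb]. *)
pose tau := Num.min (Num.min 1 T) (Num.min (g / 2) ((2 * C + 2)^-1 `^ kappa^-1)).
have tau0 : 0 < tau.
  by rewrite !lt_min ltr01 T0 divr_gt0// powR_gt0 ?invr_gt0// ltr_wpDl// mulr_ge0.
have tau1 : tau <= 1 by rewrite !ge_min lexx.
have tauT : tau <= T by rewrite !ge_min lexx orbT.
have taug : tau < g.
  by apply: (@le_lt_trans _ _ (g / 2)); [rewrite !ge_min lexx ?orbT|lra].
have Ce : C * tau `^ kappa <= 2^-1.
  have : tau `^ kappa <= (2 * C + 2)^-1.
    have : tau <= (2 * C + 2)^-1 `^ kappa^-1 by rewrite !ge_min lexx !orbT.
    move=> /(ge0_ler_powR (ltW k0)); rewrite !nnegrE (ltW tau0) powR_ge0 => /(_ isT isT).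
    by rewrite -powRrM mulVf ?gt_eqF// powRr1// invr_ge0; lra.
  move=> /(ler_wpM2l C0) /le_trans; apply.
  by rewrite ler_pdivrMr; lra.
exists tau, (2 * C); split=> //; first by rewrite mulr_ge0.
move=> D y gD sol s t sT tT st.
have := @absorb R (R * R)%type
  (fun p => [/\ 0 <= p.1 <= T, 0 <= p.2 <= T & `|p.2 - p.1| <= tau])
  (fun p => `|rem D y p.1 p.2|) (fun p => hp p.1 p.2 * hp p.1 p.2) C C0 _ _ _ (s, t).
apply=> //=.
- by move=> p _; rewrite mulr_ge0.
- have [_ _ [B B0 HB]] := sol; exists B => // -[a b] /= [aT bT ab].
  by apply: HB => //; exact: le_trans tauT.
move=> B B0 HB [a b] /= [aT bT ab].
have := H D y tau B gD sol B0 tau0 tau1 taug.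
have HB' : rem_bounded T tau B D y by move=> a' b' ? ? ?; exact: (HB (a', b')).
move=> /(_ HB' a b aT bT ab)/le_trans; apply.
rewrite ler_wpM2r ?mulr_ge0// addrC lerD2r mulrCA ler_wpM2l//.
Qed.

(** * Stability *)

Definition drive_close (del : R) D D' : Prop :=
  [/\ forall s t : R, - r ord_max <= s <= T -> - r ord_max <= t <= T ->
        `|delta1 (path D) s t - delta1 (path D') s t| <= del * hp s t,
      forall (i : 'I_k.+1) (s t : R), 0 <= s <= T -> 0 <= t <= T ->
        `|levy D i s t - levy D' i s t| <= del * (hp s t * hp s t),
      forall t : R, - r ord_max <= t <= 0 -> `|init D t - init D' t| <= del &
      forall s t : R, - r ord_max <= s <= 0 -> - r ord_max <= t <= 0 ->
        `|delta1 (init D) s t - delta1 (init D') s t| <= del * (hp s t * hp s t)].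

Definition rem_close (S tau b : R) D y D' y' : Prop :=
  forall s t : R, 0 <= s <= S -> 0 <= t <= S -> `|t - s| <= tau ->
    `|rem D y s t - rem D' y' s t| <= b * (hp s t * hp s t).

Section Pair.
Variables (N B tau0 : R).
Hypotheses (N_ge0 : 0 <= N) (B_ge0 : 0 <= B) (tau0_ge0 : 0 <= tau0) (tau0_le1 : tau0 <= 1).
Local Notation Gc := (incr_cst N tau0 B).
(** In terms of w = E + del and b tau^kappa: c1 governs the increments of y - y', c2 those of the
    extended paths, c3 and c4 those of the coefficients. The scale [tau0] of the a priori bounds is
    fixed, [tau] below it is still to be shrunk. *)
Local Notation c1 := (d%:R * (M + M * N) : R).
Local Notation c2 := (c1 + 1).
Local Notation c3 := (M * ((1 + c2) * Gc + c2)).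
Local Notation c4 := (M * (Gc + 1)).

Variables (D D' : drive) (y y' : R -> 'cV[R]_n).
Hypotheses (gD : good_drive N D) (gD' : good_drive N D').
Hypotheses (y0 : y 0 = init D 0) (y0' : y' 0 = init D' 0).
Hypotheses (remB : rem_bounded T tau0 B D y) (remB' : rem_bounded T tau0 B D' y').
Variables (del E b S tau : R).
Hypotheses (del_ge0 : 0 <= del) (E_ge0 : 0 <= E) (b_ge0 : 0 <= b).
Hypotheses (S_ge0 : 0 <= S) (ST : S <= T) (tau_ge0 : 0 <= tau) (tau_le : tau <= tau0).
Hypothesis DD' : drive_close del D D'.
Hypothesis yE : forall t : R, 0 <= t <= S -> `|y t - y' t| <= E.
Hypothesis remb : rem_close S tau b D y D' y'.
Local Notation w := (E + del).
Local Notation e := (tau `^ kappa).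

Lemma Gc_ge0 : 0 <= Gc.
Proof. by have := N_ge0; have := B_ge0; have := M_ge0 => *; rewrite /incr_cst; nneg. Qed.

Lemma power_le1 : e <= 1.
Proof.
have := @ge0_ler_powR _ kappa (ltW kappa_gt0) tau 1.
by rewrite powR1; apply; rewrite ?nnegrE ?ler01// (le_trans tau_le).
Qed.

Lemma ext_diff (t : R) : - r ord_max <= t <= S -> `|ext D y t - ext D' y' t| <= w.
Proof.
have := E_ge0; have := del_ge0; have := ST => ST' del0 E0 tS.
have [t0|/ltW t0] := leP 0 t.
  rewrite !ext_ge0//; apply: le_trans (yE _) _; lra.
rewrite !ext_le0//; case: DD' => _ _ H _.
apply: le_trans (H _ _) _; lra.
Qed.

Lemma pt_diff (t : R) : 0 <= t <= S -> `|pt D y t - pt D' y' t| <= w.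
Proof.
move=> tS; apply: mx_norm_le => [|q i]; first exact: addr_ge0.
rewrite !mxE; apply: le_trans (ext_diff (delay_shift i tS)).
have := mx_norm_ge_entry (ext D y (t - r i) - ext D' y' (t - r i)) q 0.
by rewrite !mxE.
Qed.

Lemma cf_diff (t : R) : 0 <= t <= S -> `|cf D y t - cf D' y' t| <= M * w.
Proof.
move=> tS; apply: le_trans (sigma_lip _ _) _.
by rewrite ler_wpM2l// pt_diff.
Qed.

(* A B - A' B' = A (B - B') + (A - A') B' *)
Lemma mulmx_diff (m p q : nat) (A A' : 'M[R]_(m, p)) (X X' : 'M[R]_(p, q)) a a' x x' :
  0 <= a -> 0 <= x' -> `|A| <= a -> `|X - X'| <= x' -> `|A - A'| <= a' -> `|X'| <= x ->
  `|A *m X - A' *m X'| <= p%:R * (a * x' + a' * x).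
Proof.
move=> a0 x0 Aa Xx Aa' Xx'.
have -> : A *m X - A' *m X' = A *m (X - X') + (A - A') *m X'.
  by rewrite mulmxBr mulmxBl addrA subrK.
apply: (le_trans (ler_normD _ _)); rewrite mulrDr; apply: lerD.
  by apply: le_trans (norm_mulmx_le _ _) _; rewrite ler_wpM2l// ler_pM.
by apply: le_trans (norm_mulmx_le _ _) _; rewrite ler_wpM2l// ler_pM.
Qed.

Lemma delta1_diff (s t : R) : 0 <= s <= S -> 0 <= t <= S -> `|t - s| <= tau ->
  `|delta1 y s t - delta1 y' s t| <= (c1 * w + b * e) * hp s t.
Proof.
move=> sS tS st.
have [xN _ _ _] := gD; have [xN' _ _ _] := gD'; have [dx _ _ _] := DD'.
have ST' := ST; have T0 := T_gt0; have rk0 : 0 <= r ord_max := delay_ge0 _.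
have -> : delta1 y s t - delta1 y' s t =
    (cf D y s *m delta1 (path D) s t - cf D' y' s *m delta1 (path D') s t) +
    (rem D y s t - rem D' y' s t).
  by rewrite /rem; apply/colP => p; rewrite !mxE; ring.
rewrite mulrDl; apply: (le_trans (ler_normD _ _)); apply: lerD.
  have := @mulmx_diff _ _ _ (cf D y s) (cf D' y' s) (delta1 (path D) s t)
    (delta1 (path D') s t) M (M * w) (N * hp s t) (del * hp s t) M_ge0 _ _ _ _ _.
  move=> /(_ _ _ _ _ _)/le_trans; apply.
  - exact: mulr_ge0.
  - exact: sigma_bound.
  - by apply: dx; lra.
  - exact: cf_diff.
  - by apply: xN'; lra.
  have -> : c1 * w * hp s t = d%:R * (M * (w * hp s t) + M * w * (N * hp s t)) by ring.
  rewrite ler_wpM2l// lerD2r ler_wpM2l// ler_wpM2r//.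
  by rewrite lerDr.
apply: le_trans (remb sS tS st) _.
by rewrite -mulrA ler_wpM2l// ler_wpM2r// hp_le.
Qed.

Lemma c1_ge0 : 0 <= c1.
Proof. by have := N_ge0; have := M_ge0 => *; nneg. Qed.

Lemma ext_incr_diff (s t : R) : - r ord_max <= s <= S -> - r ord_max <= t <= S ->
  `|t - s| <= tau ->
  `|delta1 (ext D y) s t - delta1 (ext D' y') s t| <= (c2 * w + b * e) * hp s t.
Proof.
wlog st : s t / s <= t => [H sS tS tau_st|sS tS tau_st].
  have [st|/ltW ts] := leP s t; first exact: H.
  rewrite hp_sym -normrN; have := H t s ts tS sS; rewrite distrC => /(_ tau_st).
  congr (`|_| <= _); rewrite /delta1; apply/colP => p; rewrite !mxE; ring.
have [_ _ _ dxi] := DD'.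
have ST' := ST; have S0' := S_ge0; have T0 := T_gt0; have rk0 : 0 <= r ord_max := delay_ge0 _.
have w0 : 0 <= w by exact: addr_ge0.
have e0 : 0 <= e by exact: powR_ge0.
have c10 := c1_ge0.
have c1w0 : 0 <= c1 * w + b * e by nneg.
have cE : c2 * w + b * e = (c1 * w + b * e) + w by ring.
have xi_incr (s' t' : R) : - r ord_max <= s' -> s' <= t' -> t' <= 0 -> `|t' - s'| <= tau ->
    `|delta1 (init D) s' t' - delta1 (init D') s' t'| <= w * hp s' t'.
  move=> ? ? ? h; apply: le_trans (dxi _ _ _ _) _; [lra|lra|].
  rewrite mulrA ler_wpM2r//.
  have : hp s' t' <= 1 by apply: le_trans (hp_le h) power_le1.
  move=> /(ler_wpM2l del_ge0); rewrite mulr1 => /le_trans; apply.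
  by rewrite lerDr.
have [s0|s0] := leP 0 s.
  rewrite /delta1 !ext_ge0 ?(le_trans s0)//.
  apply: le_trans (delta1_diff _ _ tau_st) _; [lra|lra|].
  by rewrite ler_wpM2r// cE lerDl.
have [t0|t0] := leP t 0.
  rewrite /delta1 !ext_le0 ?(ltW s0)//.
  apply: le_trans (xi_incr _ _ _ st t0 tau_st) _; first lra.
  by rewrite ler_wpM2r// cE lerDr.
have -> : delta1 (ext D y) s t - delta1 (ext D' y') s t =
   (delta1 (init D) s 0 - delta1 (init D') s 0) + (delta1 y 0 t - delta1 y' 0 t).
  rewrite /delta1 !(ext_ge0 _ _ (ltW t0)) (ext_le0 y0 (ltW s0)) (ext_le0 y0' (ltW s0)).
  rewrite y0 y0'.
  by apply/colP => p; rewrite !mxE; ring.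
have tau_st' : t - s <= tau by rewrite ger0_norm in tau_st => //; lra.
apply: (le_trans (ler_normD _ _)); rewrite cE mulrDl addrC lerD//.
  apply: le_trans (delta1_diff _ _ _) _; [lra|lra|by rewrite ger0_norm; lra|].
  by rewrite ler_wpM2l// hp_sub; lra.
apply: le_trans (xi_incr _ _ _ _ _ _) _ => //; [lra|lra|by rewrite ger0_norm; lra|].
by rewrite ler_wpM2l// hp_sub; lra.
Qed.

Lemma pt_incr_diff (s t : R) : 0 <= s <= S -> 0 <= t <= S -> `|t - s| <= tau ->
  `|(pt D y t - pt D y s) - (pt D' y' t - pt D' y' s)| <= (c2 * w + b * e) * hp s t.
Proof.
have c10 := c1_ge0; have del0 := del_ge0; have E0 := E_ge0; have b0 := b_ge0.
move=> sS tS st; apply: mx_norm_le => [|q i]; first by nneg.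
rewrite !mxE -(hp_shift s t (r i)).
have := ext_incr_diff (delay_shift i sS) (delay_shift i tS).
rewrite opprB addrA subrK => /(_ st); apply: le_trans.
have := mx_norm_ge_entry (delta1 (ext D y) (s - r i) (t - r i) -
  delta1 (ext D' y') (s - r i) (t - r i)) q 0.
by rewrite !mxE.
Qed.

Lemma cf_incr_diff (s t : R) : 0 <= s <= S -> 0 <= t <= S -> `|t - s| <= tau ->
  `|(cf D y t - cf D y s) - (cf D' y' t - cf D' y' s)| <= (c3 * w + c4 * (b * e)) * hp s t.
Proof.
move=> sS tS st.
have c10 := c1_ge0; have del0 := del_ge0; have E0 := E_ge0; have b0 := b_ge0.
have G0 := Gc_ge0; have M0 := M_ge0; have ST' := ST.
have h1 : hp s t <= 1 by apply: le_trans (hp_le st) power_le1.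
apply: mx_norm_le => [|p j]; first by nneg.
have := smooth_four_point (pt D y s) (pt D' y' s) (pt D y t - pt D y s)
  (pt D' y' t - pt D' y' s) (smoothS (sigmaM p j)).
rewrite [pt D y s + _]addrC [pt D' y' s + _]addrC !subrK /cf !mxE => /le_trans; apply.
have g0 : 0 <= c2 * w + b * e by nneg.
have -> : (c3 * w + c4 * (b * e)) * hp s t =
  M * ((w + (c2 * w + b * e)) * (Gc * hp s t) + (c2 * w + b * e) * hp s t) by ring.
rewrite ler_wpM2l//.
have dpt := pt_incr_diff sS tS st.
apply: lerD => //; apply: ler_pM; [by nneg|by []| |].
  apply: lerD; first exact: pt_diff.
  by apply: le_trans dpt _; rewrite ler_piMr.
have T0 := T_gt0.
apply: (pt_incr N_ge0 gD y0 (ltW T_gt0) (lexx _) B_ge0 remB); try lra.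
exact: le_trans tau_le.
Qed.

Lemma c2w_ge0 : 0 <= c2 * w + b * e.
Proof. by have := c1_ge0; have := del_ge0; have := E_ge0; have := b_ge0 => *; nneg. Qed.

Lemma c3w_ge0 : 0 <= c3 * w + c4 * (b * e).
Proof.
have := c1_ge0; have := del_ge0; have := E_ge0; have := b_ge0.
by have := Gc_ge0; have := M_ge0 => *; nneg.
Qed.

Lemma tcfg_close N' q a b' s u t :
  cfg_bounded N' N' (hp s t) (tcfg D y a s u t) ->
  cfg_bounded N' N' (hp s t) (tcfg D' y' a s u t) ->
  w <= q -> M * w <= q -> c2 * w + b * e <= q -> c3 * w + c4 * (b * e) <= q -> b + del <= q ->
  0 <= a -> a < b' -> b' <= S -> no_delay_inside a b' ->
  a <= s -> s <= u -> u <= t -> t <= b' -> u - s <= tau ->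
  cfg_close N' q (hp s t) (tcfg D y a s u t) (tcfg D' y' a s u t).
Proof.
move=> bD bD' wq Mwq c2q c3q bq a0 ab bS nd as_ su ut tb us.
have [dx dl _ dxi] := DD'.
have rk0 : 0 <= r ord_max := delay_ge0 _.
have st : s <= t := le_trans su ut.
have s0 : 0 <= s := le_trans a0 as_.
have u0' : 0 <= u := le_trans s0 su.
have t0 : 0 <= t := le_trans u0' ut.
have tS' : t <= S := le_trans tb bS.
have uS' : u <= S := le_trans ut tS'.
have sS' : s <= S := le_trans su uS'.
have sS : 0 <= s <= S by rewrite s0.
have uS : 0 <= u <= S by rewrite u0'.
have tS : 0 <= t <= S by rewrite t0.
have uT : 0 <= u <= T by rewrite u0' (le_trans uS').
have tT : 0 <= t <= T by rewrite t0 (le_trans tS').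
have sT : 0 <= s <= T by rewrite s0 (le_trans sS').
have inT (v : R) : 0 <= v <= T -> - r ord_max <= v <= T.
  by move=> /andP[v0 ->]; rewrite andbT (le_trans _ v0)// oppr_le0.
have q0 : 0 <= q by apply: le_trans wq; apply: addr_ge0.
have dq : del <= q by apply: le_trans wq; rewrite lerDr.
have usn : `|u - s| <= tau by rewrite ger0_norm// subr_ge0.
have hsu : hp s u <= hp s t by exact: (hp_sub (lexx _) su ut).
have hut : hp u t <= hp s t by exact: (hp_sub su ut (lexx _)).
have ub : u <= b' := le_trans ut tb.
have sb : s <= b' := le_trans su ub.
have au : a <= u := le_trans as_ su.
have lagS (v : R) i : 0 <= v - r i -> 0 <= v <= S -> 0 <= v - r i <= S.
  by move=> -> vS; have /andP[_ ->] := delay_shift i vS.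
have lag0 (v : R) i : v - r i <= 0 -> 0 <= v <= S -> - r ord_max <= v - r i <= 0.
  by move=> -> vS; have /andP[-> _] := delay_shift i vS.
have lagd (v : R) i : 0 <= v <= S -> a <= v -> v <= b' ->
    `|lag D y a v i - lag D' y' a v i| <= q.
  move=> vS av vb; rewrite /lag; have := no_delay_le i nd ab av vb.
  case: ifP => _ v0; last by rewrite subrr normr0.
  apply: le_trans (cf_diff _) Mwq.
  exact: lagS.
split=> //.
  split=> //=.
  - exact: le_trans (pt_diff _) wq.
  - exact: le_trans (pt_diff _) wq.
  - by move=> i; split; apply: lagd.
  - move=> i; apply: le_trans (dx _ _ _ _) _; try exact: delay_shift.
    by rewrite hp_shift ler_pM.
  - apply: le_trans (dx _ _ (inT _ uT) (inT _ tT)) _.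
    by rewrite ler_pM.
split=> /=.
- move=> i; apply: le_trans (dl _ _ _ uT tT) _.
  by rewrite ler_pM ?mulr_ge0 ?ler_pM.
- apply: mx_norm_le => [|l i]; first by nneg.
  have -> : (second_order (tcfg D y a s u t) - second_order (tcfg D' y' a s u t)) l i =
    second_order (tcfg D y a s u t) l i - second_order (tcfg D' y' a s u t) l i.
    by rewrite !mxE.
  rewrite !(second_order_tcfg t l i _ nd ab as_ sb au ub)//.
  apply: (@le_trans _ _ ((b + del) * (hp s u * hp s u))); last first.
    by apply: ler_pM; [exact: addr_ge0|exact: mulr_ge0|by []|exact: ler_pM].
  have := no_delay_le i nd ab as_ sb; have := no_delay_le i nd ab au ub.
  have ushift : u - r i - (s - r i) = u - s by ring.
  case: ifP => _ ui si.
    apply: (@le_trans _ _ (`|rem D y (s - r i) (u - r i) - rem D' y' (s - r i) (u - r i)|)).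
      have := mx_norm_ge_entry
        (rem D y (s - r i) (u - r i) - rem D' y' (s - r i) (u - r i)) l 0.
      by rewrite !mxE.
    apply: le_trans (remb _ _ _) _; rewrite ?ushift//.
    - exact: lagS.
    - exact: lagS.
    by rewrite hp_shift ler_wpM2r ?mulr_ge0// lerDl.
  apply: (@le_trans _ _ (`|delta1 (init D) (s - r i) (u - r i) - delta1 (init D') (s - r i) (u - r i)|)).
    have := mx_norm_ge_entry
      (delta1 (init D) (s - r i) (u - r i) - delta1 (init D') (s - r i) (u - r i)) l 0.
    by rewrite !mxE.
  apply: le_trans (dxi _ _ _ _) _.
  - exact: lag0.
  - exact: lag0.
  by rewrite hp_shift ler_wpM2r ?mulr_ge0// lerDr.
- apply: le_trans (pt_incr_diff sS uS usn) _.
  exact: ler_pM c2w_ge0 (hp_ge0 _ _) c2q hsu.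
move=> i; rewrite /lag.
have := no_delay_le i nd ab as_ sb; have := no_delay_le i nd ab au ub.
have ushift : u - r i - (s - r i) = u - s by ring.
case: ifP => _ ui si; last by rewrite !subrr normr0 mulr_ge0.
apply: le_trans (cf_incr_diff _ _ _) _; rewrite ?ushift//.
- exact: lagS.
- exact: lagS.
rewrite hp_shift; exact: ler_pM c3w_ge0 (hp_ge0 _ _) c3q hsu.
Qed.

End Pair.

Lemma cfg_bounded_le (N N' Q Q' th : R) (c : cfg) :
  N <= N' -> Q <= Q' -> cfg_bounded N Q th c -> cfg_bounded N' Q' th c.
Proof.
move=> NN QQ [/andP[th0 thN] Q1 HZ HX [H1 H2 H3 H4]].
have Nth : N * th <= N' * th by rewrite ler_wpM2r.
have Nth2 : N * (th * th) <= N' * (th * th) by rewrite ler_wpM2r ?mulr_ge0.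
have Qth : Q * th <= Q' * th by rewrite ler_wpM2r.
have Qth2 : Q * (th * th) <= Q' * (th * th) by rewrite ler_wpM2r ?mulr_ge0.
split.
- by rewrite th0 (le_trans thN).
- exact: le_trans QQ.
- by move=> i; have [a b] := HZ i; split; apply: le_trans NN.
- by move=> i; have [a b] := HX i; split; [exact: le_trans Nth|exact: le_trans Nth2].
split; [exact: le_trans Nth|exact: le_trans Qth2|exact: le_trans Qth|].
by move=> i; exact: le_trans (H4 i) Qth.
Qed.

Lemma defect_vec_close (N : R) : exists2 C, 0 <= C &
  forall (q th : R) (c c' : cfg), cfg_close N q th c c' ->
    `|(\col_p defect sigma c p : 'cV[R]_n) - \col_p defect sigma c' p| <= C * (q * (th * th * th)).
Proof.
have : dominated (fun i : cfg * cfg * R * R => cfg_close N i.1.2 i.2 i.1.1.1 i.1.1.2)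
  (fun i => (\col_p defect sigma i.1.1.1 p : 'cV[R]_n) - \col_p defect sigma i.1.1.2 p)
  (fun i => i.1.2 * (i.2 * i.2 * i.2)).
  apply: dominated_mx => [i [/cfg_bounded_ge0[th0 _ _] _ q0 _ _]|p q]; first by nneg.
  by apply: (dominated_eq (dom2_defect sigmaM N p)) => i _; rewrite !mxE.
by move=> [C C0 H]; exists C => // q th c c'; exact: (H (c, c', q, th)).
Qed.

Lemma germ2_vec_close (N : R) : exists2 C, 0 <= C &
  forall (q th : R) (c c' : cfg), cfg_close N q th c c' ->
    `|(\col_p germ2 sigma (Ys c) (Zs c) (W2 c) p : 'cV[R]_n) -
      \col_p germ2 sigma (Ys c') (Zs c') (W2 c') p| <= C * (q * (th * th)).
Proof.
have : dominated (fun i : cfg * cfg * R * R => cfg_close N i.1.2 i.2 i.1.1.1 i.1.1.2)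
  (fun i => (\col_p germ2 sigma (Ys i.1.1.1) (Zs i.1.1.1) (W2 i.1.1.1) p : 'cV[R]_n) -
    \col_p germ2 sigma (Ys i.1.1.2) (Zs i.1.1.2) (W2 i.1.1.2) p)
  (fun i => i.1.2 * (i.2 * i.2)).
  apply: dominated_mx => [i [/cfg_bounded_ge0[th0 _ _] _ q0 _ _]|p q]; first by nneg.
  by apply: (dominated_eq (dom2_germ2 sigmaM N p)) => i _; rewrite !mxE.
by move=> [C C0 H]; exists C => // q th c c'; exact: (H (c, c', q, th)).
Qed.

Section FixedScale.
Variables (N B tau0 : R).
Hypotheses (N_ge0 : 0 <= N) (B_ge0 : 0 <= B) (tau0_ge0 : 0 <= tau0) (tau0_le1 : tau0 <= 1).
Local Notation Gc := (incr_cst N tau0 B).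
Local Notation c1 := (d%:R * (M + M * N) : R).
Local Notation c2 := (c1 + 1).
Local Notation c3 := (M * ((1 + c2) * Gc + c2)).
Local Notation c4 := (M * (Gc + 1)).

(** Sewing applied to the difference of the two increments minus germs. The unknown b must appear
    with tau^kappa, so the part of order three and the area part are bounded through different
    comparisons. *)
Lemma rem_close_local : exists2 C, 0 <= C &
  forall D D' y y' (del E b S tau s t : R), good_drive N D -> good_drive N D' ->
    germ_solution D y -> germ_solution D' y' ->
    rem_bounded T tau0 B D y -> rem_bounded T tau0 B D' y' ->
    0 <= del -> 0 <= E -> 0 <= b -> 0 <= S -> S <= T -> 0 <= tau -> tau <= tau0 ->
    drive_close del D D' -> (forall t : R, 0 <= t <= S -> `|y t - y' t| <= E) ->
    rem_close S tau b D y D' y' ->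
    0 <= s -> s < t -> t <= S -> t - s <= tau -> no_delay_inside s t ->
    `|rem D y s t - rem D' y' s t| <= C * (E + del + b * tau `^ kappa) * (hp s t * hp s t).
Proof.
have N0 := N_ge0; have B0 := B_ge0; have M0 := M_ge0; have t00 := tau0_ge0; have T0 := T_gt0.
have G0 : 0 <= Gc by exact: Gc_ge0.
pose Q := 1 + B + N + (1 + M) * Gc.
have MG0 : 0 <= M * Gc by nneg.
have QE : Q = 1 + B + N + Gc + M * Gc by rewrite /Q; ring.
pose N' := big_cst N + Q.
have [Cd Cd0 HCd] := defect_vec_close N'.
have [Cg Cg0 HCg] := germ2_vec_close N'.
pose K := (1 - 2 `^ (1 - 3 * kappa))^-1.
have K0 : 0 <= K.
  rewrite invr_ge0 subr_ge0 -[leRHS](powRr0 2) ler_powR ?ler1n//.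
  by have := kappa3_gt1; lra.
have [k1 [k1E k10]] : exists k1, k1 = c1 /\ 0 <= k1 by exists c1; split=> //; nneg.
have [k3 [k3E k30]] : exists k3, k3 = c3 /\ 0 <= k3 by exists c3; split=> //; nneg.
have [k4 [k4E k40]] : exists k4, k4 = c4 /\ 0 <= k4 by exists c4; split=> //; nneg.
pose c5 := 1 + M + (k1 + 1) + k3 + k4.
have c50 : 0 <= c5 by rewrite /c5; nneg.
have facts (v z z' : R) : 0 <= v -> 0 <= z -> z <= z' ->
    [/\ v <= c5 * (v + z'), M * v <= c5 * (v + z'), (k1 + 1) * v + z <= c5 * (v + z'),
        k3 * v + k4 * z <= c5 * (v + z') & z' + v <= c5 * (v + z')].
  exact: affine_bounds.
have [Q1 Q2 Q3 Q4] : [/\ 1 <= Q, B + N <= Q, Gc <= Q & M * Gc <= Q].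
  by rewrite QE; split; lra.
have NN' : big_cst N <= N' by rewrite /N' lerDl (le_trans _ Q1).
have QN' : Q <= N'.
  by rewrite /N' lerDr /big_cst; nneg.
exists (c5 * (Cg + K * Cd)); first by nneg.
move=> D D' y y' del E b S tau s t gD gD' [y0 oJ _] [y0' oJ' _] remB remB' del0 E0 b0 S0 ST.
move=> tau_0 tau_1 DD' yE remb s0 st tS ts nd.
have [w [wE w0]] : exists w, w = E + del /\ 0 <= w by exists (E + del); split=> //; nneg.
have delw : del <= w by rewrite wE lerDr.
have e0 : 0 <= tau `^ kappa by exact: powR_ge0.
have e1 : tau `^ kappa <= 1 by exact: (power_le1 tau0_le1 tau_0 tau_1).
have tT : t <= T by exact: le_trans ST.
have ts0 : t - s <= tau0 by exact: le_trans tau_1.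
have sub (s' u' t' : R) : s <= s' -> u' <= t' -> t' <= t -> u' - s' <= t - s.
  by move=> ss' ut tt; apply: lerB => //; exact: le_trans tt.
have inT (v : R) : s <= v -> v <= t -> 0 <= v <= T.
  by move=> sv vt; rewrite (le_trans s0)// (le_trans vt).
have bounded D0 y1 (s' u' t' : R) : good_drive N D0 -> y1 0 = init D0 0 ->
    rem_bounded T tau0 B D0 y1 -> s <= s' -> s' <= u' -> u' <= t' -> t' <= t ->
    cfg_bounded N' N' (hp s' t') (tcfg D0 y1 s s' u' t').
  move=> gD0 y10 remB0 ss' su ut tt.
  apply: (cfg_bounded_le NN' QN').
  apply: (tcfg_good (b := t) N_ge0 gD0 y10 (ltW T0) (lexx _) B0
    t00 remB0) => //.
  exact: le_trans (sub _ _ _ ss' ut tt) ts0.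
have close (s' u' t' : R) : s <= s' -> s' <= u' -> u' <= t' -> t' <= t ->
    cfg_close N' (c5 * (w + b)) (hp s' t') (tcfg D y s s' u' t') (tcfg D' y' s s' u' t').
  move=> ss' su ut tt.
  have be : b * tau `^ kappa <= b by rewrite ler_piMr.
  have [f1 f2 f3 f4 f5] := facts w _ b w0 (mulr_ge0 b0 e0) be.
  apply: (tcfg_close N_ge0 B_ge0 tau0_le1 gD gD' y0 y0' remB
    del0 E0 b0 S0 ST tau_0 tau_1 DD' yE remb (b' := t) (bounded D y _ _ _ gD y0 remB ss' su ut tt)
    (bounded D' y' _ _ _ gD' y0' remB' ss' su ut tt)) => //;
    rewrite -?k3E -?k4E -?k1E -?wE//.
    by apply: le_trans f5; rewrite lerD2l.
  exact: le_trans (sub _ _ _ ss' ut tt) ts.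
(* At u = s the comparison may be made at scale 0 with b = 0, so the area part, which has no spare
   factor, is bounded by w alone. *)
have close0 : cfg_close N' (c5 * (w + 0)) (hp s t) (tcfg D y s s s t) (tcfg D' y' s s s t).
  have rem0 : rem_close S 0 0 D y D' y'.
    move=> s' t' _ _; rewrite normr_le0 subr_eq0 => /eqP ->.
    by rewrite !remxx subrr normr0 mul0r.
  have [f1 f2 f3 f4 f5] := facts w 0 0 w0 (lexx 0) (lexx 0).
  apply: (tcfg_close N_ge0 B_ge0 tau0_le1 gD gD' y0 y0' remB
    del0 E0 (lexx _) S0 ST (lexx _) t00 DD' yE rem0 (b' := t)
    (bounded D y _ _ _ gD y0 remB (lexx _) (lexx _) (ltW st) (lexx _))
    (bounded D' y' _ _ _ gD' y0' remB' (lexx _) (lexx _) (ltW st) (lexx _))) => //;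
    rewrite -?k3E -?k4E -?k1E -?wE ?mul0r//.
    by apply: le_trans f5; rewrite lerD2l.
    exact: ltW.
  by rewrite subrr.
have sdJ := small_incrementB (oJ _ _ s0 st tT nd) (oJ' _ _ s0 st tT nd).
have dJ (s' u' t' : R) : s <= s' -> s' <= u' -> u' <= t' -> t' <= t ->
    `|delta2 (fun p q => jinc D y s p q - jinc D' y' s p q) s' u' t'| <=
      Cd * (c5 * (w + b)) * (t' - s') `^ (3 * kappa).
  move=> ss' su ut tt.
  have s'u := le_trans ss' su; have s't := le_trans s'u ut.
  have ut' := le_trans ut tt; have st' := le_trans su ut'.
  have -> : delta2 (fun p q => jinc D y s p q - jinc D' y' s p q) s' u' t' =
      delta2 (jinc D y s) s' u' t' - delta2 (jinc D' y' s) s' u' t'.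
    by rewrite /delta2; apply/colP => p; rewrite !mxE; ring.
  rewrite (jinc_delta2 y s gD); [|exact: inT|exact: inT|exact: inT].
  rewrite (jinc_delta2 y' s gD'); [|exact: inT|exact: inT|exact: inT].
  apply: le_trans (HCd _ _ _ _ (close _ _ _ ss' su ut tt)) _.
  by rewrite -[t' - s']ger0_norm ?hp3 ?mulrA// subr_ge0 (le_trans su).
have cw0 : 0 <= c5 * (w + b) by nneg.
have := sewing_bound kappa3_gt1 (mulr_ge0 Cd0 cw0) sdJ dJ (lexx _) (ltW st) (lexx _).
rewrite -/K -[t - s]ger0_norm ?hp3; last by rewrite subr_ge0 ltW.
move=> Jst.
rewrite (rem_jinc D y s) (rem_jinc D' y' s).
set g1 := \col_p _; set g2 := \col_p _.
have -> : jinc D y s s t + g1 - (jinc D' y' s s t + g2) =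
   (jinc D y s s t - jinc D' y' s s t) + (g1 - g2).
  by apply/colP => p; rewrite !mxE; ring.
have hst : hp s t <= tau `^ kappa by apply: hp_le => //; rewrite ger0_norm// subr_ge0 ltW.
rewrite -wE; apply: (le_trans (ler_normD _ _)).
rewrite [leRHS](_ : _ = c5 * (K * Cd) * (w + b * tau `^ kappa) * (hp s t * hp s t) +
  Cg * (c5 * (w + b * tau `^ kappa) * (hp s t * hp s t))); last by ring.
apply: lerD.
  apply: le_trans Jst _.
  rewrite [leLHS](_ : _ = c5 * (K * Cd) * ((w + b) * hp s t) * (hp s t * hp s t)); last by ring.
  rewrite ler_wpM2r ?mulr_ge0// ler_wpM2l//; first by nneg.
  rewrite mulrDl; apply: lerD; last by rewrite ler_wpM2l.
  by rewrite ler_piMr// (le_trans hst).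
apply: le_trans (HCg _ _ _ _ close0) _.
rewrite addr0 ler_wpM2l// ler_wpM2r ?mulr_ge0// ler_wpM2l// lerDl; nneg.
Qed.

End FixedScale.

(** Analogue of [rem_improve] for a pair. The correction at a delay is now a difference of products,
    in which b also carries a factor tau^kappa, through [cf_incr_diff]. *)
Lemma rem_close_improve : exists2 g, 0 < g & forall N B tau0 : R,
  0 <= N -> 0 <= B -> 0 <= tau0 -> tau0 <= 1 -> tau0 < g -> exists2 C, 0 <= C &
  forall D D' y y' (del E b S tau : R), good_drive N D -> good_drive N D' ->
    germ_solution D y -> germ_solution D' y' ->
    rem_bounded T tau0 B D y -> rem_bounded T tau0 B D' y' ->
    0 <= del -> 0 <= E -> 0 <= b -> 0 <= S -> S <= T -> 0 <= tau -> tau <= tau0 ->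
    drive_close del D D' -> (forall t : R, 0 <= t <= S -> `|y t - y' t| <= E) ->
    rem_close S tau b D y D' y' ->
    rem_close S tau (C * (E + del + b * tau `^ kappa)) D y D' y'.
Proof.
have [g g0 straddle] := straddle_bound; exists g => //.
move=> N B tau0 N0 B0 tau00 tau01 tau0g.
have [C1 C10 HC1] := rem_close_local N0 B0 tau00 tau01.
have M0 := M_ge0.
pose Gc := incr_cst N tau0 B.
have G0 : 0 <= Gc by exact: Gc_ge0.
pose c1 : R := d%:R * (M + M * N).
pose c3 := M * ((1 + (c1 + 1)) * Gc + (c1 + 1)).
pose c4 := M * (Gc + 1).
have c30 : 0 <= c3 by rewrite /c3 /c1; nneg.
have c40 : 0 <= c4 by rewrite /c4; nneg.
pose C2 := d%:R * (M * Gc + (c3 + c4) * N).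
have C20 : 0 <= C2 by rewrite /C2; nneg.
exists (2 * C1 + 2 * C2); first by nneg.
move=> D D' y y' del E b S tau gD gD' sol sol' remB remB' del0 E0 b0 S0 ST tau_0 tau_1 DD' yE remb.
pose v := E + del + b * tau `^ kappa.
have v0 : 0 <= v by rewrite /v; nneg.
have -> : (2 * C1 + 2 * C2) * (E + del + b * tau `^ kappa) = 2 * (C1 * v) + 2 * (C2 * v).
  by rewrite /v; ring.
have rk0 : 0 <= r ord_max := delay_ge0 _.
have inT (u : R) : 0 <= u <= S -> - r ord_max <= u <= T.
  by move=> /andP[u0 uS]; rewrite (le_trans uS)// andbT (le_trans _ u0)// oppr_le0.
have [y0 _ _] := sol; have [y0' _ _] := sol'.
have inT0 (u : R) : 0 <= u <= S -> 0 <= u <= T by move=> /andP[-> uS]; rewrite (le_trans uS).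
apply: (straddle _ (fun s t => rem D y s t - rem D' y' s t)
  (fun s u t => (cf D y u - cf D y s) *m delta1 (path D) u t -
                (cf D' y' u - cf D' y' s) *m delta1 (path D') u t)).
- exact: mulr_ge0.
- exact: mulr_ge0.
- exact: le_lt_trans tau0g.
- move=> s u t; rewrite (rem_chasles D y s u t) (rem_chasles D' y' s u t).
  by apply/colP => p; rewrite !mxE; ring.
- by move=> s; rewrite !remxx subrr.
- move=> s u t sS uS tS us.
  have [xN _ _ _] := gD'; have [dx _ _ _] := DD'.
  have := @mulmx_diff _ _ _ (cf D y u - cf D y s) (cf D' y' u - cf D' y' s)
    (delta1 (path D) u t) (delta1 (path D') u t) (M * Gc * hp s u)
    ((c3 * (E + del) + c4 * (b * tau `^ kappa)) * hp s u) (N * hp u t) (del * hp u t).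
  move=> /(_ _ _ _ _ _ _)/le_trans; apply.
  - by nneg.
  - by nneg.
  - apply: (cf_incr N0 gD y0 (ltW T_gt0) (lexx _) B0 remB).
    + exact: inT0.
    + exact: inT0.
    + exact: le_trans us tau_1.
  - by apply: dx; exact: inT.
  - exact: (cf_incr_diff N0 B0 tau01 gD gD' y0 y0' remB
      del0 E0 b0 S0 ST tau_0 tau_1 DD' yE remb).
  - by apply: xN; exact: inT.
  rewrite [leLHS](_ : _ = d%:R * (M * Gc * del + (c3 * (E + del) + c4 * (b * tau `^ kappa)) * N)
    * (hp s u * hp u t)); last by ring.
  rewrite ler_wpM2r ?mulr_ge0// -[leRHS]mulrA ler_wpM2l// [leRHS]mulrDl; apply: lerD.
    by rewrite ler_wpM2l ?mulr_ge0// /v addrAC lerDr; nneg.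
  rewrite [leRHS](_ : _ = (c3 * v + c4 * v) * N); last by ring.
  rewrite ler_wpM2r//; apply: lerD; apply: ler_wpM2l => //; rewrite /v.
    by rewrite lerDl; nneg.
  by rewrite lerDr; nneg.
- move=> s t s0 st tS ts nd.
  exact: (HC1 D D' y y' del E b S tau s t).
Qed.

(** Absorbs b, starting from twice the a priori bound. The sup distance E is still unknown here;
    [stability] eliminates it. *)
Lemma rem_close_controlled (N : R) : 0 <= N -> exists tau C, [/\ 0 < tau, tau <= T, 0 <= C &
  forall D D' y y' (del E S : R), good_drive N D -> good_drive N D' ->
    germ_solution D y -> germ_solution D' y' -> 0 <= del -> 0 <= E -> 0 <= S -> S <= T ->
    drive_close del D D' -> (forall t : R, 0 <= t <= S -> `|y t - y' t| <= E) ->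
    forall s t : R, 0 <= s <= S -> 0 <= t <= S -> `|t - s| <= tau ->
      `|delta1 y s t - delta1 y' s t| <= C * (E + del) * hp s t].
Proof.
move=> N0; have [g g0 Himp] := rem_close_improve.
have [tau1 [B [tau10 B0 apr]]] := apriori N0.
have T0 := T_gt0; have k0 := kappa_gt0; have M0 := M_ge0.
pose tau0 := Num.min (Num.min 1 T) (Num.min (g / 2) tau1).
have tau00 : 0 < tau0 by rewrite !lt_min ltr01 T0 divr_gt0.
have tau01 : tau0 <= 1 by rewrite !ge_min lexx.
have tau0T : tau0 <= T by rewrite !ge_min lexx orbT.
have tau0tau1 : tau0 <= tau1 by rewrite !ge_min lexx !orbT.
have tau0g : tau0 < g.
  by apply: (@le_lt_trans _ _ (g / 2)); [rewrite !ge_min lexx ?orbT|lra].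
have [C C0 H] := Himp N B tau0 N0 B0 (ltW tau00) tau01 tau0g.
pose tau := Num.min tau0 ((2 * C + 2)^-1 `^ kappa^-1).
have tau_0 : 0 < tau by rewrite lt_min tau00 powR_gt0// invr_gt0; lra.
have tau_tau0 : tau <= tau0 by rewrite ge_min lexx.
have Ce : C * tau `^ kappa <= 2^-1.
  have : tau `^ kappa <= (2 * C + 2)^-1.
    have : tau <= (2 * C + 2)^-1 `^ kappa^-1 by rewrite ge_min lexx !orbT.
    move=> /(ge0_ler_powR (ltW k0)); rewrite !nnegrE (ltW tau_0) powR_ge0 => /(_ isT isT).
    by rewrite -powRrM mulVf ?gt_eqF// powRr1// invr_ge0; lra.
  move=> /(ler_wpM2l C0) /le_trans; apply.
  by rewrite ler_pdivrMr; lra.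
have e1 : tau `^ kappa <= 1 := power_le1 tau01 (ltW tau_0) tau_tau0.
have e0 : 0 <= tau `^ kappa := powR_ge0 _ _.
pose c1 : R := d%:R * (M + M * N).
exists tau, (c1 + 2 * C); split=> //; [exact: le_trans tau0T|by rewrite /c1; nneg|].
move=> D D' y y' del E S gD gD' sol sol' del0 E0 S0 ST DD' yE.
have SS s : 0 <= s <= S -> 0 <= s <= T by move=> /andP[-> sS]; rewrite (le_trans sS).
have remB : rem_bounded T tau0 B D y.
  by move=> s t sT tT st; apply: apr => //; exact: le_trans tau0tau1.
have remB' : rem_bounded T tau0 B D' y'.
  by move=> s t sT tT st; apply: apr => //; exact: le_trans tau0tau1.
have rc : rem_close S tau (2 * (C * (E + del))) D y D' y'.
  move=> s t sS tS st.
  have := @absorb R (R * R)%type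
    (fun p => [/\ 0 <= p.1 <= S, 0 <= p.2 <= S & `|p.2 - p.1| <= tau])
    (fun p => `|rem D y p.1 p.2 - rem D' y' p.1 p.2|) (fun p => hp p.1 p.2 * hp p.1 p.2)
    (C * (E + del)) _ _ _ _ (s, t).
  apply=> //=; first by nneg.
  - by move=> p _; rewrite mulr_ge0.
  - exists (B + B); first exact: addr_ge0.
    move=> -[a b] /= [aS bS ab]; rewrite mulrDl; apply: le_trans (ler_normB _ _) _.
    have ab0 : `|b - a| <= tau0 by exact: le_trans tau_tau0.
    by apply: lerD; [exact: remB (SS _ aS) (SS _ bS) ab0|exact: remB' (SS _ aS) (SS _ bS) ab0].
  move=> b b0 Hb [a a'] /= [aS bS ab].
  have Hb' : rem_close S tau b D y D' y' by move=> p q ? ? ?; exact: (Hb (p, q)).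
  have := H D D' y y' del E b S tau gD gD' sol sol' remB remB' del0 E0 b0 S0 ST (ltW tau_0) tau_tau0
    DD' yE Hb' a a' aS bS ab.
  move=> /le_trans; apply; rewrite ler_wpM2r ?mulr_ge0// mulrDr addrC lerD2r mulrCA.
  by rewrite ler_wpM2l.
have [y0 _ _] := sol; have [y0' _ _] := sol'.
move=> s t sS tS st.
have b0 : 0 <= 2 * (C * (E + del)) by nneg.
have := delta1_diff gD gD' y0 y0' del0 E0 b0 ST DD' yE rc
  sS tS st.
move=> /le_trans; apply; rewrite ler_wpM2r//.
rewrite -/c1 [leRHS]mulrDl lerD2l -[in leRHS]mulrA.
by rewrite ler_piMr.
Qed.

(** Over a time step of length h the distance of the solutions grows by at most (E + del) / 2, where
    E is the sup distance up to the end of that step; so E absorbs itself, and a number of steps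
    depending on T and h only reaches T. *)
Lemma stability (N : R) : 0 <= N -> exists2 K, 0 <= K &
  forall D D' y y' (del : R), good_drive N D -> good_drive N D' ->
    germ_solution D y -> germ_solution D' y' -> 0 <= del -> drive_close del D D' ->
    (forall t : R, 0 <= t <= T -> `|y t - y' t| <= K * del) /\
    (forall s t : R, 0 <= s <= T -> 0 <= t <= T ->
      `|delta1 y s t - delta1 y' s t| <= K * del * hp s t).
Proof.
move=> N0; have [tau [C [tau0 tauT C0 H]]] := rem_close_controlled N0.
have T0 := T_gt0; have k0 := kappa_gt0.
pose h := Num.min tau ((2 * C + 2)^-1 `^ kappa^-1).
have h0 : 0 < h by rewrite lt_min tau0 powR_gt0// invr_gt0; lra.
have htau : h <= tau by rewrite ge_min lexx.
have Ce : C * h `^ kappa <= 2^-1.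
  have : h `^ kappa <= (2 * C + 2)^-1.
    have : h <= (2 * C + 2)^-1 `^ kappa^-1 by rewrite ge_min lexx !orbT.
    move=> /(ge0_ler_powR (ltW k0)); rewrite !nnegrE (ltW h0) powR_ge0 => /(_ isT isT).
    by rewrite -powRrM mulVf ?gt_eqF// powRr1// invr_ge0; lra.
  move=> /(ler_wpM2l C0) /le_trans; apply.
  by rewrite ler_pdivrMr; lra.
have step m : exists2 Cm, 0 <= Cm &
  forall D D' y y' (del : R), good_drive N D -> good_drive N D' ->
    germ_solution D y -> germ_solution D' y' -> 0 <= del -> drive_close del D D' ->
    forall t : R, 0 <= t <= T -> t <= m%:R * h -> `|y t - y' t| <= Cm * del.
  elim: m => [|m [Cm Cm0 IH]].
    exists 1 => // D D' y y' del gD gD' [y0 _ _] [y0' _ _] del0 [_ _ dxi _] t.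
    move=> /andP[t0 _]; rewrite mul0r => t0'.
    have -> : t = 0 by apply/eqP; rewrite eq_le t0 t0'.
    rewrite y0 y0' mul1r; apply: dxi; rewrite lexx oppr_le0 delay_ge0//.
  exists (2 * (Cm + 1)); first by nneg.
  move=> D D' y y' del gD gD' sol sol' del0 DD' t tT tm.
  pose S := Num.min T (m.+1%:R * h).
  have S0 : 0 <= S by rewrite le_min (ltW T0) mulr_ge0// ltW.
  have ST : S <= T by rewrite ge_min lexx.
  have := @absorb R R (fun t => 0 <= t <= S) (fun t => `|y t - y' t|) (fun=> 1)
    ((Cm + 1) * del) _ _ _ _ t.
  rewrite mulr1 mulrA; apply.
  - by nneg.
  - by [].
  (* A crude bound on both paths, from their own remainders, to start the absorption. *)
  - have [_ _ [B B0 HB]] := sol; have [_ _ [B' B'0 HB']] := sol'.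
    have [y0 _ _] := sol; have [y0' _ _] := sol'.
    pose K1 := C * (0 + del) + 0.
    have [M1 HM1] : exists M1, forall t : R, 0 <= t <= T -> `|y t| <= M1 /\ `|y' t| <= M1.
      pose b (B1 : R) := `|init D 0| + `|init D' 0| + d%:R * (M * (N * T `^ kappa)) +
        B1 * (T `^ kappa * T `^ kappa).
      have bnd D1 y1 (B1 : R) : good_drive N D1 -> y1 0 = init D1 0 -> 0 <= B1 ->
          rem_bounded T T B1 D1 y1 -> forall t : R, 0 <= t <= T ->
          `|y1 t| <= `|init D1 0| + (d%:R * (M * (N * T `^ kappa)) + B1 * (T `^ kappa * T `^ kappa)).
        move=> [xN _ _ _] y10 B10 HB1 u uT.
        have uh : hp 0 u <= T `^ kappa.
          by apply: hp_le => //; case/andP: uT => u0 uT; rewrite subr0 ger0_norm.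
        have rk0 : 0 <= r ord_max := delay_ge0 _.
        have -> : y1 u = init D1 0 + (cf D1 y1 0 *m delta1 (path D1) 0 u + rem D1 y1 0 u).
          by rewrite -y10 /rem /delta1; apply/colP => p; rewrite !mxE; ring.
        apply: le_trans (ler_normD _ _) _; rewrite lerD2l; apply: le_trans (ler_normD _ _) _.
        apply: lerD.
          apply: le_trans (norm_mulmx_le _ _) _; rewrite ler_wpM2l// ler_pM//.
            exact: sigma_bound.
          apply: le_trans (xN _ _ _ _) _; [by rewrite oppr_le0 rk0 ltW| |by rewrite ler_wpM2l].
          by case/andP: uT => u0 ->; rewrite andbT (le_trans _ u0)// oppr_le0.
        apply: le_trans (HB1 _ _ _ uT _) _; first by rewrite lexx ltW.
          by case/andP: uT => u0 uT; rewrite subr0 ger0_norm.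
        by rewrite ler_wpM2l// ler_pM.
      have b1 := bnd D y B gD y0 B0 HB; have b2 := bnd D' y' B' gD' y0' B'0 HB'.
      exists (Num.max (`|init D 0| + (d%:R * (M * (N * T `^ kappa)) + B * (T `^ kappa * T `^ kappa)))
               (`|init D' 0| + (d%:R * (M * (N * T `^ kappa)) + B' * (T `^ kappa * T `^ kappa)))).
      by move=> u uT; rewrite !le_max b1 ?b2 ?orbT.
    have M10 : 0 <= M1 by have [+ _] := HM1 t tT; apply: le_trans.
    exists (M1 + M1); first exact: addr_ge0.
    move=> u /andP[u0 uS]; rewrite mulr1; apply: le_trans (ler_normB _ _) _.
    by have [|a b] := HM1 u; [rewrite u0 (le_trans uS)|exact: lerD].
  - move=> E E0 HE u /andP[u0 uS]; rewrite mulr1.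
    have HE' (v : R) : 0 <= v <= S -> `|y v - y' v| <= E by move=> /HE; rewrite mulr1.
    have uT : u <= T by exact: le_trans ST.
    have [um|um] := leP u (m%:R * h).
      have u0T : 0 <= u <= T by rewrite u0.
      apply: le_trans (IH D D' y y' del gD gD' sol sol' del0 DD' u u0T um) _.
      by rewrite mulrDl mul1r -[leLHS]add0r lerD ?lerDl// divr_ge0.
    have mh0 : 0 <= m%:R * h by rewrite mulr_ge0// ltW.
    have mhT : 0 <= m%:R * h <= T by rewrite mh0 (le_trans (ltW um)).
    have umh : `|u - m%:R * h| <= h.
      rewrite ger0_norm; last by rewrite subr_ge0 ltW.
      rewrite lerBlDl.
      by move: uS; rewrite le_min => /andP[_]; rewrite -addn1 natrD mulrDl mul1r.
    have -> : y u - y' u = (y (m%:R * h) - y' (m%:R * h)) +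
        (delta1 y (m%:R * h) u - delta1 y' (m%:R * h) u).
      by rewrite /delta1; apply/colP => p; rewrite !mxE; ring.
    apply: le_trans (ler_normD _ _) _.
    have := IH D D' y y' del gD gD' sol sol' del0 DD' _ mhT (lexx _).
    have mhS : 0 <= m%:R * h <= S by rewrite mh0 (le_trans (ltW um)).
    have u0S : 0 <= u <= S by rewrite u0.
    have := H D D' y y' del E S gD gD' sol sol' del0 E0 S0 ST DD' HE' _ _ mhS u0S (le_trans umh htau).
    have : C * (E + del) * hp (m%:R * h) u <= (E + del) / 2.
      rewrite mulrAC [leRHS]mulrC ler_wpM2r ?addr_ge0// (le_trans _ Ce)// ler_wpM2l//.
      exact: hp_le.
    move=> h1 /le_trans /(_ h1) h2 h3.
    apply: le_trans (lerD h3 h2) _; rewrite !mulrDl mul1r.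
    have : del / 2 <= del by rewrite ler_pdivrMr// mulr_natr mulr2n lerDl.
    lra.
  case/andP: tT => t0 tT; rewrite t0 le_min tT; exact: tm.
have [m Tm] : exists m : nat, T <= m%:R * h.
  exists (Num.bound (T / h)); rewrite -ler_pdivrMr//.
  by have := archi_boundP (divr_ge0 (ltW T0) (ltW h0)) => /ltW.
have [K K0 HK] := step m.
have th0 : 0 < tau `^ kappa by exact: powR_gt0.
(* K for the sup distance, C (K + 1) for increments with |t - s| <= tau; for longer ones the sup
   distance is used twice and divided by tau^kappa. *)
exists (K + (C * (K + 1)) + 2 * K / tau `^ kappa); first by nneg; rewrite invr_ge0 ltW.
move=> D D' y y' del gD gD' sol sol' del0 DD'.
have HK' (t : R) : 0 <= t <= T -> `|y t - y' t| <= K * del.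
  by move=> tT; apply: (HK D D') => //; case/andP: tT => _ /le_trans; apply.
have A1 : 0 <= C * (K + 1) * del by nneg.
have A2 : 0 <= 2 * K / tau `^ kappa * del by nneg; rewrite invr_ge0 ltW.
have A0 : 0 <= K * del by nneg.
have KE : (K + C * (K + 1) + 2 * K / tau `^ kappa) * del =
    K * del + (C * (K + 1) * del + 2 * K / tau `^ kappa * del) by ring.
rewrite KE; split.
  by move=> t tT; apply: le_trans (HK' t tT) _; rewrite lerDl addr_ge0.
move=> s t sT tT; have [ts|ts] := leP `|t - s| tau.
  have := H D D' y y' del (K * del) T gD gD' sol sol' del0 A0 (ltW T0) (lexx _) DD' HK' s t sT tT ts.
  move=> /le_trans; apply; rewrite ler_wpM2r//.
  have -> : C * (K * del + del) = C * (K + 1) * del by ring.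
  by rewrite addrCA lerDl addr_ge0.
have : `|delta1 y s t - delta1 y' s t| <= 2 * (K * del).
  have -> : delta1 y s t - delta1 y' s t = (y t - y' t) - (y s - y' s).
    by rewrite /delta1; apply/colP => p; rewrite !mxE; ring.
  by apply: le_trans (ler_normB _ _) _; rewrite mulrDl mul1r lerD ?HK'.
move=> /le_trans; apply.
have th : tau `^ kappa <= hp s t.
  by rewrite /hp ge0_ler_powR ?nnegrE ?(ltW k0) ?(ltW tau0) ?(ltW ts).
apply: (@le_trans _ _ (2 * K / tau `^ kappa * del * hp s t)); last first.
  by rewrite ler_wpM2r// addrA lerDr addr_ge0.
rewrite [leRHS](_ : _ = 2 * (K * del) * (hp s t / tau `^ kappa)); last by ring.
by rewrite ler_peMr ?mulr_ge0// ler_pdivlMr// mul1r.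
Qed.

(** * Existence *)

Section Existence.
Variables (N : R) (D : drive).
Hypotheses (N_ge0 : 0 <= N) (gD : good_drive N D).

(** Quantitative, and for s <= t only: the form that the Euler limit provides and that can be glued.
    The reversed order is recovered by [rem_bounded_ordered]. *)
Definition partial_solution (c K : R) y : Prop :=
  [/\ y 0 = init D 0,
      forall s t, 0 <= s -> s <= t -> t <= c -> `|rem D y s t| <= K * (hp s t * hp s t) &
      forall a b, 0 <= a -> a < b -> b <= c -> no_delay_inside a b ->
        forall s t, a <= s -> s <= t -> t <= b ->
          `|jinc D y a s t| <= K * (hp s t * hp s t * hp s t)].

Lemma path_le (s t : R) : 0 <= s <= T -> 0 <= t <= T -> `|delta1 (path D) s t| <= N * hp s t.
Proof.
have [xN _ _ _] := gD; have rk0 : 0 <= r ord_max := delay_ge0 _.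
move=> /andP[s0 sT] /andP[t0 tT]; apply: xN; rewrite ?sT ?tT andbT.
  by rewrite (le_trans _ s0)// oppr_le0.
by rewrite (le_trans _ t0)// oppr_le0.
Qed.

(** By Chasles' relation over s, t, s the reversed remainder is the ordered one up to a product of
    two first-order increments, for which Hoelder continuity of y suffices. *)
Lemma rem_bounded_ordered (S K : R) y : 0 <= S -> S <= T -> y 0 = init D 0 -> 0 <= K ->
  (forall s t, 0 <= s -> s <= t -> t <= S -> `|rem D y s t| <= K * (hp s t * hp s t)) ->
  exists2 K', 0 <= K' & rem_bounded S T K' D y.
Proof.
move=> S0 ST y0 K0 HK.
pose g := d%:R * (M * N) + K * T `^ kappa.
have g0 : 0 <= g by rewrite addr_ge0 ?mulr_ge0 ?powR_ge0.
have inT (v : R) : 0 <= v <= S -> 0 <= v <= T by move=> /andP[-> /le_trans]; apply.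
have ordered (s t : R) : 0 <= s <= S -> 0 <= t <= S -> s <= t -> `|delta1 y s t| <= g * hp s t.
  move=> sS tS st.
  have -> : delta1 y s t = cf D y s *m delta1 (path D) s t + rem D y s t.
    by rewrite /rem addrC subrK.
  rewrite /g mulrDl; apply: le_trans (ler_normD _ _) _; apply: lerD.
    apply: le_trans (norm_mulmx_le _ _) _; rewrite -!mulrA ler_wpM2l// ler_pM//.
      exact: sigma_bound.
    by apply: path_le; exact: inT.
  have /andP[s0 _] := sS; have /andP[t0 tS'] := tS.
  apply: le_trans (HK _ _ s0 st tS') _; rewrite -mulrA ler_wpM2l// ler_wpM2r//.
  apply: hp_le => //; rewrite ger0_norm ?subr_ge0//.
  by rewrite lerBlDr (le_trans tS')// (le_trans ST)// lerDl.
have holder (s t : R) : 0 <= s <= S -> 0 <= t <= S -> `|t - s| <= T -> `|delta1 y s t| <= g * hp s t.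
  move=> sS tS _; have [st|/ltW ts] := leP s t; first exact: ordered.
  by rewrite hp_sym /delta1 distrC; exact: ordered.
pose g' := g + N * T `^ kappa.
have g'0 : 0 <= g' by rewrite addr_ge0 ?mulr_ge0 ?powR_ge0.
have norm_T (s t : R) : 0 <= s <= S -> 0 <= t <= S -> `|t - s| <= T.
  move=> /andP[s0 sS] /andP[t0 tS]; rewrite ler_norml lerBlDr lerBrDr.
  rewrite addrC lerBlDr (le_trans (le_trans sS ST))//=; last by rewrite lerDr.
  by rewrite (le_trans (le_trans tS ST))// lerDl.
exists (K + d%:R * (M * g' * N)); first by nneg.
move=> s t sS tS ts; rewrite mulrDl.
have /andP[s0 sS'] := sS; have /andP[t0 tS'] := tS.
have [st|/ltW ts'] := leP s t.
  by apply: le_trans (HK _ _ s0 st tS') _; rewrite lerDl; nneg.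
have -> : rem D y s t = - rem D y t s - (cf D y t - cf D y s) *m delta1 (path D) t s.
  have := rem_chasles D y s t s; rewrite remxx => /esym/eqP.
  by rewrite addrAC addr_eq0 => /eqP <-; rewrite addrK.
apply: le_trans (ler_normB _ _) _; rewrite normrN; apply: lerD.
  by rewrite hp_sym; exact: HK.
apply: le_trans (norm_mulmx_le _ _) _.
have -> : d%:R * (M * g' * N) * (hp s t * hp s t) = d%:R * ((M * g' * hp s t) * (N * hp s t)) by ring.
rewrite ler_wpM2l// ler_pM//.
  exact: (cf_incr_of N_ge0 gD y0 S0 ST g0 holder).
by rewrite hp_sym; apply: path_le; exact: inT.
Qed.

Lemma germE (Y : 'M[R]_(n, k.+1)) Z X W :
  germ sigma Y Z X W = sigma Y *m X + \col_p germ2 sigma Y Z W p.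
Proof. by apply/colP => p; rewrite !mxE. Qed.

Section Extend.
Variables (a b K : R) (y : R -> 'cV[R]_n).
Hypotheses (a_ge0 : 0 <= a) (ab : a < b) (bT : b <= T) (nd : no_delay_inside a b).
Hypothesis lag_le : forall i, i != ord0 -> b - r i <= a.
Hypotheses (K_ge0 : 0 <= K) (sol : partial_solution a K y).

(* While the delayed values are already known, the unknown is the current
   value v only. *)
Definition now_pt (s : R) (v : 'cV[R]_n) : 'M[R]_(n, k.+1) :=
  \matrix_(q, i) (if i == ord0 then v q 0 else ext D y (s - r i) q 0).
Definition now_lag (s : R) (v : 'cV[R]_n) (i : 'I_k.+1) : 'M[R]_(n, d) :=
  if r i <= a then (if i == ord0 then sigma (now_pt s v) else cf D y (s - r i)) else 0.
Definition now_germ (s t : R) (v : 'cV[R]_n) := germ sigma (now_pt s v) (now_lag s v)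
  (delta1 (path D) s t) (fun i => levy D i s t).
Definition now_cfg (s u t : R) (v w : 'cV[R]_n) :=
  Cfg (now_pt s v) (now_pt u w) (now_lag s v) (now_lag u w)
  (fun i => delta1 (path D) (s - r i) (u - r i)) (delta1 (path D) u t)
  (fun i => levy D i u t).

Lemma now_lag_bound s v i : `|now_lag s v i| <= M.
Proof.
rewrite /now_lag; case: ifP => _; last by rewrite normr0.
case: ifP => _; first exact: sigma_bound.
exact: sigma_bound.
Qed.

Lemma inT (s : R) : a <= s -> s <= b -> 0 <= s <= T.
Proof. by move=> as_ sb; rewrite (le_trans a_ge0)// (le_trans sb). Qed.

Lemma hp_T (s t : R) : a <= s -> s <= t -> t <= b -> hp s t <= T `^ kappa.
Proof.
move=> as_ st tb; apply: hp_le => //; rewrite ger0_norm ?subr_ge0//.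
by rewrite lerBlDr (le_trans tb)// (le_trans bT)// lerDl (le_trans a_ge0).
Qed.

Lemma now_second_order_diag (s t : R) v : second_order (now_cfg s s t v v) = 0.
Proof.
rewrite /second_order /= subrr sub0r; apply/eqP; rewrite oppr_eq0; apply/eqP/matrixP => q i.
by rewrite mxE /= /delta1 subrr mulmx0 !mxE.
Qed.

Lemma now_bounded_diag (s t : R) v : a <= s -> s <= t -> t <= b ->
  cfg_bounded (big_cst N) 1 (hp s t) (now_cfg s s t v v).
Proof.
move=> as_ st tb; have [xN lN _ _] := gD.
have Tk0 : 0 <= T `^ kappa by exact: powR_ge0.
have NC : N <= big_cst N by rewrite /big_cst -addrA lerDl addr_ge0.
have MC : M <= big_cst N by rewrite /big_cst addrAC lerDr addr_ge0.
have TC : T `^ kappa <= big_cst N by rewrite /big_cst lerDr addr_ge0.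
have C0 : 0 <= big_cst N := le_trans N_ge0 NC.
have tT : 0 <= t <= T by apply: inT => //; exact: le_trans st.
have sT : 0 <= s <= T by apply: inT => //; exact: le_trans tb.
have X0 (u : R) : delta1 (path D) u u = 0 by rewrite /delta1 subrr.
split=> //=.
- by rewrite hp_ge0/= (le_trans (hp_T as_ st tb)).
- by move=> i; split; exact: le_trans (now_lag_bound _ _ _) MC.
- move=> i; rewrite X0 normr0; split; first by nneg.
  by apply: le_trans (lN _ _ _ sT tT) _; rewrite ler_wpM2r ?mulr_ge0.
split.
- by apply: le_trans (path_le sT tT) _; rewrite ler_wpM2r.
- by rewrite now_second_order_diag normr0 mulr_ge0 ?mulr_ge0.
- by rewrite subrr normr0 mulr_ge0.
by move=> i; rewrite subrr normr0 mulr_ge0.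
Qed.

Lemma big_cst_ge0 : 0 <= big_cst N.
Proof. by rewrite !addr_ge0 ?powR_ge0. Qed.

Lemma now_germ2_bound : exists2 C, 0 <= C & forall (s t : R) v, a <= s -> s <= t -> t <= b ->
  `|now_germ s t v - sigma (now_pt s v) *m delta1 (path D) s t| <= C * (hp s t * hp s t).
Proof.
have [C C0 HC] := germ2_vec_bound big_cst_ge0.
exists C => // s t v as_ st tb; rewrite /now_germ germE addrC addKr.
exact: HC (now_bounded_diag v as_ st tb).
Qed.

Lemma now_germ_small : exists2 C, 0 <= C & forall (s t : R) v, a <= s -> s <= t -> t <= b ->
  `|now_germ s t v| <= C * hp s t.
Proof.
have [C C0 HC] := now_germ2_bound.
exists (d%:R * (M * N) + C * T `^ kappa); first by rewrite addr_ge0 ?mulr_ge0 ?powR_ge0.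
move=> s t v as_ st tb; rewrite -[now_germ s t v](subrK (sigma (now_pt s v) *m delta1 (path D) s t)).
rewrite addrC mulrDl; apply: le_trans (ler_normD _ _) _; apply: lerD.
  apply: le_trans (norm_mulmx_le _ _) _; rewrite -!mulrA ler_wpM2l// ler_pM//.
    exact: sigma_bound.
  by apply: path_le; apply: inT => //; [exact: le_trans tb|exact: le_trans st].
apply: le_trans (HC _ _ _ as_ st tb) _; rewrite -mulrA ler_wpM2l// ler_wpM2r//.
exact: hp_T.
Qed.

Lemma now_germ_refl (s : R) v : a <= s <= b -> now_germ s s v = 0.
Proof.
move=> /andP[as_ sb]; apply/eqP; rewrite -normr_le0.
have [C C0 HC] := now_germ_small; apply: le_trans (HC s s v as_ (lexx _) sb) _.
by rewrite hpxx mulr0.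
Qed.

Lemma now_pt_diff (s : R) v w : `|now_pt s v - now_pt s w| <= `|v - w|.
Proof.
apply: mx_norm_le => // q i; rewrite !mxE; case: ifP => _; last by rewrite subrr normr0.
by have := mx_norm_ge_entry (v - w) q 0; rewrite !mxE.
Qed.

Lemma now_lag_diff (s : R) v w i : `|now_lag s v i - now_lag s w i| <= M * `|v - w|.
Proof.
rewrite /now_lag; case: ifP => _; last by rewrite subrr normr0 mulr_ge0.
case: ifP => _; last by rewrite subrr normr0 mulr_ge0.
by apply: le_trans (sigma_lip _ _) _; rewrite ler_wpM2l// now_pt_diff.
Qed.

(** On the degenerate configuration u = s only points, densities and nothing else depend on v; (1 +
    M) |v - w| dominates both differences. *)
Lemma now_germ_lip : exists2 C, 0 <= C & forall (s t : R) v w, a <= s -> s <= t -> t <= b ->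
  `|now_germ s t v - now_germ s t w| <= C * `|v - w|.
Proof.
pose N' := big_cst N + 1.
have [C C0 HC] := germ2_vec_close N'.
have Tk0 : 0 <= T `^ kappa by exact: powR_ge0.
exists (d%:R * (M * (N * T `^ kappa)) + C * ((1 + M) * (T `^ kappa * T `^ kappa))).
  by nneg.
move=> s t v w as_ st tb.
have tT : 0 <= t <= T by apply: inT => //; exact: le_trans st.
have sT : 0 <= s <= T by apply: inT => //; exact: le_trans tb.
have hT := hp_T as_ st tb.
rewrite /now_germ !germE.
set g1 := \col_p _; set g2 := \col_p _.
rewrite (_ : _ - _ = (sigma (now_pt s v) - sigma (now_pt s w)) *m delta1 (path D) s t + (g1 - g2));
  last by rewrite mulmxBl opprD addrACA.
rewrite mulrDl; apply: le_trans (ler_normD _ _) _; apply: lerD.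
  apply: le_trans (norm_mulmx_le _ _) _; rewrite -!mulrA ler_wpM2l//.
  rewrite [leRHS](_ : _ = M * `|v - w| * (N * T `^ kappa)); last by ring.
  apply: ler_pM => //.
    by apply: le_trans (sigma_lip _ _) _; rewrite ler_wpM2l// now_pt_diff.
  by apply: le_trans (path_le sT tT) _; rewrite ler_wpM2l.
have bnd (u : 'cV[R]_n) : cfg_bounded N' N' (hp s t) (now_cfg s s t u u).
  apply: cfg_bounded_le (now_bounded_diag u as_ st tb); first by rewrite lerDl.
  by rewrite lerDr big_cst_ge0.
have vw0 : 0 <= `|v - w| by [].
have q1 : `|v - w| <= (1 + M) * `|v - w| by rewrite mulrDl mul1r lerDl mulr_ge0.
have q2 : M * `|v - w| <= (1 + M) * `|v - w| by rewrite mulrDl mul1r lerDr.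
have q0 : 0 <= (1 + M) * `|v - w| by nneg.
have cl : cfg_close N' ((1 + M) * `|v - w|) (hp s t) (now_cfg s s t v v) (now_cfg s s t w w).
  split=> //.
    split=> /=.
    - exact: le_trans (now_pt_diff _ _ _) q1.
    - exact: le_trans (now_pt_diff _ _ _) q1.
    - by move=> i; split; exact: le_trans (now_lag_diff _ _ _ _) q2.
    - by move=> i; rewrite subrr normr0 mulr_ge0.
    - by rewrite subrr normr0 mulr_ge0.
  split.
  - by move=> i /=; rewrite subrr normr0; nneg.
  - by rewrite !now_second_order_diag subrr normr0; nneg.
  - by rewrite /= !subrr normr0 mulr_ge0.
  - by move=> i /=; rewrite !subrr normr0 mulr_ge0.
apply: le_trans (HC _ _ _ _ cl) _; rewrite -!mulrA ler_wpM2l//.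
rewrite [leRHS](_ : _ = (1 + M) * (`|v - w| * (T `^ kappa * T `^ kappa))); last by ring.
by rewrite ler_wpM2l ?addr_ge0// ler_wpM2l// ler_pM.
Qed.

Lemma lag_in (s : R) i : i != ord0 -> a <= s -> s <= b -> - r ord_max <= s - r i <= a.
Proof.
move=> i0 as_ sb; rewrite (le_trans _ (lag_le i0)) ?lerD2r// andbT.
rewrite lerBrDr (le_trans _ (le_trans a_ge0 as_))// addrC subr_le0.
exact: delay_le_max.
Qed.

(** Source of the factor 1 + K (t - s)^kappa in [A_chen]. The column of the current value has as
    second-order part the error w - v - germ plus the area term; the error is K1 times order three,
    that is K1 hp times order two. The other columns come from the known solution or the initial
    path. *)
Lemma now_cfg_bounded : exists2 c, 1 <= c & forall (s u t K1 : R) v w,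
  a <= s -> s <= u -> u <= t -> t <= b -> 0 <= K1 ->
  `|w - v - now_germ s u v| <= K1 * (hp s u * hp s u * hp s u) ->
  cfg_bounded (big_cst N) (c * (1 + K1 * hp s t)) (hp s t) (now_cfg s u t v w).
Proof.
have [y0 ordered _] := sol; have aT : a <= T := le_trans (ltW ab) bT.
have [K' K'0 remK] := rem_bounded_ordered a_ge0 aT y0 K_ge0 ordered.
have [Cg Cg0 HCg] := now_germ2_bound; have [CA CA0 HCA] := now_germ_small.
pose G1 := incr_cst N T K'.
have N0 := N_ge0; have M0 := M_ge0.
have G10 : 0 <= G1 by exact: le_incr_cst.
pose e := T `^ kappa; have e0 : 0 <= e by exact: powR_ge0.
exists (1 + (K + N + 1 + Cg) + (1 + M) * (CA + e + G1)).
  by rewrite -addrA lerDl; nneg.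
set c := 1 + _ + _.
move=> s u t K1 v w as_ su ut tb K10 wv.
have [xN lN xiN _] := gD.
have NC : N <= big_cst N by rewrite /big_cst -addrA lerDl addr_ge0.
have MC : M <= big_cst N by rewrite /big_cst addrAC lerDr addr_ge0.
have TC : e <= big_cst N by rewrite /big_cst lerDr addr_ge0.
have C0 : 0 <= big_cst N := le_trans N_ge0 NC.
have ub : u <= b := le_trans ut tb.
have sb : s <= b := le_trans su ub.
have au : a <= u := le_trans as_ su.
have at_ : a <= t := le_trans au ut.
have tT : 0 <= t <= T by exact: inT.
have uT : 0 <= u <= T by exact: inT.
have sT : 0 <= s <= T by exact: inT.
have hsu : hp s u <= hp s t by exact: (hp_sub (lexx _) su ut).
have hut : hp u t <= hp s t by exact: (hp_sub su ut (lexx _)).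
have hsuT : hp s u <= e by exact: hp_T.
have hst0 := hp_ge0 s t; have hsu0 := hp_ge0 s u.
set x := K1 * hp s t; have x0 : 0 <= x by exact: mulr_ge0.
have xsu : K1 * hp s u <= x by rewrite ler_wpM2l.
pose Q := c * (1 + x).
have le_Q (p p' : R) : 0 <= p' -> p <= c -> p' <= c -> p + p' * x <= Q.
  move=> p0 pc pc'; rewrite /Q mulrDr mulr1; apply: lerD => //.
  by rewrite ler_wpM2r.
have M1G : 0 <= (1 + M) * (CA + e + G1) by nneg.
have KN : 0 <= K + N + 1 + Cg by have := K_ge0 => *; nneg.
have c1 : 1 <= c by rewrite /c -addrA lerDl addr_ge0.
have cK : K + N + 1 + Cg <= c.
  by apply: (@le_trans _ _ (1 + (K + N + 1 + Cg))); rewrite ?lerDr// /c lerDl.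
have cA : CA + e + G1 <= c.
  rewrite /c; apply: (@le_trans _ _ ((1 + M) * (CA + e + G1))); last by rewrite lerDr addr_ge0.
  by rewrite mulrDl mul1r lerDl; nneg.
have cMA : M * (CA + e + G1) <= c.
  rewrite /c; apply: (@le_trans _ _ ((1 + M) * (CA + e + G1))); last by rewrite lerDr addr_ge0.
  by rewrite mulrDl mul1r lerDr; nneg.
have CAx : CA + e * x + G1 <= (CA + e + G1) + (CA + e + G1) * x.
  have : 0 <= (CA + G1) * x by nneg.
  by move: e0; lra.
have wv1 : `|w - v| <= (CA + e * x) * hp s u.
  rewrite -[w - v](subrK (now_germ s u v)); apply: le_trans (ler_normD _ _) _.
  rewrite addrC mulrDl; apply: lerD; first exact: HCA.
  apply: le_trans wv _; rewrite mulrA ler_wpM2r// mulrA [leRHS]mulrC.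
  by apply: ler_pM; nneg.
have pt_incr_now : `|now_pt u w - now_pt s v| <= (CA + e * x + G1) * hp s u.
  apply: mx_norm_le => [|q i]; first by nneg.
  rewrite !mxE; case: ifPn => i0.
    apply: (@le_trans _ _ (`|w - v|)).
      by have := mx_norm_ge_entry (w - v) q 0; rewrite !mxE.
    by apply: le_trans wv1 _; rewrite ler_wpM2r// lerDl.
  apply: (@le_trans _ _ (`|delta1 (ext D y) (s - r i) (u - r i)|)).
    by have := mx_norm_ge_entry (delta1 (ext D y) (s - r i) (u - r i)) q 0; rewrite !mxE.
  apply: le_trans (ext_incr N_ge0 gD y0 a_ge0 aT K'0 remK
    (lag_in i0 as_ sb) (lag_in i0 au ub) _) _.
    rewrite opprB addrA subrK ger0_norm ?subr_ge0// lerBlDr.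
    by case/andP: uT => _ /le_trans; apply; rewrite lerDl; case/andP: sT.
  by rewrite hp_shift ler_wpM2r// lerDr; nneg.
have CAQ : CA + e * x + G1 <= Q by apply: (le_trans CAx); apply: le_Q => //; nneg.
have Q1 : 1 <= Q by apply: (le_trans c1); rewrite /Q ler_peMr ?lerDl// (le_trans ler01).
have Q0 : 0 <= Q := le_trans ler01 Q1.
split=> //=.
- by rewrite hp_ge0/= (le_trans (hp_T as_ (le_trans su ut) tb)).
- by move=> i; split; exact: le_trans (now_lag_bound _ _ _) MC.
- move=> i; split.
    apply: le_trans (xN _ _ (delay_shift i sT) (delay_shift i uT)) _.
    by rewrite hp_shift ler_pM.
  by apply: le_trans (lN _ _ _ uT tT) _; rewrite ler_pM ?mulr_ge0// ler_pM.
split.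
- by apply: le_trans (path_le uT tT) _; rewrite ler_pM.
- have KNQ : K + N + 1 + Cg + x <= Q.
    by rewrite -[x]mul1r; apply: le_Q.
  apply: (@le_trans _ _ ((K + N + 1 + Cg + x) * (hp s u * hp s u))); last first.
    by rewrite ler_pM ?addr_ge0 ?mulr_ge0// ler_pM.
  have K0 := K_ge0.
  apply: mx_norm_le => [|q i]; first by nneg.
  have [->|i0] := eqVneq i ord0.
    have -> : second_order (now_cfg s u t v w) q ord0 =
       ((w - v - now_germ s u v) + (now_germ s u v - sigma (now_pt s v) *m delta1 (path D) s u)) q 0.
      rewrite addrA subrK /second_order /first_order !mxE /=.
      by rewrite /now_lag delay0 a_ge0 eqxx !subr0.
    apply: le_trans (mx_norm_ge_entry _ _ _) _; apply: le_trans (ler_normD _ _) _.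
    rewrite addrC (_ : _ * _ = (K + N + 1) * (hp s u * hp s u) +
      Cg * (hp s u * hp s u) + x * (hp s u * hp s u)); last by ring.
    apply: lerD.
      apply: le_trans (HCg _ _ _ as_ su ub) _; rewrite lerDr; nneg.
    by apply: le_trans wv _; rewrite mulrA [leRHS]mulrA; rewrite !mulrA ler_wpM2r// ler_wpM2r.
  have -> : second_order (now_cfg s u t v w) q i =
      (if r i <= a then rem D y (s - r i) (u - r i)
       else delta1 (init D) (s - r i) (u - r i)) q 0.
    rewrite /second_order /first_order !mxE /= (negbTE i0) /now_lag (negbTE i0).
    have := no_delay_le i nd ab as_ sb; have := no_delay_le i nd ab au ub.
    case: ifP => _ ui si; first by rewrite !ext_ge0// /rem /delta1 !mxE.
    rewrite (ext_le0 y0 ui) (ext_le0 y0 si) /delta1 [X in _ - X]big1 ?subr0 ?mxE// => l _.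
    by rewrite mxE mul0r.
  apply: le_trans (mx_norm_ge_entry _ _ _) _.
  have := no_delay_le i nd ab as_ sb; have := no_delay_le i nd ab au ub.
  case: ifP => _ ui si.
    apply: le_trans (ordered _ _ si _ _) _.
    + by rewrite lerD2r.
    + by case/andP: (lag_in i0 au ub).
    rewrite hp_shift ler_wpM2r ?mulr_ge0// -!addrA lerDl; nneg.
  apply: le_trans (xiN _ _ _ _) _.
  + by rewrite si andbT; case/andP: (lag_in i0 as_ sb).
  + by rewrite ui andbT; case/andP: (lag_in i0 au ub).
  rewrite hp_shift ler_wpM2r ?mulr_ge0// -!addrA addrCA lerDl; nneg.
- apply: le_trans pt_incr_now _; apply: ler_pM => //; nneg.
move=> i.
have MQ : M * (CA + e * x + G1) <= Q.
  apply: (@le_trans _ _ (M * (CA + e + G1) + M * (CA + e + G1) * x)).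
    by rewrite -mulrA -mulrDr ler_wpM2l.
  by apply: le_Q => //; nneg.
apply: (@le_trans _ _ (M * (CA + e * x + G1) * hp s u)); last first.
  by apply: ler_pM => //; nneg.
rewrite /now_lag.
have := no_delay_le i nd ab as_ sb; have := no_delay_le i nd ab au ub.
case: ifP => _ ui si; last by rewrite subrr normr0; nneg.
case: ifPn => i0.
  by apply: le_trans (sigma_lip _ _) _; rewrite -mulrA ler_wpM2l.
have sa : 0 <= s - r i <= a by rewrite si; case/andP: (lag_in i0 as_ sb).
have ua : 0 <= u - r i <= a by rewrite ui; case/andP: (lag_in i0 au ub).
apply: le_trans (cf_incr N_ge0 gD y0 a_ge0 aT K'0 remK
    sa ua _) _.
  rewrite opprB addrA subrK ger0_norm ?subr_ge0// lerBlDr.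
  by case/andP: uT => _ /le_trans; apply; rewrite lerDl; case/andP: sT.
rewrite hp_shift ler_wpM2r// ler_wpM2l// lerDr; nneg.
Qed.

Lemma now_germ_chen : exists2 C, 0 <= C & forall (s u t K1 : R) v w,
  a <= s -> s <= u -> u <= t -> t <= b -> 0 <= K1 ->
  `|w - v - now_germ s u v| <= K1 * (u - s) `^ (3 * kappa) ->
  `|now_germ s t v - now_germ s u v - now_germ u t w| <=
    C * (1 + K1 * (t - s) `^ kappa) * (t - s) `^ (3 * kappa).
Proof.
have [c c1 Hc] := now_cfg_bounded; have [Cd Cd0 HCd] := defect_vec_bound big_cst_ge0.
exists (Cd * c); first by rewrite mulr_ge0// (le_trans ler01).
move=> s u t K1 v w as_ su ut tb K10.
have st := le_trans su ut; have ub := le_trans ut tb; have sb := le_trans su ub.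
have au := le_trans as_ su; have at_ := le_trans au ut.
have hE (p q : R) : p <= q -> (q - p) `^ (3 * kappa) = hp p q * hp p q * hp p q.
  by move=> pq; rewrite -hp3 ger0_norm ?subr_ge0.
rewrite hE// hE// => wv.
have -> : (t - s) `^ kappa = hp s t by rewrite /hp ger0_norm ?subr_ge0.
have := @germ_defect _ _ _ _ sigma (now_cfg s u t v w) (fun i => levy D i s u)
  (fun i => levy D i s t) (delta1 (path D) s u) (delta1 (path D) s t) _ _ => /=.
rewrite -/(now_germ s t v) -/(now_germ s u v) -/(now_germ u t w) => ->; first last.
- by have [_ _ _ chen] := gD => i l j; apply: chen; exact: inT.
- by rewrite /delta1 [RHS]addrC addrA subrK.
rewrite normrN; apply: le_trans (HCd _ _ _ (Hc _ _ _ _ _ _ as_ su ut tb K10 wv)) _.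
by rewrite !mulrA.
Qed.

Lemma now_solution : exists z K1, [/\ 0 <= K1, z a = y a &
  forall s t, a <= s -> s <= t -> t <= b ->
    `|z t - z s - now_germ s t (z s)| <= K1 * (hp s t * hp s t * hp s t)].
Proof.
have [C1 C10 H1] := now_germ_small; have [C2 C20 H2] := now_germ_lip.
have [C3 C30 H3] := now_germ_chen.
have le1 : C1 <= C1 + C2 + C3 by rewrite -addrA lerDl addr_ge0.
have le2 : C2 <= C1 + C2 + C3 by rewrite addrAC lerDr addr_ge0.
have le3 : C3 <= C1 + C2 + C3 by rewrite lerDr addr_ge0.
have hE (p q : R) : p <= q -> (q - p) `^ (3 * kappa) = hp p q * hp p q * hp p q.
  by move=> pq; rewrite -hp3 ger0_norm ?subr_ge0.
have [|||||z [K1 [K10 za Hz]]] := @euler_solution R n kappa (3 * kappa) a b (C1 + C2 + C3)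
  now_germ kappa_gt0 kappa3_gt1 ab _ _ _ _ _ (y a).
- by rewrite !addr_ge0.
- by move=> s v; exact: now_germ_refl.
- move=> s t v as_ st tb; apply: le_trans (H1 _ _ _ as_ st tb) _.
  by rewrite /hp ger0_norm ?subr_ge0// ler_wpM2r ?powR_ge0.
- by move=> s t v w as_ st tb; apply: le_trans (H2 _ _ _ _ as_ st tb) _; rewrite ler_wpM2r.
- move=> s u t K1 v w as_ su ut tb K10 wv.
  apply: le_trans (H3 _ _ _ _ _ _ as_ su ut tb K10 wv) _.
  by rewrite -!mulrA ler_wpM2r// mulr_ge0 ?powR_ge0 ?addr_ge0 ?mulr_ge0 ?powR_ge0.
by exists z, K1; split=> // s t as_ st tb; rewrite -hE//; exact: Hz.
Qed.

(** Old and new pieces are glued at a. Over an interval across a the remainder is cut by Chasles'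
    relation, and the increment minus the germ by its defect at a, which is of order three. *)
Lemma extension : exists y2 K2, 0 <= K2 /\ partial_solution b K2 y2.
Proof.
have [y0 ordered oldJ] := sol; have aT : a <= T := le_trans (ltW ab) bT.
have b0 : 0 <= b := le_trans a_ge0 (ltW ab).
have [K' K'0 remK] := rem_bounded_ordered a_ge0 aT y0 K_ge0 ordered.
have [Cg Cg0 HCg] := now_germ2_bound.
have [z [K1 [K10 za Hz]]] := now_solution.
pose e := T `^ kappa; have e0 : 0 <= e by exact: powR_ge0.
pose y2 t := if t <= a then y t else z t.
have y2l t : t <= a -> y2 t = y t by move=> ta; rewrite /y2 ta.
have y2r t : a <= t -> y2 t = z t.
  move=> at_; rewrite /y2; case: ifP => // ta.
  have -> : t = a by apply/eqP; rewrite eq_le ta.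
  by rewrite za.
clearbody y2.
have ext2 t : t <= a -> ext D y2 t = ext D y t.
  by move=> ta; rewrite /ext /extend y2l.
have pt2 t : t <= a -> pt D y2 t = pt D y t.
  move=> ta; apply/matrixP => q i; rewrite !mxE ext2//.
  by rewrite lerBlDr (le_trans ta)// lerDl delay_ge0.
have cf2 t : t <= a -> cf D y2 t = cf D y t by move=> ta; rewrite /cf pt2.
have rem2 s t : s <= a -> t <= a -> rem D y2 s t = rem D y s t.
  by move=> sa ta; rewrite /rem cf2// /delta1 !y2l.
have jinc2 a' s t : s <= a -> t <= a -> jinc D y2 a' s t = jinc D y a' s t.
  move=> sa ta; have lag2 : lag D y2 a' s = lag D y a' s.
    apply/funext => i; rewrite /lag cf2//.
    by rewrite lerBlDr (le_trans sa)// lerDl delay_ge0.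
  by rewrite /jinc /tgerm lag2 (pt2 s sa) /delta1 (y2l s sa) (y2l t ta).
have ptn s : a <= s -> s <= b -> pt D y2 s = now_pt s (z s).
  move=> as_ sb; apply/matrixP => q i; rewrite !mxE; case: ifPn => [/eqP->|i0].
    by rewrite delay0 subr0 ext_ge0 ?y2r// (le_trans a_ge0).
  by rewrite ext2//; case/andP: (lag_in i0 as_ sb).
have lagn s : a <= s -> s <= b -> lag D y2 a s = now_lag s (z s).
  move=> as_ sb; apply/funext => i; rewrite /lag /now_lag; case: ifP => // _.
  case: ifPn => [/eqP->|i0]; first by rewrite delay0 subr0 /cf ptn.
  by rewrite cf2//; case/andP: (lag_in i0 as_ sb).
have jincn s t : a <= s -> s <= t -> t <= b ->
    jinc D y2 a s t = z t - z s - now_germ s t (z s).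
  move=> as_ st tb; have sb := le_trans st tb.
  rewrite /jinc /tgerm (lagn s as_ sb) (ptn s as_ sb) /delta1 (y2r s as_).
  by rewrite (y2r t (le_trans as_ st)).
have Jab s t : a <= s -> s <= t -> t <= b ->
    `|jinc D y2 a s t| <= K1 * (hp s t * hp s t * hp s t).
  by move=> as_ st tb; rewrite jincn//; exact: Hz.
have remab s t : a <= s -> s <= t -> t <= b ->
    `|rem D y2 s t| <= (K1 * e + Cg) * (hp s t * hp s t).
  move=> as_ st tb; have sb := le_trans st tb; have at_ := le_trans as_ st.
  have -> : rem D y2 s t = (z t - z s - now_germ s t (z s)) +
      (now_germ s t (z s) - sigma (now_pt s (z s)) *m delta1 (path D) s t).
    by rewrite addrA subrK /rem /cf ptn// /delta1 !y2r.
  rewrite mulrDl; apply: le_trans (ler_normD _ _) _; apply: lerD; last exact: HCg.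
  apply: le_trans (Hz _ _ as_ st tb) _; rewrite -[leRHS]mulrA ler_wpM2l//.
  by rewrite -[leLHS]mulrA ler_wpM2r ?mulr_ge0 ?hp_ge0//; exact: hp_T.
pose G1 := incr_cst N T K'; have M0 := M_ge0; have N0 := N_ge0; have K0 := K_ge0.
have G10 : 0 <= G1 by exact: le_incr_cst.
pose K3 := K + (K1 * e + Cg) + d%:R * (M * G1 * N).
have K30 : 0 <= K3 by rewrite /K3; nneg.
have y20 : y2 0 = init D 0 by rewrite y2l.
have ordered2 s t : 0 <= s -> s <= t -> t <= b -> `|rem D y2 s t| <= K3 * (hp s t * hp s t).
  move=> s0 st tb; have st0 : 0 <= hp s t * hp s t by nneg.
  have [ta|/ltW at_] := leP t a.
    have sa := le_trans st ta.
    rewrite rem2//; apply: le_trans (ordered _ _ s0 st ta) _.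
    by rewrite ler_wpM2r// /K3 -addrA lerDl; nneg.
  have [as_|/ltW sa] := leP a s.
    apply: le_trans (remab _ _ as_ st tb) _.
    by rewrite ler_wpM2r// /K3 addrAC lerDr; nneg.
  have hsa : hp s a <= hp s t by exact: (hp_sub (lexx _) sa at_).
  have hat : hp a t <= hp s t by exact: (hp_sub sa at_ (lexx _)).
  rewrite (rem_chasles D y2 s a t) /K3 !mulrDl.
  apply: le_trans (ler_normD _ _) _; apply: lerD.
    apply: le_trans (ler_normD _ _) _; apply: lerD.
      rewrite rem2//; apply: le_trans (ordered _ _ s0 sa (lexx _)) _.
      by rewrite ler_wpM2l// ler_pM.
    apply: le_trans (remab _ _ (lexx _) at_ tb) _; rewrite -mulrDl ler_wpM2l ?ler_pM//; nneg.
  apply: le_trans (norm_mulmx_le _ _) _.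
  rewrite [leRHS](_ : _ = d%:R * (M * G1 * hp s t * (N * hp s t))); last by ring.
  rewrite ler_wpM2l//; apply: ler_pM => //.
    rewrite !cf2//; apply: le_trans (cf_incr N_ge0 gD y0 a_ge0 aT
      K'0 remK _ _ _) _.
    - by rewrite s0.
    - by rewrite a_ge0 lexx.
    - by rewrite ger0_norm ?subr_ge0// lerBlDr (le_trans aT)// lerDl.
    by rewrite ler_wpM2l//; nneg.
  apply: le_trans (path_le _ _) _; first exact: inT (lexx _) (ltW ab).
    exact: inT at_ tb.
  by rewrite ler_wpM2l.
(* The defect at the times s, a, t involves the glued path on both sides of a, so its remainder must
   be bounded on all of [0, b] first. *)
have [K4 K40 rem4] := rem_bounded_ordered b0 bT y20 K30 ordered2.
have [Cd Cd0 HCd] := defect_vec_bound big_cst_ge0.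
pose G2 := incr_cst N T K4; have G20 : 0 <= G2 by exact: le_incr_cst.
pose Q := 1 + (K4 + N + (G2 + M * G2)).
have MG2 : 0 <= M * G2 by exact: mulr_ge0.
have [Q1 Q2 Q3 Q4] : [/\ 1 <= Q, K4 + N <= Q, G2 <= Q & M * G2 <= Q].
  by rewrite /Q; split; lra.
have Q0 : 0 <= Q := le_trans ler01 Q1.
pose K2 := K + K1 + Cd * Q + K3.
have K2K : K + K1 + Cd * Q <= K2 by rewrite lerDl.
have KK : K <= K + K1 + Cd * Q by rewrite -addrA lerDl; nneg.
have K1K : K1 <= K + K1 + Cd * Q by rewrite addrAC lerDr; nneg.
have CdQ : 0 <= Cd * Q by nneg.
exists y2, K2; split; first by rewrite /K2; nneg.
split=> //.
  move=> s t s0 st tb; apply: le_trans (ordered2 _ _ s0 st tb) _.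
  by rewrite ler_wpM2r ?mulr_ge0// /K2 lerDr; nneg.
move=> a' b' a'0 a'b' b'b nd' s t as_ st tb'.
have hp30 p q : 0 <= hp p q * hp p q * hp p q by nneg.
apply: (@le_trans _ _ ((K + K1 + Cd * Q) * (hp s t * hp s t * hp s t))); last by rewrite ler_wpM2r.
have tb := le_trans tb' b'b; have s0 := le_trans a'0 as_.
(* The lagged densities depend on the left endpoint, but no delay separates a' from a: both
   intervals are free of delays and b' lies beyond a. *)
have lag_eq : a < b' -> forall s', lag D y2 a' s' = lag D y2 a s'.
  move=> ab' s'; apply/funext => i; rewrite /lag.
  have -> : (r i <= a') = (r i <= a); last by [].
  have := nd' i; have := nd i; rewrite !negb_and -!leNgt => n1 n2.
  apply/idP/idP => h.
    by case/orP: n1 => // br; move: (lt_le_trans (lt_le_trans a'b' b'b) (le_trans br h)); rewrite ltxx.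
  by case/orP: n2 => // br; move: (lt_le_trans ab' (le_trans br h)); rewrite ltxx.
have jinc_eq s' t' : a < b' -> jinc D y2 a' s' t' = jinc D y2 a s' t'.
  by move=> ab'; rewrite /jinc /tgerm lag_eq.
have [ta|at_] := leP t a.
  have sa := le_trans st ta.
  rewrite jinc2//.
  have [b'a|ab'] := leP b' a.
    apply: le_trans (oldJ _ _ a'0 a'b' b'a nd' _ _ as_ st tb') _; by rewrite ler_wpM2r.
  (* With t <= a <= a' <= s the interval [s, t] is a single point. *)
  have [a'a|aa'] := ltP a' a; last first.
    have -> : t = s by apply/eqP; rewrite eq_le st (le_trans ta (le_trans aa' as_)).
    rewrite -jinc2 ?sa// (_ : jinc D y2 a' s s = 0) ?normr0 ?mulr_ge0//; first by nneg.
    rewrite jinc_eq//; have sa' : a <= s := le_trans aa' as_.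
    have sb := le_trans st tb.
    apply/eqP; rewrite -normr_le0; apply: le_trans (Jab s s sa' (lexx _) sb) _.
    by rewrite hpxx !mulr0.
  have nda : no_delay_inside a' a.
    by move=> i; apply: contra (nd' i) => /andP[-> /lt_trans]; apply.
  by apply: le_trans (oldJ _ _ a'0 a'a (lexx _) nda _ _ as_ st ta) _; rewrite ler_wpM2r.
have ab' := lt_le_trans at_ tb'.
have [as'|sa] := leP a s.
  by rewrite jinc_eq//; apply: le_trans (Jab _ _ as' st tb) _; rewrite ler_wpM2r.
have a'a := le_lt_trans as_ sa.
have nda : no_delay_inside a' a.
  by move=> i; apply: contra (nd' i) => /andP[-> /lt_trans]; apply.
(* Here s < a < t: the first term belongs to the old piece, the second to the new one, the third is
   the defect. *)
have -> : jinc D y2 a' s t = jinc D y2 a' s a + jinc D y2 a' a t + delta2 (jinc D y2 a') s a t.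
  by rewrite /delta2; apply/colP => p; rewrite !mxE; ring.
have hsa : hp s a <= hp s t by exact: (hp_sub (lexx _) (ltW sa) (ltW at_)).
have hat : hp a t <= hp s t by exact: (hp_sub (ltW sa) (ltW at_) (lexx _)).
rewrite !mulrDl; apply: le_trans (ler_normD _ _) _; apply: lerD.
  apply: le_trans (ler_normD _ _) _; apply: lerD.
    rewrite jinc2 ?(ltW sa)//; apply: le_trans (oldJ _ _ a'0 a'a (lexx _) nda _ _ as_ (ltW sa) (lexx _)) _.
    by rewrite ler_wpM2l// ler_pM ?mulr_ge0// ler_pM.
  rewrite jinc_eq//; apply: le_trans (Jab _ _ (lexx _) (ltW at_) tb) _.
  by rewrite ler_wpM2l// ler_pM ?mulr_ge0// ler_pM.
have tT : 0 <= t <= T by rewrite (le_trans s0 st) (le_trans tb).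
have sT : 0 <= s <= T by rewrite s0 (le_trans (le_trans st tb)).
have aT' : 0 <= a <= T by rewrite a_ge0.
rewrite (jinc_delta2 y2 a' gD sT aT' tT).
rewrite -[leRHS]mulrA; apply: HCd.
apply: (tcfg_good (b := b') N_ge0 gD y20 b0 bT K40 (ltW T_gt0) rem4) => //.
- exact: ltW.
- exact: ltW.
by rewrite lerBlDr (le_trans aT)// lerDl.
Qed.

End Extend.

Lemma partial_solution0 : partial_solution 0 0 (fun=> init D 0).
Proof.
split=> // [s t s0 st t0|a b a0 ab b0]; last first.
  by have := lt_le_trans (le_lt_trans a0 ab) b0; rewrite ltxx.
have -> : t = 0 by apply/eqP; rewrite eq_le t0 (le_trans s0).
have -> : s = 0 by apply/eqP; rewrite eq_le s0 (le_trans st).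
by rewrite remxx normr0 mul0r.
Qed.

(** A step has length at most the smallest gap g. If it contains a delay r_i, the solution is
    brought up to r_i first; both [max(0, r_i - g), r_i] and [r_i, c] are then free of interior
    delays. *)
Lemma partial_solution_exists : exists y K, 0 <= K /\ partial_solution T K y.
Proof.
have [g g0 gP] := delay_gap.
have main m : forall c : R, 0 <= c <= T -> c <= m%:R * g ->
    exists y K, 0 <= K /\ partial_solution c K y.
  elim: m => [|m IH] c /andP[c0 cT] cm.
    have -> : c = 0 by apply/eqP; rewrite eq_le c0 andbT (le_trans cm)// mul0r.
    by exists (fun=> init D 0), 0; split=> //; exact: partial_solution0.
  (* Every positive delay is at least g = gap to r_0 = 0, so [b - g <= a] means that the delayed
     times lie in the known part. *)
  have step a b : 0 <= a -> a < b -> b <= T -> b - g <= a -> no_delay_inside a b ->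
      (exists y K, 0 <= K /\ partial_solution a K y) ->
      exists y K, 0 <= K /\ partial_solution b K y.
    move=> a0 ab bT bga nd [y [K [K0 sol]]].
    apply: (extension a0 ab bT nd _ K0 sol) => i i0.
    apply: le_trans bga; rewrite lerB//.
    have := gP i ord0 i0; rewrite delay0 subr0 ger0_norm//.
    exact: delay_ge0.
  have far (b : R) : 0 <= b -> b <= c -> no_delay_inside (Num.max 0 (b - g)) b ->
      exists y K, 0 <= K /\ partial_solution b K y.
    move=> b0 bc nd; have [->|bn0] := eqVneq b 0.
      by exists (fun=> init D 0), 0; split=> //; exact: partial_solution0.
    have bT := le_trans bc cT.
    apply: (step (Num.max 0 (b - g)) b) => //.
    - by rewrite le_max lexx.
    - by rewrite gt_max lt_neqAle eq_sym bn0 b0/= gtrBl.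
    - by rewrite le_max lexx orbT.
    apply: IH.
      by rewrite le_max lexx/= ge_max (ltW T_gt0) (le_trans _ bT)// gerBl ltW.
    rewrite ge_max mulr_ge0//=; last exact: ltW.
    rewrite lerBlDr (le_trans bc)// (le_trans cm)// -natr1 mulrDl mul1r//.
  have [nd|] := pselect (no_delay_inside (Num.max 0 (c - g)) c); first exact: far.
  move=> /existsNP[i /negP]; rewrite negbK gt_max => /andP[/andP[ri0 cri] ric].
  have near_gap j : (r i - g < r j < r i + g) -> j = i.
    move=> /andP[h1 h2]; apply/eqP/negPn/negP => ji.
    by have := gP j i ji; rewrite leNgt => /negP; apply; rewrite ltr_norml; lra.
  apply: (step (r i) c) => //; first exact: ltW.
  - exact: ltW.
  - move=> j; apply/negP => /andP[h1 h2]; have ji : j = i by apply: near_gap; lra.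
    by move: h1; rewrite ji ltxx.
  apply: far; [exact: ltW|exact: ltW|].
  move=> j; apply/negP; rewrite gt_max => /andP[/andP[h0 h1] h2].
  have ji : j = i by apply: near_gap; lra.
  by move: h2; rewrite ji ltxx.
have [m Tm] : exists m : nat, T <= m%:R * g.
  exists (Num.bound (T / g)); rewrite -ler_pdivrMr//.
  by have := archi_boundP (divr_ge0 (ltW T_gt0) (ltW g0)) => /ltW.
by apply: (main m) => //; rewrite (ltW T_gt0) lexx.
Qed.

End Existence.

(** * Solutions and germs *)

Lemma mem_itvcc (a b t : R) : (t \in `[a, b]) = (a <= t <= b).
Proof. by rewrite in_itv. Qed.

Section Fixed.
Variables (x : R -> 'cV[R]_d) (area : 'I_k.+1 -> R -> R -> 'M[R]_d) (xi : R -> 'cV[R]_n).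
Local Notation D := (Drive x area xi).
Variables (y : R -> 'cV[R]_n) (zeta : R -> 'M[R]_(n, d)).
Hypothesis zetaE : forall t, t \in `[0, T] -> zeta t = coefficient sigma r xi y t.
Local Notation m := (coefficient sigma r xi y).

Section Piece.
Variables (a b : R).
Hypotheses (ab : a < b) (bT : b <= T) (nd : no_delay_inside a b).
Local Notation dens := (coefficient_density sigma r xi y zeta a).

Lemma densityE i p j l s : a <= s <= b ->
  dens i p j l s = dens_val sigma (pt D y s) (lag D y a s) i p j l.
Proof.
move=> /andP[as_ sb]; rewrite /coefficient_density /dens_val /lag.
have := no_delay_le i nd ab as_ sb; case: ifP => _ si; last first.
  by rewrite big1// => q _; rewrite mxE mulr0.
apply: eq_bigr => q _; rewrite zetaE// mem_itvcc si.
have := delay_ge0 i; have := bT; lra.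
Qed.

Lemma remainderE p j s t u : a <= s <= b ->
  remainder r x m dens p j s t = coef_rem sigma (tcfg D y a s t u) p j.
Proof.
move=> sab; rewrite /remainder /coef_rem; congr (_ - _).
by apply: eq_bigr => i _; apply: eq_bigr => l _; rewrite densityE.
Qed.

Lemma dens_incrE i p j l s t u : a <= s <= b -> a <= t <= b ->
  delta1 (dens i p j l) s t = dens_incr sigma (tcfg D y a s t u) i p j l.
Proof. by move=> sab tab; rewrite /delta1 !densityE. Qed.

Lemma integral_defectE p s u t : a <= s <= b -> a <= u <= b ->
  integral_defect r x area m dens p s u t = defect sigma (tcfg D y a s u t) p.
Proof.
move=> sab uab; rewrite /integral_defect /defect; congr (_ + _).
  by apply: eq_bigr => j _; rewrite (remainderE p j u t sab).
apply: eq_bigr => i _; apply: eq_bigr => j _; apply: eq_bigr => l _.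
by rewrite (dens_incrE i p j l t sab uab).
Qed.

Lemma delayed_integralE s t : a <= s <= b ->
  delayed_integral a b r x area m dens s t =
  tgerm D y a s t + \col_p Lambda a b (integral_defect r x area m dens p) s t.
Proof.
move=> sab; apply/colP => p; rewrite !mxE; congr (_ + _ + _).
rewrite /germ2; apply: eq_bigr => i _; apply: eq_bigr => j _; apply: eq_bigr => l _.
by rewrite densityE.
Qed.

End Piece.
End Fixed.

(** On a solution the increment minus the germ is a value of [Lambda], hence o(t - s) whatever the
    defect is. *)
Lemma is_solution_germ x area xi y zeta :
  is_solution kappa T r sigma x area xi y zeta ->
  germ_solution (Drive x area xi) y /\
  forall t, 0 <= t <= T -> zeta t = cf (Drive x area xi) y t.
Proof.
move=> [[y_holder y0 z_holder R_holder] zE sol].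
have zE' t : 0 <= t <= T -> zeta t = cf (Drive x area xi) y t.
  by move=> tT; apply: zE; rewrite mem_itvcc.
split=> //; split=> //.
  move=> a b a0 ab bT nd.
  have nd' i : r i \notin `]a, b[ by rewrite in_itv; exact: nd.
  have [_ Hint] := sol a b a0 ab bT nd'.
  apply: small_increment_col => p.
  have oL := small_increment_Lambda (integral_defect r x area (coefficient sigma r xi y)
    (coefficient_density sigma r xi y zeta a) p) ab.
  move=> e e0; have [del del0 Hdel] := oL e e0; exists del => // s t as_ st tb ts.
  have := Hint s t as_ st tb.
  rewrite (delayed_integralE x area zE ab bT nd t) ?as_ ?(le_trans st)// => E.
  apply: le_trans (Hdel s t as_ st tb ts).
  rewrite /jinc E (addrC (tgerm _ _ _ _ _)) addrK !mxE.
  exact: lexx.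
have [B B0 HB] := holderC2_bound T_gt0 R_holder.
exists B => // s t sT tT _; rewrite -hp2 /rem -zE'//.
by apply: HB; rewrite mem_itvcc.
Qed.

(** The increment minus the germ has the defect as its [delta2] and is of order 3 kappa > 1, so it
    is itself a sewing of the defect; uniqueness identifies it with [Lambda]. *)
Lemma germ_is_solution N x area xi y K : 0 <= N -> 0 <= K ->
  good_drive N (Drive x area xi) -> partial_solution (Drive x area xi) T K y ->
  is_solution kappa T r sigma x area xi y (cf (Drive x area xi) y).
Proof.
move=> N0 K0; set D := Drive x area xi => gD psol.
have [y0 ordered oldJ] := psol; have T0 := T_gt0.
have [B B0 remB] := rem_bounded_ordered N0 gD
  (ltW T_gt0) (lexx _) y0 K0 ordered.
have k0 := kappa_gt0.
have Tdist (s t : R) : 0 <= s <= T -> 0 <= t <= T -> `|t - s| <= T.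
  by move=> sT tT; rewrite ler_norml; lra.
pose G1 := incr_cst N T B; have G10 : 0 <= G1 by exact: le_incr_cst.
have M0 := M_ge0.
have z_holder (s t : R) : 0 <= s <= T -> 0 <= t <= T ->
    `|cf D y t - cf D y s| <= M * G1 * hp s t.
  move=> sT tT; apply: (cf_incr N0 gD y0 (ltW T_gt0) (lexx _)
    B0 remB) => //; exact: Tdist.
have zE t : t \in `[0, T] -> cf D y t = coefficient sigma r xi y t by [].
split=> //.
  split=> //.
  - apply: (@holderC1_intro _ _ kappa 0 T (d%:R * (M * N) + B * T `^ kappa)) => //.
      by rewrite addr_ge0 ?mulr_ge0 ?powR_ge0.
    move=> s t; rewrite !mem_itvcc => sT tT.
    exact: (y_incr gD (ltW T_gt0) (lexx _) B0 remB sT tT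
      (Tdist _ _ sT tT)).
  - apply: (@holderC1_intro _ _ kappa 0 T (M * G1)) => //.
    exact: mulr_ge0.
  - apply: (@holderC2_intro _ _ (2 * kappa) 0 T B); first exact: mulr_gt0.
    by move=> s t; rewrite !mem_itvcc hp2 => sT tT; apply: remB => //; exact: Tdist.
move=> a b a0 ab bT nd'.
have nd : no_delay_inside a b by move=> i; have := nd' i; rewrite in_itv.
pose Q := 1 + (B + N + (G1 + M * G1)).
have MG1 : 0 <= M * G1 by nneg.
have [Q1 Q2 Q3 Q4] : [/\ 1 <= Q, B + N <= Q, G1 <= Q & M * G1 <= Q].
  by rewrite /Q; split; lra.
pose N' := big_cst N.
have Tk0 : 0 <= T `^ kappa by exact: powR_ge0.
have [N'N N'M N'T] : [/\ N <= N', M <= N' & T `^ kappa <= N'].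
  by rewrite /N' /big_cst; split; lra.
have N'0 : 0 <= N' := le_trans N0 N'N.
have inT (s : R) : a <= s <= b -> 0 <= s <= T by move=> sab; lra.
have bnd (s u t th : R) : a <= s <= b -> a <= u <= b -> a <= t <= b ->
    hp s u <= th -> hp u t <= th -> th <= N' ->
    cfg_bounded N' Q th (tcfg D y a s u t).
  move=> sab uab tab h1 h2 h3.
  case/andP: (sab) => as_ sb; case/andP: (uab) => au ub; case/andP: (tab) => at_ tb.
  apply: (tcfg_bounded N0 gD y0 (ltW T_gt0) (lexx _) B0 remB
    (a := a) (b := b)) => //.
  by apply: Tdist; exact: inT.
have hpT (s t : R) : a <= s <= b -> a <= t <= b -> hp s t <= N'.
  by move=> sab tab; apply: le_trans N'T; apply: hp_le => //; apply: Tdist; exact: inT.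
have [Cd Cd0 HCd] := defect_vec_bound N'0.
split.
  split.
  - apply: (@holderC1_intro _ _ kappa a b (M * G1)) => //.
    by move=> s t; rewrite !mem_itvcc => sab tab; apply: z_holder; exact: inT.
  - move=> i p j l.
    have [C C0 HC] := dom_dens_incr sigmaM N' i p j l.
    apply: (@holderC1_intro _ _ kappa a b (C * Q)) => //.
      by rewrite mulr_ge0// (le_trans ler01).
    move=> s t; rewrite !mem_itvcc => sab tab.
    have := dens_incrE x area zE ab bT nd i p j l t sab tab; rewrite /delta1 => ->.
    rewrite -mulrA; apply: (HC (tcfg D y a s t t, Q, hp s t)).
    by apply: bnd => //; [rewrite hpxx hp_ge0|exact: hpT].
  - move=> p j; have [C C0 HC] := dom_coef_rem sigmaM N' p j.
    apply: (@holderC2_intro _ _ (2 * kappa) a b (C * Q)); first exact: mulr_gt0.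
    move=> s t; rewrite !mem_itvcc hp2 => sab tab.
    rewrite (remainderE x area zE ab bT nd p j t t sab) -mulrA.
    apply: (HC (tcfg D y a s t t, Q, hp s t)).
    by apply: bnd => //; [rewrite hpxx hp_ge0|exact: hpT].
move=> s t as_ st tb.
have sab : a <= s <= b by rewrite as_ (le_trans st).
rewrite (delayed_integralE x area zE ab bT nd t sab).
suff -> : \col_p Lambda a b (integral_defect r x area (coefficient sigma r xi y)
    (coefficient_density sigma r xi y (cf D y) a) p) s t = jinc D y a s t.
  by rewrite /jinc addrC subrK.
apply/colP => p; rewrite mxE.
apply: (@Lambda_unique _ a b _ (fun s t => jinc D y a s t p 0)) => //.
have jd (s' u' t' : R) : a <= s' <= b -> a <= u' <= b -> a <= t' <= b ->
    delta2 (jinc D y a) s' u' t' = \col_p defect sigma (tcfg D y a s' u' t') p.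
  by move=> ? ? ?; apply: (jinc_delta2 y a gD); exact: inT.
split; last first.
  move=> s' u' t'; rewrite !mem_itvcc => sab' uab' tab'.
  rewrite (integral_defectE x area zE ab bT nd p t' sab' uab').
  have /colP/(_ p) := jd _ _ _ sab' uab' tab'.
  by rewrite /delta2 !mxE.
exists (3 * kappa); first exact: kappa3_gt1.
apply: (@holderC2_intro _ _ (3 * kappa) a b (K + Cd * Q)); first exact: mulr_gt0.
move=> s' t'; rewrite !mem_itvcc hp3 => sab' tab'.
apply: (@le_trans _ _ `|jinc D y a s' t'|).
  exact: (mx_norm_ge_entry (jinc D y a s' t') p 0).
have Q0 : 0 <= Q := le_trans ler01 Q1.
have ordJ (p' q' : R) : a <= p' <= b -> a <= q' <= b -> p' <= q' ->
    `|jinc D y a p' q'| <= K * (hp p' q' * hp p' q' * hp p' q').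
  by move=> /andP[h1 h2] /andP[h3 h4] pq; exact: (oldJ a b).
have [st'|/ltW ts'] := leP s' t'.
  apply: le_trans (ordJ _ _ sab' tab' st') _; rewrite ler_wpM2r ?mulr_ge0// lerDl; nneg.
have Jss : jinc D y a s' s' = 0.
  apply/eqP; rewrite -normr_le0; apply: le_trans (ordJ s' s' sab' sab' (lexx _)) _.
  by rewrite hpxx !mulr0.
(* The reversed order again: [delta2] at the times s', t', s' is a defect of order three. *)
have -> : jinc D y a s' t' = - jinc D y a t' s' - delta2 (jinc D y a) s' t' s'.
  by rewrite /delta2 Jss; apply/colP => q; rewrite !mxE; ring.
rewrite mulrDl; apply: le_trans (ler_normB _ _) _; rewrite normrN; apply: lerD.
  by rewrite hp_sym; apply: ordJ.
rewrite jd// -[leRHS]mulrA; apply: HCd; apply: bnd => //; last exact: hpT.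
by rewrite hp_sym.
Qed.

End DelayEquation.

(** * Passage from gamma to kappa, and assembly of the theorem *)

Section Exponents.
Context {R : realType} {n d k : nat}.
Variables (r : 'I_k.+1 -> R) (T kappa gamma : R).
Variable sigma : 'M[R]_(n, k.+1) -> 'M[R]_(n, d).
Hypotheses (r_delays : is_delays r) (T_gt0 : 0 < T) (kappa_gt : 3^-1 < kappa).
Hypotheses (kappa_lt : kappa < gamma) (k_gt0 : (0 < k)%N).

Local Notation hp := (hp kappa).
Local Notation drive := (@drive R n d k).
Local Notation rmax := (r ord_max).
Implicit Type D : drive.

(** Since k >= 1 the initial interval is nondegenerate, so that its Hoelder seminorm is a supremum
    over a nonempty set. *)
Lemma rmax_gt0 : 0 < rmax.
Proof. by rewrite -[ltLHS](delay0 r_delays); have [_] := r_delays; apply. Qed.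

(** The costs of lowering the exponents of x, of the areas and of the initial path: powers of the
    lengths of their intervals. *)
Local Notation L1 := ((T + rmax) `^ (gamma - kappa)).
Local Notation L2 := (T `^ (2 * gamma - 2 * kappa)).
Local Notation L3 := (rmax `^ (2 * gamma - 2 * kappa)).

Lemma path_exponent (V : normedModType R) (B : R) (h : R -> R -> V) : 0 <= B ->
  (forall s t, s \in `[- rmax, T] -> t \in `[- rmax, T] -> `|h s t| <= B * `|t - s| `^ gamma) ->
  forall s t : R, - rmax <= s <= T -> - rmax <= t <= T -> `|h s t| <= B * L1 * hp s t.
Proof.
move=> B0 hB s t sT tT; apply: le_trans (hB s t _ _) _; rewrite ?mem_itvcc//.
rewrite -mulrA ler_wpM2l//; apply: powR_exponent_le => //; first exact: ltW.
  exact: kappa_gt0.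
by rewrite ler_norml; lra.
Qed.

Lemma levy_exponent (V : normedModType R) (B : R) (h : R -> R -> V) : 0 <= B ->
  (forall s t, s \in `[0, T] -> t \in `[0, T] -> `|h s t| <= B * `|t - s| `^ (2 * gamma)) ->
  forall s t : R, 0 <= s <= T -> 0 <= t <= T -> `|h s t| <= B * L2 * (hp s t * hp s t).
Proof.
move=> B0 hB s t sT tT; apply: le_trans (hB s t _ _) _; rewrite ?mem_itvcc//.
rewrite -hp2 -mulrA ler_wpM2l//; have k0 := kappa_gt0 kappa_gt; have kg := kappa_lt.
apply: powR_exponent_le => //; [lra|lra|].
by rewrite ler_norml; lra.
Qed.

Lemma init_exponent (V : normedModType R) (B : R) (h : R -> R -> V) : 0 <= B ->
  (forall s t, s \in `[- rmax, 0] -> t \in `[- rmax, 0] -> `|h s t| <= B * `|t - s| `^ (2 * gamma)) ->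
  forall s t : R, - rmax <= s <= 0 -> - rmax <= t <= 0 -> `|h s t| <= B * L3 * (hp s t * hp s t).
Proof.
move=> B0 hB s t sT tT; apply: le_trans (hB s t _ _) _; rewrite ?mem_itvcc//.
rewrite -hp2 -mulrA ler_wpM2l//; have k0 := kappa_gt0 kappa_gt; have kg := kappa_lt.
apply: powR_exponent_le => //; [lra|lra|].
by rewrite ler_norml; lra.
Qed.

Lemma good_drive_intro (N B1 B2 : R) x area xi :
  0 <= B1 -> 0 <= B2 -> B1 * L1 <= N -> B2 * L2 <= N ->
  is_delayed_levy_area gamma T r x area ->
  (forall s t, s \in `[- rmax, T] -> t \in `[- rmax, T] ->
     `|delta1 x s t| <= B1 * `|t - s| `^ gamma) ->
  (forall i s t, s \in `[0, T] -> t \in `[0, T] ->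
     `|area i s t| <= B2 * `|t - s| `^ (2 * gamma)) ->
  (forall s t : R, - rmax <= s <= 0 -> - rmax <= t <= 0 ->
     `|delta1 xi s t| <= N * (hp s t * hp s t)) ->
  good_drive r T kappa N (Drive x area xi : drive).
Proof.
move=> B10 B20 B1N B2N levy_area xB aB xiN; split=> //=.
- move=> s t sT tT; apply: le_trans (path_exponent B10 xB sT tT) _.
  by rewrite ler_wpM2r// hp_ge0.
- move=> i s t sT tT; apply: le_trans (levy_exponent B20 (aB i) sT tT) _.
  by rewrite ler_wpM2r// mulr_ge0 ?hp_ge0.
move=> i s u t sT uT tT l j; have [_ /(_ s u t)] := levy_area i.
rewrite !mem_itvcc => /(_ sT uT tT l j) <-; rewrite /delta2 !mxE; ring.
Qed.

End Exponents.

Theorem theorem4p2 (R : realType) (n d k : nat) (r : 'I_k.+1 -> R)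
    (T kappa gamma : R) (sigma : 'M[R]_(n, k.+1) -> 'M[R]_(n, d))
    (n_gt0 : (0 < n)%N) (d_gt0 : (0 < d)%N) (k_gt0 : (0 < k)%N)
    (r_delays : is_delays r) (T_gt0 : 0 < T)
    (kappa_gt : 3^-1 < kappa) (kappa_lt : kappa < gamma)
    (sigma_Cb3 : Cb 3 sigma) :
  (forall (x : R -> 'cV[R]_d) (area : 'I_k.+1 -> R -> R -> 'M[R]_d)
      (xi : R -> 'cV[R]_n),
    holderC1 gamma (- r ord_max) T x ->
    is_delayed_levy_area gamma T r x area ->
    holderC1 (2 * kappa) (- r ord_max) 0 xi ->
    exists (y : R -> 'cV[R]_n) (zeta : R -> 'M[R]_(n, d)),
      is_solution kappa T r sigma x area xi y zeta /\
      forall (y' : R -> 'cV[R]_n) (zeta' : R -> 'M[R]_(n, d)),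
        is_solution kappa T r sigma x area xi y' zeta' ->
        forall t, t \in `[0, T] -> y' t = y t /\ zeta' t = zeta t) /\
  (forall N : R, 0 < N ->
    exists2 K : R, 0 < K &
    forall (x x' : R -> 'cV[R]_d) (area area' : 'I_k.+1 -> R -> R -> 'M[R]_d)
        (xi xi' y y' : R -> 'cV[R]_n) (zeta zeta' : R -> 'M[R]_(n, d)),
      holderC1 gamma (- r ord_max) T x ->
      is_delayed_levy_area gamma T r x area ->
      holderC1 (2 * gamma) (- r ord_max) 0 xi ->
      holderC1 gamma (- r ord_max) T x' ->
      is_delayed_levy_area gamma T r x' area' ->
      holderC1 (2 * gamma) (- r ord_max) 0 xi' ->
      is_solution kappa T r sigma x area xi y zeta ->
      is_solution kappa T r sigma x' area' xi' y' zeta' ->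
      (\sum_(i < k.+1) holder_seminorm (2 * gamma) 0 T (area i) +
       \sum_(i < k.+1) holder_seminorm (2 * gamma) 0 T (area' i) +
       holder_norm gamma (- r ord_max) T x +
       holder_norm gamma (- r ord_max) T x' +
       holder_norm (2 * gamma) (- r ord_max) 0 xi +
       holder_norm (2 * gamma) (- r ord_max) 0 xi' <= N%:E)%E ->
      (holder_norm kappa 0 T (fun t => (y t - y' t)%R) <=
       K%:E * (holder_norm gamma (- r ord_max) T (fun t => (x t - x' t)%R) +
               \sum_(i < k.+1)
                 holder_seminorm (2 * gamma) 0 T
                   (fun s t => (area i s t - area' i s t)%R) +
               holder_norm (2 * gamma) (- r ord_max) 0
                 (fun t => (xi t - xi' t)%R)))%E).
Proof.
have T0 := T_gt0.
have [M0 sigmaM0] : exists M, smooth_coef sigma M.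
  have /choice[M HM] : forall pj : 'I_n * 'I_d, exists M, smooth 3 M (fun z => sigma z pj.1 pj.2).
    by move=> pj; exact: smooth_Cb (Cb_entry _ _ sigma_Cb3).
  have M0 pj : 0 <= M pj by exact: smooth_ge0 (HM pj).
  exists (\sum_p \sum_j M (p, j)) => p j; apply: smooth_le (HM (p, j)).
  rewrite (bigD1 p)//= (bigD1 j)//= -addrA lerDl addr_ge0// ?sumr_ge0// => q _.
  exact: sumr_ge0.
pose M := Num.max 0 M0; have M_ge0 : 0 <= M by rewrite le_max lexx.
have sigmaM : smooth_coef sigma M.
  by move=> p j; apply: smooth_le (sigmaM0 p j); rewrite le_max lexx orbT.
have k0 := kappa_gt0 kappa_gt; have g0 : 0 < gamma := lt_trans k0 kappa_lt.
have rm0 : 0 < r ord_max := rmax_gt0 r_delays k_gt0.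
have rmT : - r ord_max < T by apply: lt_trans T0; rewrite oppr_lt0.
have rm0' : - r ord_max < 0 by rewrite oppr_lt0.
pose L1 := (T + r ord_max) `^ (gamma - kappa).
pose L2 := T `^ (2 * gamma - 2 * kappa).
pose L3 := r ord_max `^ (2 * gamma - 2 * kappa).
have L10 : 0 <= L1 by exact: powR_ge0.
have L20 : 0 <= L2 by exact: powR_ge0.
have L30 : 0 <= L3 by exact: powR_ge0.
split.
  move=> x area xi x_holder levy_area xi_holder.
  have [B1 B10 HB1] := holderC1_bound rmT x_holder.
  have [B3 B30 HB3] := holderC1_bound rm0' xi_holder.
  have /choice[b2 Hb2] : forall i, exists b, 0 <= b /\ forall s t, s \in `[0, T] -> t \in `[0, T] ->
      `|area i s t| <= b * `|t - s| `^ (2 * gamma).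
    move=> i; have [/(holderC2_bound T0)[b b0 Hb] _] := levy_area i.
    by exists b.
  pose B2 := \sum_i b2 i.
  have B20 : 0 <= B2 by apply: sumr_ge0 => i _; case: (Hb2 i).
  have HB2 i s t : s \in `[0, T] -> t \in `[0, T] -> `|area i s t| <= B2 * `|t - s| `^ (2 * gamma).
    move=> sT tT; apply: le_trans ((Hb2 i).2 s t sT tT) _; rewrite ler_wpM2r ?powR_ge0//.
    by rewrite /B2 (bigD1 i)//= lerDl sumr_ge0// => j _; case: (Hb2 j).
  (* In this part xi is given at the exponent 2 kappa, so B3 carries no power of the length. *)
  pose N := B1 * L1 + B2 * L2 + B3.
  have [N1 N2 N3] : [/\ 0 <= B1 * L1, 0 <= B2 * L2 & 0 <= N] by rewrite /N; split; nneg.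
  have gD : good_drive r T kappa N (Drive x area xi : @drive R n d k).
    apply: (good_drive_intro kappa_gt kappa_lt B10 B20) => //.
    - by rewrite /N -addrA lerDl addr_ge0.
    - by rewrite /N addrAC lerDr addr_ge0.
    move=> s t sT tT; rewrite -hp2; apply: le_trans (HB3 s t _ _) _; rewrite ?mem_itvcc//.
    by rewrite ler_wpM2r ?powR_ge0// /N lerDr addr_ge0.
  have [y [K [K0 psol]]] := partial_solution_exists r_delays T_gt0 kappa_gt sigmaM M_ge0 N3 gD.
  have sol := germ_is_solution r_delays T_gt0 kappa_gt sigmaM M_ge0 N3 K0 gD psol.
  exists y, (cf r sigma (Drive x area xi) y); split=> // y' zeta' sol'.
  have [gsol zE] := is_solution_germ r_delays T_gt0 sol.
  have [gsol' zE'] := is_solution_germ r_delays T_gt0 sol'.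
  have [Ks Ks0 Hs] := stability r_delays T_gt0 kappa_gt sigmaM M_ge0 N3.
  (* Uniqueness is stability for data at distance 0. *)
  have [|Hy _] := Hs _ _ y' y 0 gD gD gsol' gsol (lexx 0).
    by split=> *; rewrite subrr normr0 ?mul0r.
  have yE t : 0 <= t <= T -> y' t = y t.
    by move=> tT; have := Hy t tT; rewrite mulr0 normr_le0 subr_eq0 => /eqP.
  move=> t tT'; have tT : 0 <= t <= T by move: tT'; rewrite mem_itvcc.
  split; first exact: yE.
  rewrite zE'//; congr sigma; apply/matrixP => q i; rewrite !mxE.
  rewrite /ext /extend; case: ifPn => //; rewrite -leNgt => ti; rewrite yE// ti.
  have := delay_ge0 r_delays i; lra.
move=> N N0.
pose N' := N * L1 + N * L2 + N * L3.
have N'0 : 0 <= N' by rewrite /N'; have := ltW N0 => N00; nneg.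
have [Ks Ks0 Hs] := stability r_delays T_gt0 kappa_gt sigmaM M_ge0 N'0.
(* The 1 accounts for the sup distance of the initial paths, which involves no exponent. *)
pose L := L1 + L2 + L3 + 1.
have L0 : 0 <= L by rewrite /L; nneg.
(* The sup norm and the seminorm of y - y' each cost Ks L; the 1 makes the constant positive. *)
exists (2 * (Ks * L) + 1); first by rewrite ltr_wpDl//; nneg.
move=> x x' area area' xi xi' y y' zeta zeta' hx ax hxi hx' ax' hxi' sol sol' small.
have [gsol _] := is_solution_germ r_delays T_gt0 sol.
have [gsol' _] := is_solution_germ r_delays T_gt0 sol'.
have semi0 (V : normedModType R) (mu : R) (h : R -> R -> V) :
  (0 <= holder_seminorm mu 0 T h)%E by exact: holder_seminorm_ge0.
have sum0 (mu : R) (f : 'I_k.+1 -> R -> R -> 'M[R]_d) :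
    (0 <= \sum_(i < k.+1) holder_seminorm mu 0 T (f i))%E by exact: sume_ge0.
have norm0 (V : normedModType R) (mu a b : R) (f : R -> V) : a < b -> (0 <= holder_norm mu a b f)%E.
  by move=> ab; rewrite adde_ge0 ?sup_norm_ge0 ?holder_seminorm_ge0// ltW.
have sum_le (mu B : R) (f : 'I_k.+1 -> R -> R -> 'M[R]_d) i :
    (\sum_(i < k.+1) holder_seminorm mu 0 T (f i) <= B%:E ->
     holder_seminorm mu 0 T (f i) <= B%:E)%E.
  apply: le_trans; rewrite (bigD1 i)//= leeDl// sume_ge0 => // j _; exact: semi0.
have norm_le (V : normedModType R) (mu a b B : R) (f : R -> V) : a < b ->
    (holder_norm mu a b f <= B%:E)%E ->
    (holder_seminorm mu a b (delta1 f) <= B%:E)%E /\ (sup_norm a b f <= B%:E)%E.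
  move=> ab fB; split; apply: le_trans fB.
    by rewrite leeDr// sup_norm_ge0// ltW.
  by rewrite leeDl// holder_seminorm_ge0.
have good x1 (area1 : 'I_k.+1 -> R -> R -> 'M[R]_d) (xi1 : R -> 'cV[R]_n) :
    is_delayed_levy_area gamma T r x1 area1 ->
    (holder_norm gamma (- r ord_max) T x1 <= N%:E)%E ->
    (\sum_(i < k.+1) holder_seminorm (2 * gamma) 0 T (area1 i) <= N%:E)%E ->
    (holder_norm (2 * gamma) (- r ord_max) 0 xi1 <= N%:E)%E ->
    good_drive r T kappa N' (Drive x1 area1 xi1).
  move=> ax1 xN aN xiN; have N00 := ltW N0.
  have [xN' _] := norm_le _ _ _ _ _ _ rmT xN; have [xiN' _] := norm_le _ _ _ _ _ _ rm0' xiN.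
  apply: (good_drive_intro kappa_gt kappa_lt N00 N00) => //.
  - by rewrite /N' -addrA lerDl; nneg.
  - by rewrite /N' addrAC lerDr; nneg.
  - by apply: le_holder_seminorm => // t _; rewrite /delta1 subrr.
  - move=> i; apply: le_holder_seminorm => //; last exact: sum_le aN.
    by have [[]] := ax1 i.
  move=> s t sT tT; apply: (@le_trans _ _ (N * L3 * (hp kappa s t * hp kappa s t))).
    apply: (init_exponent kappa_gt kappa_lt N00) => //.
    by apply: le_holder_seminorm => // u _; rewrite /delta1 subrr.
  rewrite ler_wpM2r ?mulr_ge0 ?hp_ge0// /N' lerDr; nneg.
(* All summands are nonnegative extended reals, so the bound N on the sum passes to each of them. *)
have x0 := norm0 _ gamma _ _ x rmT; have x'0 := norm0 _ gamma _ _ x' rmT.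
have xi0 := norm0 _ (2 * gamma) _ _ xi rm0'; have xi'0 := norm0 _ (2 * gamma) _ _ xi' rm0'.
have a0 := sum0 (2 * gamma) area; have a'0 := sum0 (2 * gamma) area'.
have addl (u v : \bar R) : (0 <= v -> u + v <= N%:E -> u <= N%:E)%E.
  by move=> v0; apply: le_trans; rewrite leeDl.
have addr (u v : \bar R) : (0 <= u -> u + v <= N%:E -> v <= N%:E)%E.
  by move=> u0; apply: le_trans; rewrite leeDr.
have small5 := addl _ _ xi'0 small; have small4 := addl _ _ xi0 small5.
have small3 := addl _ _ x'0 small4; have small2 := addl _ _ x0 small3.
have gD : good_drive r T kappa N' (Drive x area xi).
  apply: good => //; [|exact: addl small2|].
    exact: (addr _ _ (adde_ge0 a0 a'0) small3).
  exact: (addr _ _ (adde_ge0 (adde_ge0 (adde_ge0 a0 a'0) x0) x'0) small5).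
have gD' : good_drive r T kappa N' (Drive x' area' xi').
  apply: good => //; [|exact: addr small2|].
    exact: (addr _ _ (adde_ge0 (adde_ge0 a0 a'0) x0) small4).
  exact: (addr _ _ (adde_ge0 (adde_ge0 (adde_ge0 (adde_ge0 a0 a'0) x0) x'0) xi0) small).
set X := holder_norm gamma _ _ _; set A := (\sum_(i < k.+1) _)%E; set Z := holder_norm (2 * gamma) _ _ _.
have X0 : (0 <= X)%E by exact: norm0.
have A0 : (0 <= A)%E by exact: (sum0 _ (fun i s t => (area i s t - area' i s t)%R)).
have Z0 : (0 <= Z)%E by exact: norm0.
have : (0 <= X + A + Z)%E := adde_ge0 (adde_ge0 X0 A0) Z0.
(* If the distance of the data is infinite, positivity of the constant makes the right-hand side
   infinite too. *)
case E : (X + A + Z)%E => [del| |]//; last first.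
  by rewrite gt0_muley ?leey// lte_fin ltr_wpDl//; nneg.
rewrite lee_fin => del0.
have XAZ : (X + A + Z <= del%:E)%E by rewrite E.
have Xdel : (X <= del%:E)%E by apply: le_trans XAZ; rewrite -addeA leeDl// adde_ge0.
have Adel : (A <= del%:E)%E.
  by apply: le_trans XAZ; rewrite addeAC leeDr// adde_ge0.
have Zdel : (Z <= del%:E)%E by apply: le_trans XAZ; rewrite leeDr// adde_ge0.
have [Xs _] := norm_le _ _ _ _ _ _ rmT Xdel.
have [Zs Zn] := norm_le _ _ _ _ _ _ rm0' Zdel.
have dL (c : R) : c <= L -> del * c <= L * del by move=> cL; rewrite mulrC ler_wpM2r.
have deltaB (m : nat) (f g : R -> 'cV[R]_m) (s t : R) :
    delta1 f s t - delta1 g s t = delta1 (fun t => f t - g t) s t.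
  by rewrite /delta1; apply/colP => p; rewrite !mxE; ring.
have Ldel0 : 0 <= L * del by exact: mulr_ge0.
have DD' : drive_close r T kappa (L * del) (Drive x area xi) (Drive x' area' xi').
  split=> /=.
  - move=> s t sT tT; rewrite deltaB.
    apply: le_trans (path_exponent kappa_gt kappa_lt del0 _ sT tT) _.
      by apply: le_holder_seminorm => // u _; rewrite /delta1 subrr.
    rewrite ler_wpM2r ?hp_ge0//; apply: dL; rewrite /L -!addrA lerDl; nneg.
  - move=> i s t sT tT.
    apply: le_trans (levy_exponent kappa_gt kappa_lt
      (h := fun s t => area i s t - area' i s t) del0 _ sT tT) _.
      apply: le_holder_seminorm => //.
        move=> u uT; have [[a1 _] _] := ax i; have [[a2 _] _] := ax' i.
        by rewrite a1// a2// subrr.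
      exact: (sum_le _ _ (fun i s t => area i s t - area' i s t)).
    rewrite ler_wpM2r ?mulr_ge0 ?hp_ge0//; apply: dL; rewrite /L -!addrA addrCA lerDl; nneg.
  - move=> t tT; apply: (@le_trans _ _ del).
      by apply: (le_sup_norm Zn); rewrite mem_itvcc.
    by rewrite ler_peMl// /L lerDr; nneg.
  - move=> s t sT tT; rewrite deltaB.
    apply: le_trans (init_exponent kappa_gt kappa_lt del0 _ sT tT) _.
      by apply: le_holder_seminorm => // u _; rewrite /delta1 subrr.
    rewrite ler_wpM2r ?mulr_ge0 ?hp_ge0//; apply: dL.
    by rewrite /L [_ + L3]addrC -addrA lerDl; nneg.
have [Hy1 Hy2] := Hs _ _ y y' _ gD gD' gsol gsol' Ldel0 DD'.
apply: (@le_trans _ _ ((Ks * (L * del)) + (Ks * (L * del)))%:E).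
  rewrite EFinD; apply: leeD.
    by apply: sup_norm_le => t; rewrite mem_itvcc; exact: Hy1.
  apply: holder_seminorm_le => s t; rewrite !mem_itvcc -deltaB; exact: Hy2.
rewrite -EFinM lee_fin.
have -> : (2 * (Ks * L) + 1) * del = Ks * (L * del) + Ks * (L * del) + del by ring.
by rewrite lerDl.
Qed.
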